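(* Let $P(\mathbf{w})=A+B\sum_{i=1}^d|w_i|^{r_i}$, where $A,B\ge0$ and $r_i\geq 0$, $i=1,\ldots,d$. Let $f$ be the solution (given in the context) of the $\mathrm{MVN}(\mathbf 0,\Sigma)$ Stein equation with test function $h(g(\cdot))$. (1) Suppose $\Sigma$ is non-negative definite and $h\in C_b^n(\mathbb{R})$ and $g\in C_P^n(\mathbb{R}^d)$ for $n\geq 1$. Let $Z_i=(\Sigma^{1/2}\mathbf{Z})_i\sim N(0,\sigma_{ii}^2)$. Then, for all $\mathbf{w}\in\mathbb{R}^d$, $$\bigg|\frac{\partial^nf(\mathbf{w})}{\prod_{j=1}^n\partial w_{i_j}}\bigg|\leq\frac{h_n}{n}\bigg[A+B\sum_{i=1}^d2^{r_i}\big(|w_i|^{r_i}+\mathbb{E}|Z_i|^{r_i}\big)\bigg].$$ (2) Suppose now that $\Sigma$ is positive definite and $h\in C_b^{n-1}(\mathbb{R})$ and $g\in C_P^{n-1}(\mathbb{R}^d)$ for $n\geq 2$. Then, for all $\mathbf{w}\in\mathbb{R}^d$, $$ \bigg|\frac{\partial^{n}f(\mathbf{w})}{\prod_{j=1}^{n}\partial w_{i_j}}\bigg|\leq h_{n-1}\min_{1\leq l\leq d} \bigg[A\mathbb{E}|(\Sigma^{-1/2}\mathbf{Z})_l|+B\sum_{i=1}^d2^{r_i}\big(|w_i|^{r_i}\mathbb{E}|(\Sigma^{-1/2}\mathbf{Z})_l|+\mathbb{E}|(\Sigma^{-1/2}\mathbf{Z})_lZ_i^{r_i}|\big)\bigg].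 $$ (3) Suppose now, in (2), that $\Sigma=I_d$. Then we have the simplified bound $$\bigg|\frac{\partial^{n}f(\mathbf{w})}{\prod_{j=1}^{n}\partial w_{i_j}}\bigg|\leq h_{n-1} \bigg[A+B\sum_{i=1}^d2^{r_i}\big(|w_i|^{r_i}+\mathbb{E}|Z|^{r_i+1}\big)\bigg].$$ (4) Consider now the case $d=1$ with $\Sigma=1$. Suppose $h\in C_b^{n-2}(\mathbb{R})$ and $g\in C_P^{n-2}(\mathbb{R})$, where $n\geq 3$ and $P(w)=A+B|w|^r$, $r\geq0$. Then, for all $w\in\mathbb{R}$, $$|f^{(n)}(w)|\leq h_{n-2}\Big[3A+2^rB\big(|w|^{r+1}+2|w|^r+|w|\mathbb{E}|Z|^{r+1}+\mathbb{E}|Z|^r\big)\Big].$$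
   Context: $\mathbf Z\sim N(\mathbf 0,I_d)$, $Z\sim N(0,1)$; $(\cdot)_l$ denotes the $l$-th component; $\sigma_{ii}^2$ denotes the variance of $(\Sigma^{1/2}\mathbf Z)_i$; $i_1,\ldots,i_n\in\{1,\ldots,d\}$. The Stein equation is $\nabla^T\Sigma\nabla f(\mathbf{w})-\mathbf{w}^T\nabla f(\mathbf{w})=h(g(\mathbf{w}))-\mathbb{E}h(g(\Sigma^{1/2}\mathbf{Z}))$, and the solution considered is $$f(\mathbf{w})=-\int_{0}^{\infty}\big[\mathbb{E}h(g(\mathrm{e}^{-s}\mathbf{w}+\sqrt{1-\mathrm{e}^{-2s}}\,\Sigma^{1/2}\mathbf{Z}))-\mathbb{E}h(g(\Sigma^{1/2}\mathbf{Z}))\big]\,\mathrm{d}s.$$ $\|u\|$ is the supremum norm. $h\in C_b^n(\mathbb{R})$ means that $h^{(n-1)}$ exists and is absolutely continuous, with derivatives up to $n$-th order bounded. $g\in C_P^n(\mathbb{R}^d)$ means that all $n$-th order partial derivatives of $g:\mathbb R^d\to\mathbb R$ exist and $\big|\frac{\partial^k g(\mathbf w)}{\prod_{j=1}^k\partial w_{i_j}}\big|^{n/k}\le P(\mathbf w)$ for all $\mathbf w\in\mathbb R^d$ and $k=1,\ldots,n$. $h_n:=\sum_{k=1}^n{n\brace k}\|h^{(k)}\|$ with ${n\brace k}$ the Stirling numbers of the second kind.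
   Formalization: In (2) the minimum is over l in {i_1,…,i_n}, since over 1≤l≤d the bound fails for d≥2; in (1) and (4) the bound is for points where the n-th derivative of f exists, shown if the top derivative of h exists (in (4), at g(w)) or, in (1), Σ is positive definite. *)

(* Defs.v *)
From HB Require Import structures.
From mathcomp Require Import all_boot all_order all_algebra.
From mathcomp Require Import all_classical all_reals all_analysis.
Set Implicit Arguments.
Unset Strict Implicit.
Unset Printing Implicit Defensive.
Import Order.TTheory GRing.Theory Num.Theory.
Import numFieldNormedType.Exports.
Local Open Scope classical_set_scope.
Local Open Scope ring_scope.

(* Stirling numbers of the second kind. *)
Fixpoint stirling2 (n k : nat) : nat :=
  match n, k with
  | 0, 0 => 1
  | 0, _.+1 => 0
  | _.+1, 0 => 0
  | n'.+1, k'.+1 => (k * stirling2 n' k + stirling2 n' k')%N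
  end.

Section FunctionClasses.
Variable R : realType.

Definition locally_absolutely_continuous (F : R -> R) : Prop :=
  forall a b e : R, 0 < e -> exists2 dl : R, 0 < dl &
    forall (m : nat) (x y : 'I_m -> R),
      (forall k, a <= x k /\ x k <= y k /\ y k <= b) ->
      trivIset setT (fun k => `]x k, y k[%classic) ->
      \sum_k (y k - x k) < dl -> \sum_k `|F (y k) - F (x k)| < e.

(* The library derivatives [derive1n k h] and ['D_v u] are total, with value 0 where
   the limit of the difference quotients does not exist.  Hence
   [supnorm (derive1n k h)] and the bound in [in_Cb] only see the points where
   the derivative exists, which for k = n is almost everywhere. *)
Definition supnorm (u : R -> R) : R := sup (range (fun x => `|u x|)).

(* The n-th derivative of h is only required to exist almost everywhere (which
   absolute continuity of h^(n-1) provides); h itself need not be bounded. *)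
Definition in_Cb (n : nat) (h : R -> R) : Prop :=
  [/\ forall k x, (k < n.-1)%N -> derivable (derive1n k h) x 1,
      locally_absolutely_continuous (derive1n n.-1 h) &
      forall k, (0 < k <= n)%N -> exists M : R, forall x, `|derive1n k h x| <= M].

Definition hnorm (n : nat) (h : R -> R) : R :=
  \sum_(1 <= k < n.+1) (stirling2 n k)%:R * supnorm (derive1n k h).

Variable d : nat.
Implicit Types (f g P : 'cV[R]_d -> R) (w : 'cV[R]_d).

(* [partials [:: i_1; ...; i_n] f] is d/dw_{i_1} (... (d/dw_{i_n} f)). *)
Definition partials (s : seq 'I_d) f : 'cV[R]_d -> R :=
  foldr (fun i u => 'D_(delta_mx i 0) u) f s.

(* All partial derivatives of f of order at most n exist everywhere. *)
Definition partials_exist (n : nat) f : Prop :=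
  forall (s : seq 'I_d) (i : 'I_d) w,
    (size s < n)%N -> derivable (partials s f) w (delta_mx i 0).

Definition in_CP (n : nat) P g : Prop :=
  partials_exist n g /\
  forall (s : seq 'I_d) w, (0 < size s <= n)%N ->
    `|partials s g w| `^ (n%:R / (size s)%:R) <= P w.

(* [0 `^ 0 = 1], so the i-th summand is constantly 1 when r i = 0. *)
Definition Ppow (A B : R) (r : 'I_d -> R) w : R :=
  A + B * \sum_i `|w i 0| `^ r i.

End FunctionClasses.

Section Matrices.
Variables (R : realType) (d : nat).
Implicit Type M : 'M[R]_d.

Definition nonneg_definite M : Prop :=
  M^T = M /\ forall v : 'cV[R]_d, 0 <= (v^T *m M *m v) 0 0.

Definition pos_definite M : Prop :=
  M^T = M /\ forall v : 'cV[R]_d, v != 0 -> 0 < (v^T *m M *m v) 0 0.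

(* S = M^{1/2}: the (unique) non-negative definite square root of M. *)
Definition is_sqrtmx M (S : 'M[R]_d) : Prop :=
  nonneg_definite S /\ S *m S = M.

End Matrices.

(* Minimum of F over the entries of a nonempty list (0 on the empty list). *)
Definition min_over (R : realType) (I : Type) (s : seq I) (F : I -> R) : R :=
  if s is l :: s' then \big[Num.min/F l]_(l' <- s') F l' else 0.

(* E|Z|^p for a scalar Z ~ N(0,1). *)
Definition normal_absmoment (R : realType) (p : R) : R :=
  fine ('E_(normal_prob 0%R 1%R)[fun x : R => (`|x| `^ p)%R])%E.

Section Gaussian.
Context (R : realType) (dT : measure_display) (T : measurableType dT).
Variable Pr : probability T R.

(* All the expectations in use are finite. *)
Definition Ex (X : T -> R) : R := fine ('E_Pr[X])%E.

Definition is_std_normal (X : {RV Pr >-> R}) : Prop :=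
  forall A : set R, measurable A -> distribution Pr X A = normal_prob 0 1 A.

Definition mutually_independent (d : nat) (Z : 'I_d -> {RV Pr >-> R}) : Prop :=
  forall (J : {set 'I_d}) (A : 'I_d -> set R),
    (forall i, measurable (A i)) ->
    Pr (\bigcap_(i in [set` J]) (Z i @^-1` A i)) =
      (\prod_(i in J) Pr (Z i @^-1` A i))%E.

(* (Z_1, ..., Z_d) ~ N(0, I_d). *)
Definition std_normal_vector (d : nat) (Z : 'I_d -> {RV Pr >-> R}) : Prop :=
  (forall i, is_std_normal (Z i)) /\ mutually_independent Z.

Definition rvec (d : nat) (Z : 'I_d -> {RV Pr >-> R}) (t : T) : 'cV[R]_d :=
  \col_i Z i t.

(* The solution of the MVN(0, S ^ 2) Stein equation with test function phi,
   where S is the square root of the covariance matrix. *)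
Definition stein_solution (d : nat) (Z : 'I_d -> {RV Pr >-> R})
    (S : 'M[R]_d) (phi : 'cV[R]_d -> R) (w : 'cV[R]_d) : R :=
  - \int[lebesgue_measure]_(s in `[0%R, +oo[)
      (Ex (fun t => phi (expR (- s) *: w +
             Num.sqrt (1 - expR (- (2 * s))) *: (S *m rvec Z t)))
       - Ex (fun t => phi (S *m rvec Z t))).

End Gaussian.

(* Main.v *)
(** Write phi = h o g and P_s for the Ornstein-Uhlenbeck semigroup, so that
    f = - int_0^oo (P_s phi - E phi) ds.  Since the top derivative of h exists
    only almost everywhere, everything is phrased with increments: by absolute
    continuity and Faa di Bruno's formula the increments of the partial
    derivatives of phi of order m are bounded, on the scale of the step, by
    h_(m+1) P.

    Each derivative commutes with P_s up to a factor e^(-s), and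
    int_0^oo e^(-ns) ds = 1/n gives (1).  When Sigma is invertible, Gaussian
    integration by parts turns one derivative into the weight
    e^(-s) (1 - e^(-2s))^(-1/2) (Sigma^(-1/2) Z)_l; with
    int_0^oo e^(-2s) (1 - e^(-2s))^(-1/2) ds = 1 this gives (2) and (3).

    For (4) put theta = phi^(n-3), y = int_0^oo e^(-(n-3)s) (P_s theta - c) ds,
    W = y' and V = W', where c = E theta if n = 3 and c = 0 otherwise; up to
    sign, W and V are f^(n-2) and f^(n-1).  Then
    V = x W + (n-3) y - theta + c, hence f^(n) = theta' - (x V + (n-2) W).
    A maximum principle shows that the operator theta |-> x V + (n-2) W is
    nonnegative on nondecreasing functions.  Applied to G + theta and
    G - theta, where G' dominates theta', it bounds x V + (n-2) W by the same
    expression for G, which is computed by the formulas of (1) and (2).  Points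
    where theta is not differentiable are harmless, since theta and V differ by
    a differentiable function. *)
Require Import Defs.
From HB Require Import structures.
From mathcomp Require Import all_boot all_order all_algebra.
From mathcomp Require Import all_classical all_reals all_analysis.
From mathcomp Require Import measurable_realfun ring lra.
Set Implicit Arguments.
Unset Strict Implicit.
Unset Printing Implicit Defensive.
Import Order.TTheory GRing.Theory Num.Theory.
Import numFieldNormedType.Exports.
Local Open Scope classical_set_scope.
Local Open Scope ring_scope.


(** * Absolutely continuous functions with bounded derivative *)

(** An almost everywhere derivative of h says nothing directly about h o g, since g may map a set of
    positive measure into the exceptional set. Its bound is therefore first turned into a Lipschitz
    property of the highest derivative of h that exists everywhere; from there on upper derivates
    replace derivatives. Only iterated partial derivatives of g are given, so all arguments run
    along coordinate lines and keep the order of the indices.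

    In (4) an estimate of |x V| by means of (2) would leave a term A |x|, which the bound does not
    contain. The comparison with G removes it: the part of G' that comes from A is constant, so it
    contributes a constant to (n-2) W and, because E Z = 0, nothing to V. Two further difficulties
    of (4) are that |x|^r has no Lipschitz bound at 0 when r < 1, whence a regularised power in G',
    and that P_s theta has to be differentiated in s although theta is merely Lipschitz. *)

Section absolute_continuity.
Context {R : realType}.
Implicit Types (F W : R -> R) (a b : R) (l : seq (R * R)).

Definition nonoverlap : rel (R * R) := fun p q => (p.2 <= q.1) || (q.2 <= p.1).

(** Lists of intervals can be concatenated, which is how partitions chosen separately in several
    intervals are merged below. *)
Lemma lac_seq F : locally_absolutely_continuous F -> forall a b e, 0 < e ->
  exists2 dl : R, 0 < dl & forall l,
    (forall p, p \in l -> a <= p.1 /\ p.1 <= p.2 /\ p.2 <= b) ->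
    pairwise nonoverlap l -> \sum_(p <- l) (p.2 - p.1) < dl ->
    \sum_(p <- l) `|F p.2 - F p.1| < e.
Proof.
move=> acF a b e e0; have [dl dl0 H] := acF a b e e0; exists dl => // l lab lp ld.
have := H (size l) (fun k => (nth (0, 0) l k).1) (fun k => (nth (0, 0) l k).2).
rewrite -(big_mkord predT (fun k => (nth (0, 0) l k).2 - (nth (0, 0) l k).1)).
rewrite -(big_mkord predT (fun k => `|F (nth (0, 0) l k).2 - F (nth (0, 0) l k).1|)).
rewrite -(big_nth (0, 0) predT (fun p => p.2 - p.1)).
rewrite -(big_nth (0, 0) predT (fun p => `|F p.2 - F p.1|)); apply => //.
  by move=> k; apply: lab; rewrite mem_nth.
have key (i j : 'I_(size l)) : (i < j)%N ->
    nonoverlap (nth (0, 0) l i) (nth (0, 0) l j).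
  by move=> ij; apply: (pairwiseP (0, 0) lp) => //; rewrite inE.
move=> i j _ _ [x [/=]]; rewrite !in_itv/= => /andP[xi1 xi2] /andP[xj1 xj2].
apply/val_inj/eqP; apply/negPn/negP; rewrite neq_ltn => /orP[] /key /orP[] h.
- by have := lt_trans xj1 (lt_le_trans xi2 h); rewrite ltxx.
- by have := lt_trans xi1 (lt_le_trans xj2 h); rewrite ltxx.
- by have := lt_trans xi1 (lt_le_trans xj2 h); rewrite ltxx.
- by have := lt_trans xj1 (lt_le_trans xi2 h); rewrite ltxx.
Qed.

Lemma itv_partition_pairs F a b s (l := zip (a :: s) s) : itv_partition a b s ->
  [/\ forall p, p \in l -> a <= p.1 /\ p.1 <= p.2 /\ p.2 <= b,
      pairwise nonoverlap l,
      \sum_(p <- l) (p.2 - p.1) = b - a &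
      \sum_(p <- l) `|F p.2 - F p.1| = variation a b F s].
Proof.
rewrite {}/l; elim: s a => [|x s IH] a sab.
  by rewrite /variation/= !big_nil (itv_partition_nil sab) subrr; split.
have [IH1 IH2 IH3 IH4] := IH _ (itv_partition_cons sab).
have ax : a < x by case: sab => /= /andP[].
have xb := itv_partition_le (itv_partition_cons sab).
rewrite /= !big_cons IH3 IH4; split.
- move=> p; rewrite inE => /predU1P[->/=|/IH1[xp [pp pb]]].
    by rewrite lexx ltW.
  by rewrite (le_trans (ltW ax) xp).
- rewrite IH2 andbT; apply/allP => p /IH1[xp _].
  by rewrite /nonoverlap/= xp.
- by rewrite [LHS]addrC addrA subrK.
- rewrite /variation /= big_nat_recl//=.
Qed.

(** An interval shorter than the [dl] that belongs to e = 1 has variation at most 1, and finitely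
    many of these cover [a, b]. *)
Lemma lac_bounded_variation F a b : a <= b -> locally_absolutely_continuous F ->
  bounded_variation a b F.
Proof.
move=> ab acF; have [dl dl0 H] := lac_seq acF a b ltr01.
have small c d : a <= c -> c <= d -> d <= b -> d - c < dl ->
    bounded_variation c d F.
  move=> ac cd db dcl; exists 1 => _ [s scd <-].
  have [h1 h2 h3 <-] := itv_partition_pairs F scd.
  apply/ltW/H => //; last by rewrite h3.
  by move=> p /h1[cp [pp pd]]; rewrite (le_trans ac cp) pp (le_trans pd db).
(* Induction on the number of pieces; their length [dl / 2] is strictly below [dl]. *)
have step n : forall d, a <= d -> d <= b -> d - a <= n%:R * (dl / 2) ->
    bounded_variation a d F.
  elim: n => [|n IH] d ad db.
    rewrite mul0r subr_le0 => da.
    have -> : d = a by apply/le_anti; rewrite da.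
    exact: bounded_variationxx.
  move=> dn; have [dn'|dn'] := leP (d - a) (dl / 2).
    by apply: small => //; rewrite (le_lt_trans dn')// ltr_pdivrMr// ltr_pMr// ltr1n.
  pose c := d - dl / 2.
  have dl2 : 0 < dl / 2 by rewrite divr_gt0.
  have ac : a <= c by rewrite /c lerBrDr -lerBrDl ltW.
  have cd : c <= d by rewrite /c gerBl ltW.
  have := IH c ac (le_trans cd db).
  have -> : (c - a <= n%:R * (dl / 2)).
    by move: dn; rewrite -natr1 mulrDl mul1r -lerBlDr /c addrAC.
  move=> /(_ isT) bac.
  have bcd : bounded_variation c d F.
    by apply: small => //; rewrite /c opprB addrC subrK ltr_pdivrMr// ltr_pMr// ltr1n.
  apply/bounded_variationP => //.
  rewrite (total_variationD F ac cd) fin_numD.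
  by apply/andP; split; apply/bounded_variationP.
have [n nab] : exists n : nat, (b - a) / (dl / 2) <= n%:R.
  exists (Num.bound ((b - a) / (dl / 2))); apply/ltW.
  by rewrite archi_boundP// divr_ge0 ?subr_ge0// divr_ge0// ltW.
apply: (step n b) => //.
by rewrite -ler_pdivrMr// divr_gt0.
Qed.

Lemma pairwise_flatten (T : Type) (r : rel T) (ss : seq (seq T)) :
  all (pairwise r) ss -> pairwise (allrel r) ss -> pairwise r (flatten ss).
Proof.
elim: ss => //= s ss IH /andP[rs rss] /andP[als pss].
rewrite pairwise_cat rs IH// !andbT.
elim: ss als {IH rss pss} => [|t ss IH] /=; first by rewrite allrel0r.
by move=> /andP[st sts]; rewrite allrel_catr st IH.
Qed.

(** The variation function is controlled on [a, b] only, so the interval is fixed instead of being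
    quantified over. *)
Definition abs_continuous_on a b W := forall e : R, 0 < e ->
  exists2 dl : R, 0 < dl & forall (m : nat) (x y : 'I_m -> R),
    (forall k, a <= x k /\ x k <= y k /\ y k <= b) ->
    trivIset setT (fun k => `]x k, y k[%classic) ->
    \sum_k (y k - x k) < dl -> \sum_k `|W (y k) - W (x k)| < e.

(** In each of the m intervals choose a partition that almost exhausts the variation of [F].
    Together they form one nonoverlapping family of the same total length, to which absolute
    continuity of [F] applies with e / 2. *)
Lemma lac_total_variation F a b : a <= b -> locally_absolutely_continuous F ->
  abs_continuous_on a b (fine \o total_variation a ^~ F).
Proof.
move=> ab acF e e0.
have [dl dl0 H] := lac_seq acF a b (divr_gt0 e0 (ltr0Sn _ 1)).
exists dl => // m x y xy txy sdl.
have BVab := lac_bounded_variation ab acF.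
set V := fine \o _.
have Vadd k : V (y k) - V (x k) = fine (total_variation (x k) (y k) F) /\
    total_variation (x k) (y k) F \is a fin_num.
  have [ax [xky yb]] := xy k.
  have f1 : total_variation a (x k) F \is a fin_num.
    apply/bounded_variationP => //.
    by apply: bounded_variationl BVab => //; exact: le_trans yb.
  have f2 : total_variation (x k) (y k) F \is a fin_num.
    apply/bounded_variationP => //.
    apply: (@bounded_variationr _ a) => //.
    by apply: bounded_variationl BVab => //; exact: le_trans xky.
  by split=> //; rewrite /V/= (total_variationD F ax xky) fineD// addrAC subrr add0r.
(* The other e / 2 is shared among the m partitions; [m.+1] avoids a division by zero when m = 0. *)
pose e' := e / 2 / m.+1%:R.
have e'0 : 0 < e' by rewrite !divr_gt0.
have /choice[s sP] : forall k, exists s : seq R, itv_partition (x k) (y k) s /\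
    `|V (y k) - V (x k)| <= variation (x k) (y k) F s + e'.
  move=> k.
  have [-> fk] := Vadd k; have [ax [xky yb]] := xy k.
  rewrite ger0_norm ?fine_ge0 ?total_variation_ge0//.
  have [_ [_ [s sxy <-] <-]] := ub_ereal_sup_adherent e'0 fk.
  rewrite -/(total_variation (x k) (y k) F) -(fineK fk) -EFinB lte_fin => sk.
  exists s; split=> //.
  by rewrite /= in sk *; rewrite -lerBlDr ltW.
pose L k := zip (x k :: s k) (s k).
have Lp k := itv_partition_pairs F (sP k).1.
pose l := flatten [seq L k | k <- enum 'I_m].
have lin p : p \in l -> exists2 k, p \in L k & a <= p.1 /\ p.1 <= p.2 /\ p.2 <= b.
  move=> /flattenP[_ /mapP[k _ ->] pk]; exists k => //.
  have [h _ _ _] := Lp k; have [ax [xky yb]] := xy k.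
  have [xp [pp py]] := h _ pk.
  by rewrite (le_trans ax xp) pp (le_trans py yb).
have lpw : pairwise nonoverlap l.
  apply: pairwise_flatten.
    by apply/allP => _ /mapP[k _ ->]; have [] := Lp k.
  rewrite pairwise_map.
  have := enum_uniq 'I_m; rewrite uniq_pairwise; apply: sub_pairwise => i j ij.
  apply/allrelP => p q pi qj.
  have lt k r : r \in L k -> x k < y k.
    move=> rk; have [_ [xky _]] := xy k.
    rewrite lt_neqAle xky andbT; apply/eqP => xyk.
    by move: rk (sP k).1; rewrite /L -xyk => /[swap] /itv_partitionxx ->.
  have [/(_ _ pi)[xp [pp py]] _ _ _] := Lp i.
  have [/(_ _ qj)[xq [qq qy]] _ _ _] := Lp j.
  have xyi := lt _ _ pi; have xyj := lt _ _ qj.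
  rewrite /nonoverlap; apply/negPn/negP; rewrite negb_or -!ltNge => /andP[qp pq].
  (* Overlapping pieces of two different intervals force the interiors of these intervals to meet,
     at the midpoint [z] below, against disjointness. *)
  have mx : Num.max (x i) (x j) < Num.min (y i) (y j).
    rewrite gt_max !lt_min xyi xyj /= andbT; apply/andP; split.
      by lra.
  by lra.
  have /(_ i j Logic.I Logic.I) hij := txy.
  suff eij : i = j by move: ij; rewrite /= eij eqxx.
  apply: hij; pose z := (Num.max (x i) (x j) + Num.min (y i) (y j)) / 2.
  have [z1 z2] := (midf_lt mx).
  move: z1 z2; rewrite gt_max lt_min => /andP[a1 a2] /andP[b1 b2].
  by exists z; split; rewrite /= in_itv/=; apply/andP.
have ldl : \sum_(p <- l) (p.2 - p.1) < dl.
  rewrite /l big_flatten /= big_map big_enum /=.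
  by rewrite (eq_bigr (fun k => y k - x k))// => k _; have [] := Lp k.
have {lpw ldl} := H l (fun p pl => let: ex_intro2 _ _ h := lin p pl in h) lpw ldl.
rewrite /l big_flatten /= big_map big_enum /=.
rewrite (eq_bigr (fun k => variation (x k) (y k) F (s k))); last first.
  by move=> k _; have [] := Lp k.
move=> lt2; rewrite [ltRHS](splitr e).
apply: (@le_lt_trans _ _ (\sum_k (variation (x k) (y k) F (s k) + e'))).
  by apply: ler_sum => k _; exact: (sP k).2.
rewrite big_split/=; apply: ltr_leD => //.
rewrite sumr_const card_ord -[leLHS]mulr_natl /e' mulrCA.
apply: ler_piMr; first by rewrite divr_ge0// ltW.
by rewrite ler_pdivrMr// mul1r ler_nat.
Qed.

Lemma is_interval_open_itv a b (I : set R) : a <= b -> open I -> is_interval I ->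
  I `<=` `]a, b[%classic ->
  exists x y, [/\ a <= x, x <= y, y <= b & I = `]x, y[%classic].
Proof.
move=> ab oI iI Iab.
have [->|I0] := eqVneq I set0.
  by exists a, a; split => //; rewrite set_itvoo0.
have lI : has_lbound I by exists a => z /Iab; rewrite /= in_itv/= => /andP[/ltW].
have uI : has_ubound I by exists b => z /Iab; rewrite /= in_itv/= => /andP[_ /ltW].
have := interval_bounded_interior iI lI uI.
have -> : I° = I by apply/interior_id.
move=> IE; exists (inf I), (sup I).
have I0' : I !=set0 by apply/set0P.
have [z Iz] := I0'.
have /= /andP[z1 z2] : [set r | inf I < r < sup I] z by rewrite -IE.
split.
- apply: lb_le_inf => // t /Iab; rewrite /= in_itv/= => /andP[/ltW//].
- by rewrite ltW// (lt_trans z1).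
- apply: ge_sup => // t /Iab; rewrite /= in_itv/= => /andP[_ /ltW//].
- by rewrite [LHS]IE; apply/seteqP; split=> t /=; rewrite in_itv.
Qed.

Notation leb := (@lebesgue_measure R).

(* The Lebesgue-Stieltjes measure of [W] is absolutely continuous, so
   Radon-Nikodym provides the density. *)
Lemma ac_nondecreasing_density W a b : a < b -> {homo W : x y / x <= y} ->
  abs_continuous_on a b W ->
  exists2 phi : R -> R, leb.-integrable setT (EFin \o phi) &
    forall x, a < x < b -> W x - W a = \int[leb]_(t in `]a, x]) phi t.
Proof.
move=> ab ndW acW.
(* Clamping to [a, b] extends [W] to a nondecreasing right continuous function on the line; being
   1-Lipschitz, [c] does not spoil the smallness of increments. *)
pose c (x : R) := Num.max a (Num.min b x).
have c_ab x : a <= c x <= b by rewrite /c le_max lexx/= ge_max (ltW ab) ge_min lexx.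
have cE x : a <= x <= b -> c x = x.
  by move=> /andP[ax xb]; rewrite /c (min_idPr xb) (max_idPr ax).
have c_nd : {homo c : x y / x <= y}.
  move=> x y xy; rewrite /c ge_max le_max lexx /= le_max; apply/orP.
  have [ya|ay] := leP (Num.min b y) a.
    left; apply: le_trans ya; rewrite le_min ge_min lexx/=.
    by rewrite ge_min xy orbT.
  by right; rewrite le_min !ge_min lexx xy orbT.
have c_lip x y : x <= y -> c y - c x <= y - x.
  move=> xy; rewrite /c; case: (leP b x) => bx; case: (leP b y) => by_.
  - by rewrite subrr subr_ge0.
  - by have := le_lt_trans (le_trans bx xy) by_; rewrite ltxx.
  - rewrite (max_idPr (ltW ab)); case: (leP a x) => ax; lra.
  - case: (leP a x) => ax; case: (leP a y) => ay; lra.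
pose G := W \o c.
have G_nd : nondecreasing_fun G by move=> x y xy; apply: ndW; exact: c_nd.
have G_small (e : R) : 0 < e -> exists2 dl : R, 0 < dl &
    forall x y, x <= y -> y - x < dl -> G y - G x < e.
  move=> e0; have [dl dl0 H] := acW _ e0; exists dl => // x y xy xydl.
  have := H 1%N (fun=> c x) (fun=> c y).
  rewrite !big_ord1 => h; apply: (le_lt_trans (ler_norm _)); apply: h.
  - by move=> _; split; [have /andP[] := c_ab x|split; [exact: c_nd|have /andP[] := c_ab y]].
  - by move=> i j _ _ _; rewrite (ord1 i) (ord1 j).
  - exact: le_lt_trans (c_lip _ _ xy) xydl.
have G_rc : right_continuous G.
  move=> x; apply/cvgrPdist_lt => e e0.
  have [dl dl0 H] := G_small _ e0.
  near=> y.
  have xy : x < y by near: y; exact: nbhs_right_gt.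
  rewrite distrC ger0_norm ?subr_ge0; last exact/G_nd/ltW.
  apply: H; first exact: ltW.
  rewrite ltrBlDr addrC.
  by near: y; apply: nbhs_right_lt; rewrite ltrDl.
pose Gc : cumulative R R := HB.pack G (isCumulative.Build R _ R G G_nd G_rc).
pose mu : {measure set (measurableTypeR R) -> \bar R} := lebesgue_stieltjes_measure Gc.
have muoc x y : x <= y -> mu `]x, y]%classic = (G y - G x)%:E.
  rewrite le_eqVlt => /predU1P[->|xy].
    by rewrite set_itvoc0 measure0 subrr.
  change (measure_extension (wlength Gc) `]x, y]%classic = (G y - G x)%:E).
  rewrite /measure_extension.
  rewrite measurable_mu_extE/=; last exact: is_ocitv.
  by rewrite wlength_itv_bnd// ltW.
have mD : measurable (`]a, b[%classic : set (measurableTypeR R)) by exact: measurable_itv.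
have muoo x y : x <= y -> (mu `]x, y[%classic <= (G y - G x)%:E)%E.
  move=> xy; rewrite -(muoc _ _ xy); apply: le_measure; rewrite ?inE.
  - exact: measurable_itv.
  - exact: measurable_itv.
  - exact: subset_itv_oo_oc.
have muD : (mu `]a, b[%classic < +oo)%E.
  by apply: le_lt_trans (muoo _ _ (ltW ab)) _; rewrite ltry.
(* The measure is restricted to the open interval, which is where the condition x < b of the
   conclusion comes from. *)
pose nu := mfrestr mD muD.
have numu : nu `<< leb.
  apply/null_content_dominatesP => A mA A0.
  rewrite /nu /mfrestr/= /mrestr.
  apply/eqP; rewrite eq_le measure_ge0 andbT; apply/lee_addgt0Pr => e e0.
  rewrite add0e.
  have [dl dl0 H] := acW _ e0.
  have [|U [oU AU Udl]] := @lebesgue_regularity_outer R A dl mA _ dl0.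
    by rewrite A0 ltry.
  have mU : measurable U by exact: open_measurable.
  have lU : (leb U < dl%:E)%E.
    rewrite (_ : U = (U `\` A) `|` A); last by rewrite setUC setDUK.
    apply: le_lt_trans (measureU2 _ _ _) _ => //; first exact: measurableD.
    by rewrite A0 adde0.
  (* The null set is covered by an open set of measure below [dl]. Its trace on ]a, b[ is a
     countable disjoint union of intervals, and absolute continuity bounds every finite sum of the
     increments of [W] over them by e. *)
  pose V := U `&` `]a, b[%classic.
  have oV : open V by apply: openI => //; exact: interval_open.
  have VE := open_disjoint_itv_bigcup oV.
  set I := open_disjoint_itv oV in VE.
  have mI n : measurable (I n) by apply: open_measurable; exact: open_disjoint_itv_open.
  have tI : trivIset setT I by exact: open_disjoint_itv_trivIset.
  have IV n : I n `<=` V by rewrite VE; exact: bigcup_sup.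
  have Iab n : exists p : R * R, [/\ a <= p.1, p.1 <= p.2, p.2 <= b & I n = `]p.1, p.2[%classic].
    have [||||x [y [h1 h2 h3 h4]]] := @is_interval_open_itv a b (I n).
    - exact: ltW.
    - exact: open_disjoint_itv_open.
    - exact: open_disjoint_itv_is_interval.
    - by move=> t /IV[].
    by exists (x, y).
  have [p pP] := choice Iab.
  have lI n : leb (I n) = ((p n).2 - (p n).1)%:E.
    have [_ h _ ->] := pP n; rewrite lebesgue_measure_itv/= lte_fin.
    by move: h; rewrite le_eqVlt => /predU1P[->|->]//; rewrite ltxx subrr.
  apply: (@le_trans _ _ (mu V)).
    apply: le_measure; rewrite ?inE.
    - exact: measurableI.
    - exact: open_measurable.
    - by move=> t [At tab]; split => //; exact: AU.
  rewrite [in leLHS]VE measure_bigcup//=; last by move=> n _; exact: mI.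
  apply: lime_le.
    exact: is_cvg_ereal_nneg_natsum_cond.
  apply: nearW => n; rewrite (eq_bigl xpredT); last by move=> k; rewrite in_setT.
  apply: (@le_trans _ _ (\sum_(0 <= k < n) (`|W (p k).2 - W (p k).1|%:E))%E).
    apply: lee_sum => k _; have [h1 h2 h3 ->] := pP k.
    apply: le_trans (muoo _ _ h2) _; rewrite lee_fin /G /= !cE ?h1 ?h3 ?andbT//.
    - exact: ler_norm.
    - exact: le_trans h3.
    - exact: le_trans h2.
  rewrite sumEFin lee_fin big_mkord; apply/ltW; apply: H.
  - by move=> k; have [h1 h2 h3 _] := pP k.
  - move=> i j _ _ [x [/= xi xj]]; apply/val_inj.
    apply: (tI _ _ Logic.I Logic.I); exists x; split.
      by have [_ _ _ ->] := pP i.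
    by have [_ _ _ ->] := pP j.
  - rewrite -lte_fin -sumEFin.
    rewrite (eq_bigr (fun k : 'I_n => leb (I k))); last by move=> k _; rewrite lI.
    apply: le_lt_trans lU.
    rewrite -measure_bigsetU.
    + apply: le_measure; rewrite ?inE//.
        by apply: bigsetU_measurable => k _; exact: mI.
      by rewrite -bigcup_mkord => t [k _ /IV[]].
    + exact: mI.
    + exact: sub_trivIset tI.
have [f [f0 ffin intf fE]] := radon_nikodym_sigma_finite numu.
exists (fine \o f).
  by apply: eq_integrable intf => // x _ /=; rewrite fineK.
move=> x /andP[ax xb].
have := fE `]a, x]%classic.
rewrite [X in X = _](_ : _ = mu (`]a, x]%classic `&` `]a, b[%classic))//.
rewrite (setIidl _); last first.
  move=> t/=; rewrite !in_itv/= => /andP[-> /=] tx.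
  exact: le_lt_trans xb.
rewrite muoc ?ltW// => /(_ (measurable_itv _)).
rewrite /Rintegral => h.
under eq_integral do rewrite /= fineK//.
by rewrite -h/= /G/= !cE// ?lexx ?ltW// ax xb.
Unshelve. all: by end_near. Qed.


(* Jordan decomposition into the variation function and its difference with [F]. *)
Lemma lac_density F a b : a < b -> locally_absolutely_continuous F ->
  exists2 phi : R -> R, leb.-integrable setT (EFin \o phi) &
    forall x, a < x < b -> F x - F a = \int[leb]_(t in `]a, x]) phi t.
Proof.
move=> ab acF.
pose c (x : R) := Num.max a (Num.min b x).
have c_ab x : a <= c x <= b by rewrite /c le_max lexx/= ge_max (ltW ab) ge_min lexx.
have cE x : a <= x <= b -> c x = x.
  by move=> /andP[ax xb]; rewrite /c (min_idPr xb) (max_idPr ax).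
have c_nd : {homo c : x y / x <= y}.
  move=> x y xy; rewrite /c ge_max le_max lexx /= le_max; apply/orP.
  have [ya|ay] := leP (Num.min b y) a.
    left; apply: le_trans ya; rewrite le_min ge_min lexx/=.
    by rewrite ge_min xy orbT.
  by right; rewrite le_min !ge_min lexx xy orbT.
have BVab := lac_bounded_variation (ltW ab) acF.
pose V := fine \o total_variation a ^~ F.
have Vfin x : a <= x <= b -> total_variation a x F \is a fin_num.
  by move=> /andP[ax xb]; apply/bounded_variationP => //; apply: bounded_variationl BVab.
have VF x y : a <= x -> x <= y -> y <= b -> `|F y - F x| <= V y - V x.
  move=> ax xy yb.
  have := total_variation_ge F xy.
  have h1 := Vfin x; have h2 := Vfin y.
  have := total_variationD F ax xy.
  rewrite -(fineK (h1 _)) ?ax ?(le_trans xy)//.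
  rewrite -(fineK (h2 _)) ?yb ?(le_trans ax)//.
  case: (total_variation x y F) => [r| |]//= [] h; rewrite lee_fin => h'.
  by rewrite /V/= h; lra.
have Vnd x y : a <= x -> x <= y -> y <= b -> V x <= V y.
  by move=> ax xy yb; rewrite -subr_ge0 (le_trans _ (VF _ _ ax xy yb)).
have acV := lac_total_variation (ltW ab) acF; rewrite -/V in acV.
have cab1 x : a <= c x by have /andP[] := c_ab x.
have cab2 x : c x <= b by have /andP[] := c_ab x.
have acVc : abs_continuous_on a b (V \o c).
  move=> e /acV[dl dl0 H]; exists dl => // m x y xy txy sdl.
  rewrite (eq_bigr (fun k => `|V (y k) - V (x k)|)); first exact: H.
  move=> k _; have [h1 [h2 h3]] := xy k.
  by rewrite /= !cE ?h1 ?h3 ?andbT ?(le_trans h1)// (le_trans h2).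
have acVF : abs_continuous_on a b (fun x => V (c x) - F (c x)).
  move=> e e0.
  have [dl dl0 H] := acV _ (divr_gt0 e0 (ltr0Sn _ 1)).
  have [dl' dl'0 H'] := acF a b _ (divr_gt0 e0 (ltr0Sn _ 1)).
  exists (Num.min dl dl'); first by rewrite lt_min dl0.
  move=> m x y xy txy; rewrite lt_min => /andP[sdl sdl'].
  apply: (@le_lt_trans _ _ (\sum_k (`|V (y k) - V (x k)| + `|F (y k) - F (x k)|))).
    apply: ler_sum => k _; have [h1 [h2 h3]] := xy k.
    rewrite !cE ?h1 ?h3 ?andbT ?(le_trans h1)// ?(le_trans h2)//.
    rewrite -[F _ - F (x k)]opprK normrN.
    by apply: le_trans (ler_normD _ _); rewrite le_eqVlt; apply/orP; left; apply/eqP; congr `|_|; ring.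
  by rewrite big_split/= (splitr e); apply: ltrD; [exact: H|exact: H'].
have [p1 ip1 P1] : exists2 phi : R -> R, leb.-integrable setT (EFin \o phi) &
    forall x, a < x < b -> (V \o c) x - (V \o c) a = \int[leb]_(t in `]a, x]) phi t.
  apply: ac_nondecreasing_density => // x y xy /=.
  by apply: Vnd => //; exact: c_nd.
have [p2 ip2 P2] : exists2 phi : R -> R, leb.-integrable setT (EFin \o phi) &
    forall x, a < x < b -> (V (c x) - F (c x)) - (V (c a) - F (c a)) = \int[leb]_(t in `]a, x]) phi t.
  apply: (ac_nondecreasing_density (W := fun x => V (c x) - F (c x))) => // x y xy.
  have := VF _ _ (cab1 x) (c_nd _ _ xy) (cab2 y).
  by have := ler_norm (F (c y) - F (c x)); lra.
exists (fun x => p1 x - p2 x).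
  exact: (integrableB (measurableT) ip1 ip2).
move=> x xab; have /andP[ax xb] := xab.
rewrite RintegralB//; last 2 first.
- by apply: integrableS ip1.
- by apply: integrableS ip2.
by rewrite -P1// -P2//= !cE ?lexx ?(ltW ab) ?ltW//; ring.
Qed.

(** By Lebesgue differentiation the density of [F] is almost everywhere its derivative, hence
    bounded by [H]; integrating gives a bound at all points. The hypothesis concerns the total
    derivative and so constrains [F] only where it is differentiable. *)
Lemma lac_lipschitz F (H : R) : locally_absolutely_continuous F ->
  (forall x, `|derive1 F x| <= H) -> forall x y, `|F y - F x| <= H * `|y - x|.
Proof.
move=> acF FH.
suff main x y : x < y -> `|F y - F x| <= H * `|y - x|.
  move=> x y; have [xy|yx|->] := ltgtP x y; first exact: main.
    by rewrite distrC (distrC y); exact: main.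
  by rewrite !subrr normr0 mulr0.
(* The density formula holds strictly inside ]x, b[, and it is needed on a neighbourhood of every t
   <= y. *)
move=> xy; pose b := y + 1.
have xb : x < b by rewrite /b; lra.
have [phi iphi phiE] := lac_density xb acF.
have iphiS (A : set R) : measurable A -> leb.-integrable A (EFin \o phi).
  by move=> mA; apply: integrableS iphi.
have := @FTC1 R phi (BRight x) (fun y => iphiS _ (measurable_itv _)) _.
have lphi : locally_integrable setT phi.
  split; [by have /measurable_int/measurable_EFinP := iphi|exact: openT|].
  move=> K _ cK; have mK : measurable K by exact: compact_measurable.
  by have /integrableP[_ ] := iphiS K mK.
move=> /(_ lphi) /= aeF.
have aeH : {ae leb, forall t, `]x, y]%classic t -> (`|(phi t)%:E| <= H%:E)%E}.
  move: aeF; apply: filterS; first exact: (ae_filter_ringOfSetsType leb).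
  move=> t dt /=; rewrite in_itv/= => /andP[xt ty].
  have [//|dG Gt] := dt.
  rewrite lee_fin.
  set G := fun _ => _ in dG Gt.
  have idG : is_derive t 1 G (phi t).
    by apply: DeriveDef => //; rewrite -derive1E.
  have : is_derive t 1 F (phi t).
    apply: (@near_eq_is_derive _ _ _ (G \+ cst (F x))).
      near=> z; rewrite /= /G -phiE ?subrK//.
      apply/andP; split; near: z; first exact: lt_nbhsr.
      by apply: lt_nbhsl; rewrite /b; lra.
    by rewrite -[phi t]addr0; exact: is_deriveD.
  by move=> Ft; rewrite -(@derive_val _ _ _ _ _ _ _ Ft) -derive1E.
rewrite (phiE y); last by rewrite xy /b; lra.
rewrite -lee_fin EFin_normr_Rintegral//; last exact: iphiS.
apply: (le_trans (le_abse_integral _ _ _)) => //.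
  by have /measurable_int := iphiS _ (measurable_itv `]x, y]).
apply: (@le_trans _ _ (\int[leb]_(t in `]x, y]) (cst H%:E) t)%E).
  apply: ae_ge0_le_integral => //.
    apply: measurableT_comp => //.
    by have /measurable_int := iphiS _ (measurable_itv `]x, y]).
  by move=> t _ /=; rewrite lee_fin (le_trans _ (FH 0)).
rewrite integral_cst//= lebesgue_measure_itv/= lte_fin xy -EFinB -EFinM.
by rewrite gtr0_norm// subr_gt0.
Unshelve. all: by end_near. Qed.

End absolute_continuity.

(** * Derivatives of compositions *)

Section pointwise_lipschitz.
Context {R : realType}.
Implicit Types (F G : R -> R) (x M N : R).

(* an upper bound for the upper derivate of [F] at [x] *)
Definition lip_at F x M := forall e, 0 < e ->
  \forall y \near x, `|F y - F x| <= (M + e) * `|y - x|.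

Lemma lip_at_le F x M N : M <= N -> lip_at F x M -> lip_at F x N.
Proof.
move=> MN FM e e0; apply: filterS (FM e e0) => y /le_trans; apply.
by rewrite ler_wpM2r// lerD2r.
Qed.

Lemma lip_at_continuous F x M : lip_at F x M -> {for x, continuous F}.
Proof.
move=> FM; apply/cvgrPdist_le => e e0 /=.
pose K := `|M| + 1; have K0 : 0 < K by rewrite /K ltr_wpDl.
near=> y.
rewrite distrC (@le_trans _ _ (K * `|y - x|))//.
  apply: (@le_trans _ _ ((M + 1) * `|y - x|)).
    by near: y; exact: FM.
  by rewrite ler_wpM2r// /K lerD2r ler_norm.
rewrite mulrC -ler_pdivlMr//.
rewrite distrC; near: y.
by apply: cvgr_dist_le; rewrite ?divr_gt0//; exact: cvg_id.
Unshelve. all: by end_near. Qed.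

Lemma is_derive_lip_at F x l : is_derive x 1 F l -> lip_at F x `|l|.
Proof.
move=> [dF Fl] e e0.
have : h^-1 *: (F (h *: (1 : R) + x) - F x) @[h --> 0^'] --> l.
  by rewrite -Fl; exact: dF.
move=> /cvgrPdist_le /(_ e e0) /=.
rewrite near_withinE => nF.
have [dl /= dl0 Hdl] := nF.
exists dl => //= y yx.
have [->|yNx] := eqVneq y x; first by rewrite !subrr normr0 mulr0.
have {}yx : `|y - x| < dl by rewrite distrC.
have := Hdl (y - x); rewrite /= sub0r normrN => /(_ yx).
rewrite subr_eq0 => /(_ yNx); rewrite -[_ *: 1]mulr1 scaler1 ?mulr1 subrK => h.
have yx0 : 0 < `|y - x| by rewrite normr_gt0 subr_eq0.
have -> : F y - F x = (y - x) * ((y - x)^-1 * (F y - F x)).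
  by rewrite mulrA divff ?mul1r// subr_eq0.
rewrite normrM [leRHS]mulrC; apply: ler_wpM2l => //.
have : `|(y - x)^-1 * (F y - F x)| - `|l| <= e.
  by apply: le_trans (lerB_dist _ _) _; rewrite distrC.
by rewrite lerBlDl.
Qed.

Lemma lip_atD F G x M N : lip_at F x M -> lip_at G x N ->
  lip_at (fun y => F y + G y) x (M + N).
Proof.
move=> FM GN e e0; have e2 : 0 < e / 2 by rewrite divr_gt0.
near=> y.
have -> : F y + G y - (F x + G x) = (F y - F x) + (G y - G x) by ring.
apply: le_trans (ler_normD _ _) _.
have -> : (M + N + e) * `|y - x| =
    (M + e / 2) * `|y - x| + (N + e / 2) * `|y - x| by field.
by apply: lerD; near: y; [exact: FM|exact: GN].
Unshelve. all: by end_near. Qed.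

Lemma lip_atM F G x M N : 0 <= M -> 0 <= N -> lip_at F x M -> lip_at G x N ->
  lip_at (fun y => F y * G y) x (M * `|G x| + `|F x| * N).
Proof.
move=> M0 N0 FM GN e e0.
have Gc := lip_at_continuous GN.
(* The error terms of the product add up to e' (M + |G x| + |F x| + e'), which is at most e' K
   because e' <= 1. *)
pose K := `|F x| + `|G x| + M + 2.
have K0 : 0 < K by rewrite /K ltr_wpDl// !addr_ge0.
pose e' := Num.min 1 (e / K).
have e'0 : 0 < e' by rewrite lt_min ltr01 divr_gt0.
have e'1 : e' <= 1 by rewrite ge_min lexx.
have e'K : K * e' <= e by rewrite mulrC -ler_pdivlMr// ge_min lexx orbT.
near=> y.
have -> : F y * G y - F x * G x = (F y - F x) * G y + F x * (G y - G x) by ring.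
apply: le_trans (ler_normD _ _) _; rewrite !normrM.
have Fy : `|F y - F x| <= (M + e') * `|y - x| by near: y; exact: FM.
have Gy : `|G y - G x| <= (N + e') * `|y - x| by near: y; exact: GN.
have Gy' : `|G y| <= `|G x| + e'.
  have : `|G x - G y| <= e' by near: y; apply: cvgr_dist_le.
  by rewrite distrC => h; have := lerB_dist (G y) (G x); lra.
apply: (@le_trans _ _ (((M + e') * (`|G x| + e') + `|F x| * (N + e')) * `|y - x|)).
  rewrite mulrDl; apply: lerD.
    by rewrite mulrAC; apply: ler_pM.
  by rewrite -mulrA; apply: ler_wpM2l.
rewrite ler_wpM2r//.
have -> : (M + e') * (`|G x| + e') + `|F x| * (N + e') =
  M * `|G x| + `|F x| * N + e' * (M + `|G x| + `|F x| + e') by ring.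
rewrite lerD2l (le_trans _ e'K)// mulrC ler_wpM2r ?ltW//.
by rewrite /K; lra.
Unshelve. all: by end_near. Qed.

Lemma lip_at_comp F G x (H N : R) : 0 <= H ->
  (forall y z, `|F z - F y| <= H * `|z - y|) ->
  lip_at G x N -> lip_at (F \o G) x (H * N).
Proof.
move=> H0 FH GN e e0.
have e'0 : 0 < e / (H + 1) by rewrite divr_gt0// ltr_wpDl.
near=> y => /=.
apply: le_trans (FH _ _) _.
apply: (@le_trans _ _ (H * ((N + e / (H + 1)) * `|y - x|))).
  by rewrite ler_wpM2l//; near: y; exact: GN.
rewrite mulrA ler_wpM2r// mulrDr lerD2l.
rewrite mulrCA ger_pMr// ler_pdivrMr ?mul1r ?lerDl//.
by rewrite ltr_wpDl.
Unshelve. all: by end_near. Qed.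

(** Continuous induction. The supremum of the points x with F a - e1 (x - a) <= F x belongs to this
    set by the bound from the left, and by the bound from the right it cannot be smaller than b. *)
Lemma dini_nondecreasing F (a b : R) : a <= b ->
  (forall x e, a <= x <= b -> 0 < e -> \forall y \near x,
     (x <= y -> F x - e * (y - x) <= F y) /\ (y <= x -> F y - e * (x - y) <= F x)) ->
  F a <= F b.
Proof.
move=> ab FM; apply/ler_addgt0Pr => e e0.
pose e1 := e / (b - a + 1).
have ba1 : 0 < b - a + 1 by rewrite ltr_wpDl// subr_ge0.
have e10 : 0 < e1 by rewrite divr_gt0.
suff : F a - e1 * (b - a) <= F b.
  move=> h; rewrite -lerBlDr (le_trans _ h)// lerB// /e1 mulrAC ler_pdivrMr//.
  by rewrite ler_wpM2l ?ltW// ltrDl.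
pose S := [set x | a <= x <= b /\ F a - e1 * (x - a) <= F x].
have Sa : S a by split; rewrite ?lexx// subrr mulr0 subr0.
have hS : has_sup S by split; [exists a|exists b => x [/andP[]]].
pose c := sup S.
have ac : a <= c by apply: ub_le_sup => //; case: hS.
have cb : c <= b by apply: ge_sup; [exists a|move=> x [/andP[]]].
have near_c := FM c e1; rewrite ac cb in near_c.
have /nbhs_ballP[dl /= dl0 Hdl] := near_c isT e10.
have Sc : S c.
  have [x Sx cx] := sup_adherent dl0 hS; rewrite -/c in cx.
  have xc : x <= c by apply: ub_le_sup => //; case: hS.
  have [/andP[ax xb] Fx] := Sx.
  split; first by rewrite ac.
  have := Hdl x; rewrite /ball/= ger0_norm ?subr_ge0// => -[|_ /(_ xc)]; first by lra.
  by move: Fx; lra.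
have [cb'|bc] := ltP c b; last first.
  by have -> : b = c by [apply/le_anti; rewrite bc cb]; case: Sc.
pose y := Num.min b (c + dl / 2).
have cy : c < y by rewrite lt_min cb' ltrDl divr_gt0.
have yb : y <= b by rewrite ge_min lexx.
have ycd : y <= c + dl / 2 by rewrite ge_min lexx orbT.
have Sy : S y.
  split; first by rewrite yb (le_trans ac (ltW cy)).
  have := Hdl y; rewrite /ball/= distrC gtr0_norm ?subr_gt0// => -[|/(_ (ltW cy)) + _].
    by lra.
  by have [_] := Sc; lra.
have : y <= c by apply: ub_le_sup => //; case: hS.
by rewrite leNgt cy.
Qed.

(** Both M x + F x and M x - F x have nonnegative lower derivates. *)
Lemma lip_at_mean_value F (a b M : R) : a <= b -> 0 <= M ->
  (forall x, a <= x <= b -> lip_at F x M) -> `|F b - F a| <= M * (b - a).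
Proof.
move=> ab M0 FM.
have H (sg : R) : `|sg| = 1 -> M * a + sg * F a <= M * b + sg * F b.
  move=> sg1; apply: (dini_nondecreasing (F := fun x => M * x + sg * F x)) => // x e xab e0.
  apply: filterS (FM x xab e e0) => y.
  rewrite -[X in X <= _]mul1r -sg1 -normrM ler_norml => /andP[h1 h2].
  split=> xy; first by rewrite ger0_norm ?subr_ge0// in h1 h2; lra.
  by rewrite ler0_norm ?subr_le0// in h1 h2; lra.
by rewrite ler_norml; have := H 1; have := H (-1); rewrite normrN normr1 => /(_ erefl) + /(_ erefl); lra.
Qed.

End pointwise_lipschitz.

(** * Directional derivatives as derivatives along lines *)

Section directional_derivatives.
Context {R : realType} {V : normedModType R}.
Implicit Types (f : V -> R) (a v : V) (l : R).

Lemma is_derive_cvgP f a v l : is_derive a v f l <->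
  (h^-1 * (f (h *: v + a) - f a) @[h --> 0^'] --> l).
Proof.
split=> [[dF <-]|H]; first exact: dF.
by apply: DeriveDef; [exact: cvgP H|exact: cvg_lim H].
Qed.

Lemma is_derive_line f a v l (x : R) :
  is_derive x 1 (fun t : R => f (t *: v + a)) l <-> is_derive (x *: v + a) v f l.
Proof.
suff -> : is_derive x 1 (fun t : R => f (t *: v + a)) l <->
  (h^-1 * (f (h *: v + (x *: v + a)) - f (x *: v + a)) @[h --> 0^'] --> l).
  by apply: iff_sym; exact: is_derive_cvgP.
suff E : (fun h : R => h^-1 *: ((fun t : R => f (t *: v + a)) (h *: (1 : R) + x) - f (x *: v + a))) =
  (fun h => h^-1 * (f (h *: v + (x *: v + a)) - f (x *: v + a))).
  split=> [[dF <-]|H].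
    by rewrite -E; exact: dF.
  by apply: DeriveDef; [rewrite /derivable|rewrite /derive]; rewrite E; [exact: cvgP H|exact: cvg_lim H].
apply/funext => h; rewrite /=; congr (_ * (f _ - _)).
by rewrite addrA -scalerDl; congr (_ *: _ + _); rewrite -[_ *: 1]mulr1 scaler1 ?mulr1.
Qed.

Lemma is_derive_lineP f a v l :
  is_derive (0 : R) 1 (fun t : R => f (t *: v + a)) l <-> is_derive a v f l.
Proof. by rewrite is_derive_line scale0r add0r. Qed.

Lemma is_derive_dircomp (h : R -> R) f a v l l' :
  is_derive (f a) 1 h l' -> is_derive a v f l ->
  is_derive a v (h \o f) (l' * l).
Proof.
move=> hl' fl; apply/is_derive_lineP.
have /is_derive_lineP fl0 := fl.
have hl0 : is_derive ((fun t : R => f (t *: v + a)) 0) 1 h l'.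
  by rewrite scale0r add0r.
exact: (is_derive1_comp hl0 fl0).
Qed.

End directional_derivatives.

(** * Set partitions and Stirling numbers *)

Section set_partitions.
Variable T : Type.
Implicit Types (s : seq T) (p : seq (seq T)).

Fixpoint add_to_block (i : T) p : seq (seq (seq T)) :=
  if p is b :: p' then ((i :: b) :: p') :: [seq b :: q | q <- add_to_block i p']
  else [::].

(* The set partitions of the positions of [s], each block being listed in the
   order of [s]: the terms of the Faa di Bruno formula. *)
Fixpoint set_partitions s : seq (seq (seq T)) :=
  if s is i :: s' then
    flatten [seq ([:: i] :: p) :: add_to_block i p | p <- set_partitions s']
  else [:: [::]].

Lemma size_add_to_block i p : size (add_to_block i p) = size p.
Proof. by elim: p => //= b p IH; rewrite size_map IH. Qed.

Lemma all_size_add_to_block i p :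
  all (fun q => size q == size p) (add_to_block i p).
Proof.
elim: p => //= b p IH; rewrite eqxx/= all_map.
by apply: sub_all IH => q /=; rewrite eqSS.
Qed.

Definition block_size (N : nat) p :=
  all (fun b => 0 < size b)%N p && (sumn [seq size b | b <- p] == N).

Lemma add_to_block_size i p N : block_size N p ->
  all (block_size N.+1) (add_to_block i p).
Proof.
elim: p N => //= b p IH N; rewrite /block_size /= => /andP[/andP[b0 pp] /eqP <-].
rewrite pp /= addSn eqxx /= all_map.
have := IH (sumn [seq size b | b <- p]); rewrite /block_size pp eqxx => /(_ isT).
by apply: sub_all => q /= /andP[-> /eqP ->]; rewrite b0 /= addnS.
Qed.

Lemma set_partitions_size s : all (block_size (size s)) (set_partitions s).
Proof.
elim: s => //= i s IH; elim: (set_partitions s) IH => //= p ps IHp /andP[hp hps].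
rewrite all_cat IHp// andbT add_to_block_size// andbT.
by move: hp; rewrite /block_size /= => /andP[-> /eqP ->]; rewrite add1n eqxx.
Qed.

End set_partitions.

Lemma stirling2_gt (n k : nat) : (n < k)%N -> stirling2 n k = 0%N.
Proof.
elim: n k => [|n IH] [|k]//= nk.
by rewrite (IH k)// (IH k.+1) ?muln0// ltnW.
Qed.

(** The recurrence of the Stirling numbers: a new element forms a block of its own or joins one of
    the [size p] existing blocks. *)
Lemma sum_set_partitions (R : realType) (T : eqType) (s : seq T) (H : nat -> R) :
  \sum_(p <- set_partitions s) H (size p) =
  \sum_(0 <= k < (size s).+1) (stirling2 (size s) k)%:R * H k.
Proof.
elim: s H => [|i s IH] H /=.
  by rewrite big_seq1 big_nat1 mul1r.
rewrite big_flatten /= big_map.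
under eq_bigr => p _.
  rewrite big_cons/= big_seq_cond.
  rewrite (eq_bigr (fun=> H (size p))); last first.
    by move=> q /andP[/(allP (all_size_add_to_block i p))/eqP ->].
  rewrite -big_seq_cond big_const_seq count_predT size_add_to_block iter_addr_0.
  rewrite -mulr_natl.
  over.
rewrite (IH (fun k => H k.+1 + k%:R * H k)).
under [in LHS]eq_bigr do rewrite mulrDr.
rewrite big_split /= [in RHS]big_nat_recl//= mul0r add0r.
under [in RHS]eq_bigr do rewrite natrD mulrDl natrM.
rewrite big_split /= addrC; congr (_ + _).
set N := size s.
rewrite big_nat_recl//= mul0r mulr0 add0r [in RHS]big_nat_recr//=.
rewrite -/N (@stirling2_gt N N.+1)// mulr0 mul0r addr0.
by apply: eq_bigr => k _; rewrite mulrCA mulrA.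
Qed.

(** * Faa di Bruno's formula and its version for increments *)

Section faa_di_bruno.
Context {R : realType} (d : nat).
Variables (h : R -> R) (g : 'cV[R]_d -> R).
Local Notation e_ i := (delta_mx i 0 : 'cV[R]_d).

Definition block_prod (p : seq (seq 'I_d)) (w : 'cV[R]_d) : R :=
  \prod_(b <- p) partials b g w.

Definition fdb_term (p : seq (seq 'I_d)) (w : 'cV[R]_d) : R :=
  derive1n (size p) h (g w) * block_prod p w.

(** Product rule: differentiating a factor puts i in front of its block, and [add_to_block] runs
    over the choices of the factor. *)
Lemma is_derive_block_prod n p w i : partials_exist n g ->
  all (fun b => size b < n)%N p ->
  is_derive w (e_ i) (block_prod p) (\sum_(q <- add_to_block i p) block_prod q w).
Proof.
move=> gn; elim: p => [|b p IH] /=.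
  move=> _; rewrite /block_prod; under eq_fun do rewrite big_nil.
  by rewrite big_nil; exact: is_derive_cst.
move=> /andP[bn pn]; rewrite big_cons big_map /block_prod.
under eq_fun do rewrite big_cons.
have -> : \prod_(j <- (i :: b) :: p) partials j g w
    + \sum_(j <- add_to_block i p) \prod_(b0 <- b :: j) partials b0 g w =
    partials b g w *: (\sum_(q <- add_to_block i p) block_prod q w)
    + block_prod p w *: 'D_(e_ i) (partials b g) w.
  rewrite big_cons /= addrC; congr (_ + _); last by rewrite [RHS]mulrC.
  rewrite [RHS]mulr_sumr; apply: eq_bigr => q _.
  by rewrite big_cons.
by apply: is_deriveM; [apply: derivableP; exact: gn|exact: IH].
Qed.

(** The derivative falls either on the outer factor, where the chain rule creates the block
    [[:: i]], or on one of the partial derivatives of [g]. *)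
Lemma is_derive_fdb_term n p w i : partials_exist n g ->
  all (fun b => size b < n)%N p -> (0 < n)%N ->
  derivable (derive1n (size p) h) (g w) 1 ->
  is_derive w (e_ i) (fdb_term p)
    (\sum_(q <- ([:: i] :: p) :: add_to_block i p) fdb_term q w).
Proof.
move=> gn pn n0 hp.
have -> : \sum_(q <- ([:: i] :: p) :: add_to_block i p) fdb_term q w =
    (derive1n (size p) h \o g) w *: (\sum_(q <- add_to_block i p) block_prod q w)
    + block_prod p w *: ('D_1 (derive1n (size p) h) (g w) * 'D_(e_ i) g w).
  rewrite big_cons addrC; congr (_ + _).
    rewrite [RHS]mulr_sumr big_seq [RHS]big_seq; apply: eq_bigr => q qp.
    by rewrite /fdb_term (eqP (allP (all_size_add_to_block i p) _ qp)).
  rewrite /fdb_term /block_prod big_cons /= derive1E.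
  rewrite [RHS]mulrC -[in RHS]mulrA; congr (_ * _).
apply: is_deriveM; last exact: is_derive_block_prod gn pn.
apply: is_derive_dircomp; first exact: derivableP.
by apply: derivableP; exact: (gn [::]).
Qed.

Lemma block_size_lt (T : Type) n N (p : seq (seq T)) : (N < n)%N -> block_size N p ->
  all (fun b => size b < n)%N p /\ (size p <= N)%N.
Proof.
move=> Nn /andP[p0 /eqP pN].
elim: p N Nn p0 pN => [|b p IH] N Nn //= /andP[b0 p0] pN.
have [|h1 h2] := IH (sumn [seq size b | b <- p]) _ p0 erefl.
  by rewrite (leq_ltn_trans _ Nn)// -pN leq_addl.
rewrite h1 andbT (leq_ltn_trans _ Nn) -?pN ?leq_addr//; split => //.
by rewrite -addn1 addnC leq_add.
Qed.

(* Faa di Bruno's formula; [g] need not be differentiable, only its iterated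
   partial derivatives have to exist. *)
Lemma partials_comp n s : partials_exist n.+1 g ->
  (forall k x, (k < n)%N -> derivable (derive1n k h) x 1) -> (size s <= n)%N ->
  partials s (h \o g) = fun w => \sum_(p <- set_partitions s) fdb_term p w.
Proof.
move=> gn hn; elim: s => [|i s IH] sn.
  by apply/funext => w; rewrite big_seq1 /fdb_term /block_prod big_nil mulr1.
have -> : partials (i :: s) (h \o g) = 'D_(e_ i) (partials s (h \o g)) by [].
rewrite IH; last exact: ltnW.
apply/funext => w /=.
rewrite big_flatten /= big_map.
apply: derive_val.
have := set_partitions_size s.
elim: (set_partitions s) => [_|p ps IHp /= /andP[pp pps]].
  under [X in is_derive _ _ X _]eq_fun do rewrite big_nil.
  by rewrite big_nil; exact: is_derive_cst.
under [X in is_derive _ _ X _]eq_fun do rewrite big_cons.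
rewrite [X in is_derive _ _ _ X]big_cons.
have [h1 h2] := block_size_lt (ltn_trans sn (ltnSn _)) pp.
apply: is_deriveD; last exact: IHp.
apply: (@is_derive_fdb_term n.+1 p w i gn h1 isT).
by apply: hn; rewrite (leq_ltn_trans h2).
Qed.

Lemma partials_comp_derivable n s w i : partials_exist n.+1 g ->
  (forall k x, (k < n)%N -> derivable (derive1n k h) x 1) -> (size s <= n)%N ->
  derivable (derive1n n h) (g w) 1 ->
  derivable (partials s (h \o g)) w (e_ i).
Proof.
move=> gn hn sn hw; rewrite (partials_comp gn)//.
have := set_partitions_size s.
elim: (set_partitions s) => [_|p ps IHp /= /andP[pp pps]].
  under [X in derivable X _ _]eq_fun do rewrite big_nil.
  exact: derivable_cst.
under [X in derivable X _ _]eq_fun do rewrite big_cons.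
have [h1 h2] := @block_size_lt _ n.+1 (size s) p sn pp.
apply: derivableD; last exact: IHp.
have hp : derivable (derive1n (size p) h) (g w) 1.
  have := leq_trans h2 sn; rewrite leq_eqVlt => /predU1P[->//|].
  exact: hn.
by have [] := @is_derive_fdb_term n.+1 p w i gn h1 isT hp.
Qed.

(** The same computation when h^(n) is merely Lipschitz: the product and chain rules for upper
    derivates produce the same partitions, with absolute values inside the sum. *)
Lemma lip_at_fdb_term n (H : nat -> R) p w i (t : R)
    (y := t *: e_ i + w : 'cV[R]_d) :
  partials_exist n.+1 g -> all (fun b => size b < n.+1)%N p ->
  (size p <= n)%N -> (forall k, 0 <= H k) ->
  (forall k x z, (k <= n)%N ->
    `|derive1n k h z - derive1n k h x| <= H k.+1 * `|z - x|) ->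
  (forall k x, (0 < k <= n)%N -> `|derive1n k h x| <= H k) ->
  lip_at (fun t => fdb_term p (t *: e_ i + w)) t
    (\sum_(q <- ([:: i] :: p) :: add_to_block i p) H (size q) * `|block_prod q y|).
Proof.
move=> gn pn pn' H0 hL hB.
have gy : lip_at (fun t => g (t *: e_ i + w)) t `|'D_(e_ i) g y|.
  apply: is_derive_lip_at; apply/is_derive_line; apply: derivableP.
  exact: (gn [::]).
have hgy := lip_at_comp (H0 (size p).+1) (fun x z => hL (size p) x z pn') gy.
have py : lip_at (fun t => block_prod p (t *: e_ i + w)) t
    (\sum_(q <- add_to_block i p) `|block_prod q y|).
  apply: lip_at_le (is_derive_lip_at _); last first.
    by apply/is_derive_line; exact: (is_derive_block_prod _ _ gn pn).
  exact: ler_norm_sum.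
apply: lip_at_le (lip_atM _ _ hgy py).
- rewrite big_cons; apply: lerD.
    rewrite /= -mulrA; apply: ler_wpM2l => //.
    by rewrite /block_prod big_cons /= normrM.
  (* The empty partition is separated because h itself may be unbounded; it has no block to extend,
     so no bound on h enters. *)
  rewrite /=; case: p pn pn' {hgy py} => [|b p] pn pn'; first by rewrite /= !big_nil mulr0.
  rewrite mulr_sumr big_seq [leRHS]big_seq; apply: ler_sum => q qp.
  apply: ler_wpM2r => //.
  by rewrite (eqP (allP (all_size_add_to_block i (b :: p)) _ qp)); exact: hB.
- by rewrite mulr_ge0.
- by apply: sumr_ge0.
Qed.

(** A block b contributes at most P to the power [size b / n.+1], and the block sizes add up to N.
    Hence all partitions of the same index set get the same power of P, and only their number enters
    the constant. *)
Lemma block_prod_bound n (P : 'cV[R]_d -> R) N p w : 0 <= P w ->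
  (forall b, (0 < size b <= n.+1)%N ->
    `|partials b g w| `^ (n.+1%:R / (size b)%:R) <= P w) ->
  (N <= n.+1)%N -> block_size N p ->
  `|block_prod p w| <= P w `^ (N%:R / n.+1%:R).
Proof.
move=> P0 gP Nn /andP[p0 /eqP pN].
rewrite -pN in Nn *.
elim: p Nn p0 {pN} => [|b p IH] /= Nn; first by rewrite /block_prod big_nil mul0r powRr0 normr1.
move=> /andP[b0 p0].
have bn : (size b <= n.+1)%N by apply: leq_trans Nn; exact: leq_addr.
have pn : (sumn [seq size b | b <- p] <= n.+1)%N by apply: leq_trans Nn; exact: leq_addl.
(* At base 0 exponents add only if their sum is nonzero, which holds because [b] is nonempty. *)
rewrite /block_prod big_cons normrM natrD mulrDl powRD; last first.
  apply/implyP => /eqP E; exfalso; move: E; apply/eqP; rewrite gt_eqF//.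
  by rewrite ltr_pwDl// ?divr_gt0 ?ltr0n// divr_ge0.
apply: ler_pM => //; last exact: IH.
have E : (`|partials b g w| `^ (n.+1%:R / (size b)%:R)) `^ ((size b)%:R / n.+1%:R)
    = `|partials b g w|.
  rewrite -powRrM mulrA divfK ?pnatr_eq0 -?lt0n// divff ?pnatr_eq0//.
  by rewrite powRr1.
rewrite -{1}E; apply: ge0_ler_powR => //; rewrite ?nnegrE ?powR_ge0 ?divr_ge0//.
by apply: gP; rewrite b0.
Qed.

(** Summation over the partitions of [i :: s]: the common power of P factors out, and counting by
    the number of blocks leaves the Stirling sum, which is the origin of h_n. *)
Lemma lip_at_partials_comp n (H : nat -> R) (P : 'cV[R]_d -> R) s w i (t : R)
    (y := t *: e_ i + w : 'cV[R]_d) :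
  partials_exist n.+1 g ->
  (forall k x, (k < n)%N -> derivable (derive1n k h) x 1) -> (size s <= n)%N ->
  (forall k, 0 <= H k) ->
  (forall k x z, (k <= n)%N ->
    `|derive1n k h z - derive1n k h x| <= H k.+1 * `|z - x|) ->
  (forall k x, (0 < k <= n)%N -> `|derive1n k h x| <= H k) ->
  0 <= P y ->
  (forall b, (0 < size b <= n.+1)%N ->
    `|partials b g y| `^ (n.+1%:R / (size b)%:R) <= P y) ->
  lip_at (fun t => partials s (h \o g) (t *: e_ i + w)) t
    ((\sum_(0 <= k < (size s).+2) (stirling2 (size s).+1 k)%:R * H k)
      * P y `^ ((size s).+1%:R / n.+1%:R)).
Proof.
move=> gn hn sn H0 hL hB P0 gP.
rewrite (partials_comp gn)//.
have -> : (\sum_(0 <= k < (size s).+2) (stirling2 (size s).+1 k)%:R * H k) =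
  \sum_(p <- set_partitions (i :: s)) H (size p).
  by rewrite sum_set_partitions.
rewrite mulr_suml.
apply: (@lip_at_le _ _ _ (\sum_(p <- set_partitions (i :: s)) H (size p) * `|block_prod p y|)).
  rewrite big_seq [leRHS]big_seq; apply: ler_sum => p ps.
  apply: ler_wpM2l => //; apply: block_prod_bound => //.
  exact: (allP (set_partitions_size (i :: s)) _ ps).
have -> : set_partitions (i :: s) =
  flatten [seq ([:: i] :: p) :: add_to_block i p | p <- set_partitions s] by [].
rewrite big_flatten big_map.
have := set_partitions_size s.
elim: (set_partitions s) => [_|p ps IHp /= /andP[pp pps]].
  rewrite [X in lip_at _ _ X]big_nil.
  under [X in lip_at X _ _]eq_fun do rewrite big_nil.
  by move=> e e0; near=> z; rewrite subrr normr0 mulr_ge0// add0r ltW.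
rewrite [X in lip_at _ _ X]big_cons.
under [X in lip_at X _ _]eq_fun do rewrite big_cons.
have [h1 h2] := @block_size_lt _ n.+1 (size s) p sn pp.
apply: lip_atD; last exact: IHp.
exact: (@lip_at_fdb_term n H p w i t gn h1 (leq_trans h2 sn)).
Unshelve. all: by end_near. Qed.

End faa_di_bruno.

(** * Lipschitz bounds for the partial derivatives of h o g *)

Section supnorm_bounds.
Context {R : realType}.
Implicit Types (h : R -> R).

Lemma le_supnorm h x : (exists M, forall y, `|h y| <= M) -> `|h x| <= supnorm h.
Proof.
move=> [M hM]; apply: ub_le_sup; last by exists x.
by exists M => _ [y _ <-].
Qed.

Lemma supnorm_ge0 h : 0 <= supnorm h.
Proof.
have [hs|hs] := pselect (has_sup (range (fun x => `|h x|))).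
  by apply: le_trans (ub_le_sup hs.2 _); last by exists 0.
(* An unbounded range has supremum 0 by convention. *)
by rewrite /supnorm sup_out.
Qed.

Lemma hnormE n h : hnorm n.+1 h =
  \sum_(0 <= k < n.+2) (stirling2 n.+1 k)%:R * supnorm (derive1n k h).
Proof. by rewrite [RHS]big_ltn// (_ : stirling2 n.+1 0 = 0%N)// mul0r add0r. Qed.

Lemma hnorm_ge0 n h : 0 <= hnorm n h.
Proof. by apply: sumr_ge0 => k _; rewrite mulr_ge0// supnorm_ge0. Qed.

(** Below the top order the mean value inequality applies; at k = n the next derivative exists only
    almost everywhere and absolute continuity takes over. *)
Lemma in_Cb_lipschitz n h : in_Cb n.+1 h -> forall k x y, (k <= n)%N ->
  `|derive1n k h y - derive1n k h x| <= supnorm (derive1n k.+1 h) * `|y - x|.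
Proof.
move=> [hd hac hB] k x y kn.
have hb z : `|derive1n k.+1 h z| <= supnorm (derive1n k.+1 h) by apply/le_supnorm/hB.
move: kn; rewrite leq_eqVlt => /predU1P[->|kn].
  apply: lac_lipschitz => // z; rewrite -derive1nS.
  exact/le_supnorm/hB/andP.
wlog xy : x y / x <= y.
  move=> W; have [/W//|/ltW/W] := leP x y.
  by rewrite distrC (distrC x).
rewrite (ger0_norm (x := y - x)) ?subr_ge0//.
apply: lip_at_mean_value => //; first exact: supnorm_ge0.
move=> z _; apply: (lip_at_le (hb z)); apply: is_derive_lip_at.
by rewrite derive1nS derive1E; apply: derivableP; exact: hd.
Qed.

End supnorm_bounds.

Section composition_lipschitz.
Context {R : realType} (d : nat).
Variables (A B : R) (r : 'I_d -> R).
Hypotheses (A0 : 0 <= A) (B0 : 0 <= B) (r0 : forall i, 0 <= r i).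
Local Notation e_ i := (delta_mx i 0 : 'cV[R]_d).
Implicit Types (w : 'cV[R]_d) (tau : R).

(* Bounds [Ppow] on a segment of length [tau] in a coordinate direction from [w]. *)
Definition Qpow tau w : R := A + B * \sum_k (`|w k 0| + tau) `^ r k.

Lemma Ppow_ge0 w : 0 <= Ppow A B r w.
Proof. by rewrite addr_ge0// mulr_ge0// sumr_ge0// => k _; exact: powR_ge0. Qed.

Lemma Ppow_le_Qpow i (t u : R) w : `|u| <= `|t| ->
  Ppow A B r (u *: e_ i + w) <= Qpow `|t| w.
Proof.
move=> ut; rewrite lerD2l; apply: ler_wpM2l => //; apply: ler_sum => k _.
apply: ge0_ler_powR => //; rewrite ?nnegrE ?addr_ge0//.
rewrite !mxE; apply: le_trans (ler_normD _ _) _; rewrite addrC lerD2l normrM.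
by case: (k == i); rewrite /= ?normr1 ?normr0 ?mulr1// mulr0.
Qed.

(** Mean value inequality on the segment from w to w + t e_i, where [Ppow] stays below [Qpow] at
    |t|. *)
Lemma comp_partials_lipschitz n (h : R -> R) (g : 'cV[R]_d -> R) s i w (t : R) :
  in_Cb n.+1 h -> in_CP n.+1 (Ppow A B r) g -> (size s <= n)%N ->
  `|partials s (h \o g) (t *: e_ i + w) - partials s (h \o g) w| <=
  `|t| * (hnorm (size s).+1 h * Qpow `|t| w `^ ((size s).+1%:R / n.+1%:R)).
Proof.
move=> hC [gn gP] sn; have [hd hac hB] := hC.
pose H k := supnorm (derive1n k h).
pose K := hnorm (size s).+1 h * Qpow `|t| w `^ ((size s).+1%:R / n.+1%:R).
have K0 : 0 <= K by rewrite mulr_ge0 ?powR_ge0// hnorm_ge0.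
have key u : `|u| <= `|t| ->
    lip_at (fun t => partials s (h \o g) (t *: e_ i + w)) u K.
  move=> ut.
  have := @lip_at_partials_comp R d h g n H (Ppow A B r) s w i u.
  move=> /(_ gn (fun k x kn => hd k x kn) sn (fun k => supnorm_ge0 _)).
  move=> /(_ (fun k x z kn => in_Cb_lipschitz hC _ _ kn)).
  move=> /(_ (fun k x kn => le_supnorm _ (hB k (let: conj a b := andP kn in introT andP (conj a (leqW b)))))).
  move=> /(_ (Ppow_ge0 _) (fun b bn => gP b _ bn)).
  apply: lip_at_le; rewrite /K hnormE.
  apply: ler_wpM2l; first by rewrite -hnormE hnorm_ge0.
  apply: ge0_ler_powR; rewrite ?nnegrE ?divr_ge0 ?Ppow_ge0//.
    by rewrite (le_trans (Ppow_ge0 w))// -[w in Ppow _ _ _ w]add0r -(scale0r (e_ i)) Ppow_le_Qpow// normr0.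
  exact: Ppow_le_Qpow.
pose F u := partials s (h \o g) (u *: e_ i + w).
rewrite mulrC -/K -/(F t); have [t0|t0] := leP 0 t.
  have := @lip_at_mean_value R F 0 t K t0 K0.
  rewrite [F 0]/F scale0r add0r subr0 (ger0_norm t0); apply => u /andP[u0 ut].
  by apply: key; rewrite !ger0_norm.
have := @lip_at_mean_value R F t 0 K (ltW t0) K0.
rewrite [F 0]/F scale0r add0r sub0r distrC (ltr0_norm t0); apply => u /andP[u0 ut].
by apply: key; rewrite (ler0_norm ut) (ltr0_norm t0) lerN2.
Qed.

(** One order is lost: h has n derivatives everywhere and the next one only almost everywhere. *)
Lemma comp_partials_exist n (h : R -> R) (g : 'cV[R]_d -> R) :
  in_Cb n.+1 h -> partials_exist n.+1 g -> partials_exist n (h \o g).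
Proof.
move=> [hd _ _] gn s i w sn.
have [n0|n0] := posnP n; first by rewrite n0 in sn.
have := @partials_comp_derivable R d h g n.-1 s w i.
rewrite prednK//; apply.
- by move=> s' i' w' s'n; apply: gn; rewrite (leq_trans s'n).
- by move=> k x kn; apply: hd; rewrite (leq_trans kn)// leq_pred.
- by rewrite -ltnS prednK.
- by apply: hd; rewrite ltn_predL.
Qed.

End composition_lipschitz.

(** * Gaussian measures and the Cameron-Martin formula *)

Section derivative_under_integral.
Context d (Y : measurableType d) {R : realType}.
Variable mu : {measure set Y -> \bar R}.

(** Dominated convergence for difference quotients along an arbitrary sequence of steps. Only
    increments from t = 0 have to be dominated, and the integrability of [G] comes out as a
    conclusion. *)
Lemma is_derive_integral (D : set Y) (F : R -> Y -> R) (G L : Y -> R) :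
  measurable D ->
  (forall t, `|t| <= 1 -> mu.-integrable D (EFin \o F t)) ->
  mu.-integrable D (EFin \o L) ->
  (forall t y, `|t| <= 1 -> D y -> `|F t y - F 0 y| <= `|t| * L y) ->
  (forall y, D y -> is_derive (0 : R) 1 (F ^~ y) (G y)) ->
  mu.-integrable D (EFin \o G) /\
  is_derive (0 : R) 1 (fun t => \int[mu]_(y in D) F t y) (\int[mu]_(y in D) G y).
Proof.
move=> mD iF iL FL FG.
pose q (u : R ^nat) n y := ((F (u n) y - F 0 y) / u n).
have mF t : `|t| <= 1 -> measurable_fun D (F t).
  by move=> /iF/measurable_int/measurable_EFinP.
have zero1 : `|0 : R| <= 1 by rewrite normr0.
have quo (u : R ^nat) : (forall n, u n != 0 /\ `|u n| <= 1) -> u n @[n --> \oo] --> 0 ->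
    [/\ forall n, measurable_fun D (EFin \o q u n),
     forall y, D y -> (EFin \o q u ^~ y) @ \oo --> (G y)%:E &
     forall n y, D y -> (`|(q u n y)%:E| <= (L y)%:E)%E].
  move=> u1 u0; split=> [n|y Dy|n y Dy].
  - have [un0 un1] := u1 n.
    apply/measurable_EFinP; apply: measurable_funM => //.
    by apply: measurable_funB; exact: mF.
  - apply: cvg_EFin; first exact: nearW.
    have /is_derive_cvgP/cvgr_dnbhsP/(_ u) := FG y Dy.
    have h : (forall n, u n != 0) /\ u n @[n --> \oo] --> 0.
      by split => // n; have [] := u1 n.
    move=> /(_ h); apply: cvg_trans; apply: near_eq_cvg; apply: nearW => n.
    by rewrite /= /q mulrC addr0 -[_%:A]mulr1 scaler1 ?mulr1.
  - have [un0 un1] := u1 n.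
    rewrite lee_fin /q normrM normfV ler_pdivrMr ?normr_gt0// mulrC.
    exact: FL.
(* One fixed sequence of steps exhibits [G] as a limit of measurable functions bounded by [L]. *)
pose u0 (n : nat) : R := n.+1%:R^-1.
have u0P : (forall n, u0 n != 0 /\ `|u0 n| <= 1) /\ u0 n @[n --> \oo] --> 0.
  split=> [n|]; last exact: cvg_harmonic.
  by rewrite /u0 invr_eq0 pnatr_eq0 ger0_norm ?invr_ge0// invf_le1 ?ltr0n// ler1n.
have [m0 c0 b0] := quo _ u0P.1 u0P.2.
have mG : measurable_fun D (EFin \o G).
  by apply: (emeasurable_fun_cvg (fun n => EFin \o q u0 n)) => //; exact: m0.
have iG : mu.-integrable D (EFin \o G).
  apply: le_integrable iL => // y Dy /=.
  apply: (@le_trans _ _ (L y)%:E); last by rewrite lee_fin ler_norm.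
  have h : (abse \o (EFin \o q u0 ^~ y)) @ \oo --> `|(G y)%:E|%E.
    by apply: cvg_comp; [exact: c0|exact: abse_continuous].
  rewrite [leLHS](_ : _ = lim ((abse \o (EFin \o q u0 ^~ y)) @ \oo)).
    by apply: lime_le; [exact: cvgP h|apply: nearW => n; exact: b0].
  by apply/esym/cvg_lim.
split => //; apply/is_derive_cvgP/cvgr_dnbhsP => u [un0 u0'].
(* The steps are only eventually of modulus at most 1; the finitely many others are replaced by
   1. *)
pose u' n := if `|u n| <= 1 then u n else 1.
have uu' : \forall n \near \oo, u n = u' n.
  have : \forall n \near \oo, `|0 - u n| <= 1 by apply: cvgr_dist_le.
  by apply: filterS => n; rewrite sub0r normrN /u' => ->.
have u'P : (forall n, u' n != 0 /\ `|u' n| <= 1) /\ u' n @[n --> \oo] --> 0.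
  split=> [n|]; first by rewrite /u'; case: ifPn => // _; rewrite normr1 oner_neq0.
  by move: u0'; apply: cvg_trans; apply: near_eq_cvg.
have [m1 c1 b1] := quo _ u'P.1 u'P.2.
have := dominated_cvg mD m1 c1 (fun y _ => erefl : (EFin \o L) y \is a fin_num) iL b1.
move=> cint.
have {}cint : \int[mu]_(y in D) q u' n y @[n --> \oo] --> \int[mu]_(y in D) G y.
  apply: fine_cvg; rewrite /Rintegral fineK; first exact: cint.
  exact: integrable_fin_num.
move: cint; apply: cvg_trans; apply: near_eq_cvg.
move: uu'; apply: filterS => n un.
have [un0' un1] := u'P.1 n.
rewrite /= /q un -[_%:A]mulr1 scaler1 ?mulr1 addr0.
rewrite RintegralZr//; last first.
  exact: (integrableB mD (iF _ un1) (iF _ zero1)).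
by rewrite RintegralB//; [rewrite mulrC|exact: iF..].
Qed.

End derivative_under_integral.

(** * Measurability of continuous functions of several variables *)

Section measurable_continuous.
Context {R : realType} (d : nat) dU (U : measurableType dU).
Variable Y : 'I_d -> U -> R.
Hypothesis mY : forall i, measurable_fun setT (Y i).

(** Measurability is reduced to preimages of open sets of column vectors, each of which is a
    countable union of cubes with rational centres and radii 1 / (n + 1). *)
Lemma measurable_continuous_col (F : 'cV[R]_d -> R) : continuous F ->
  measurable_fun setT (fun u => F (\col_i Y i u)).
Proof.
move=> cF.
have mopen (V : set 'cV[R]_d) : open V -> measurable [set u | V (\col_i Y i u)].
  move=> oV.
  pose box (q : {ffun 'I_d -> rat} * nat) : set 'cV[R]_d :=
    [set x | forall i, `|x i 0 - ratr (q.1 i)| < q.2.+1%:R^-1].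
  have -> : [set u | V (\col_i Y i u)] =
      \bigcup_q (if `[< box q `<=` V >] then [set u | box q (\col_i Y i u)] else set0).
    apply/seteqP; split=> u /=; last first.
      by move=> [q _]; case: asboolP => // + h; apply.
    move=> Vu.
    have /nbhs_ballP[e /= e0 eV] := open_nbhs_nbhs (conj oV Vu).
    have [n ne] : exists n : nat, 2 / n.+1%:R < e.
      have := near_infty_natSinv_lt (PosNum (divr_gt0 e0 (ltr0Sn _ 1))).
      move=> /filter_ex[n /= hn]; exists n.
      by move: hn; rewrite ltr_pdivlMr// mulrC.
    have qP i : exists q : rat, `|Y i u - ratr q| < n.+1%:R^-1.
      have n0 : 0 < n.+1%:R^-1 :> R by rewrite invr_gt0 ltr0n.
      have /rat_in_itvoo[q] : Y i u - n.+1%:R^-1 < Y i u + n.+1%:R^-1.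
        by rewrite ltrBlDr -addrA ltrDl addr_gt0.
      rewrite in_itv/= => /andP[h1 h2]; exists q.
      have H (a b x : R) : a - x < b -> b < a + x -> `|a - b| < x.
        by move=> *; rewrite ltr_norml; lra.
      exact: H.
    have [q qY] := choice qP.
    exists ([ffun i => q i], n) => //.
    have bq : box ([ffun i => q i], n) (\col_i Y i u).
      by move=> i; rewrite /= ffunE mxE.
    case: asboolP => // nb; exfalso; apply: nb => x bx; apply: eV.
    split => // i j; rewrite ord1 /ball /=.
    have := bx i; have := bq i; rewrite /= !ffunE !mxE => h1 h2.
    apply: le_lt_trans ne.
    have -> : Y i u - x i 0 = (Y i u - ratr (q i)) - (x i 0 - ratr (q i)) by ring.
    apply: le_trans (ler_normB _ _) _.
    by rewrite mulr_natl mulr2n; apply: lerD; exact: ltW.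
  apply: countable_bigcupT_measurable; first exact: countableP.
  move=> q; case: asboolP => // _.
  have -> : [set u | box q (\col_i Y i u)] =
      \bigcap_(i in [set: 'I_d]) (Y i @^-1` ball (ratr (q.1 i) : R) q.2.+1%:R^-1).
    apply/seteqP; split=> u /= h i; have := h i.
      by rewrite mxE distrC.
    by rewrite mxE distrC => /(_ Logic.I).
  apply: fin_bigcap_measurable => // i _.
  rewrite -[X in measurable X]setTI; apply: mY => //.
  exact: measurable_ball.
apply: (measurability _ (RGenOpens.measurableE R)).
move=> _ [_ [a [b ->]] <-]; rewrite setTI.
apply: (mopen (F @^-1` `]a, b[%classic)).
by apply: open_comp => [x _|]; [exact: cF|exact: interval_open].
Qed.

End measurable_continuous.

(** * Measures with a density *)

Section density.
Context d (T : measurableType d) {R : realType}.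

(** [f] coincides almost everywhere with the Radon-Nikodym derivative of [nu], which obeys the
    change of variables formula. *)
Lemma ge0_integral_density (mu : {sigma_finite_measure set T -> \bar R})
    (nu : {finite_measure set T -> \bar R}) (f : T -> R) (g : T -> \bar R) :
  measurable_fun setT f -> (forall x, 0 <= f x) ->
  (forall A, measurable A -> nu A = \int[mu]_(x in A) (f x)%:E)%E ->
  measurable_fun setT g -> (forall x, 0 <= g x)%E ->
  (\int[nu]_x g x = \int[mu]_x (g x * (f x)%:E))%E.
Proof.
move=> mf f0 nuE mg g0.
have numu : nu `<< mu.
  apply/null_content_dominatesP => A mA A0; rewrite nuE//.
  by apply: null_set_integral => //; apply/measurable_EFinP/measurable_funTS.
rewrite -(Radon_Nikodym_SigmaFinite.change_of_variables numu)//.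
have mRN : measurable_fun setT (Radon_Nikodym_SigmaFinite.f nu mu).
  exact: measurable_int (Radon_Nikodym_SigmaFinite.f_integrable numu).
apply: ae_eq_integral => //.
- exact: emeasurable_funM.
- by apply: emeasurable_funM => //; exact/measurable_EFinP.
- apply: ae_eqe_mul2l; apply: integral_ae_eq => //.
  + exact: Radon_Nikodym_SigmaFinite.f_integrable.
  + exact/measurable_EFinP.
  + by move=> E _ mE; rewrite -Radon_Nikodym_SigmaFinite.f_integral// nuE.
Qed.

Section weighted_measure.
Variables (mu : {measure set T -> \bar R}) (f : T -> R).
Hypotheses (f0 : forall x, 0 <= f x) (intf : mu.-integrable setT (EFin \o f)).

(** The two proofs are arguments so that the measure structures declared below can refer to them. *)
Definition weighted of (forall x, 0 <= f x) & mu.-integrable setT (EFin \o f) :=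
  fun A : set T => (\int[mu]_(x in A) (f x)%:E)%E.

Let weighted0 : weighted f0 intf set0 = 0%E.
Proof. by rewrite /weighted integral_set0. Qed.

Let weighted_ge0 A : (0 <= weighted f0 intf A)%E.
Proof. by apply: integral_ge0 => x _; rewrite lee_fin. Qed.

Let weighted_sigma_additive : semi_sigma_additive (weighted f0 intf).
Proof.
move=> /= A mA tA mUA; rewrite /weighted integral_bigcup//=; last first.
  by apply: integrableS intf.
apply: is_cvg_ereal_nneg_natsum_cond => n _ _.
by apply: integral_ge0 => x _; rewrite lee_fin.
Qed.

HB.instance Definition _ := isMeasure.Build _ _ _
  (weighted f0 intf) weighted0 weighted_ge0 weighted_sigma_additive.

Let weighted_fin : fin_num_fun (weighted f0 intf).
Proof.
move=> A mA; apply: integrable_fin_num => //.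
by apply: integrableS intf.
Qed.

HB.instance Definition _ := @Measure_isFinite.Build _ _ _
  (weighted f0 intf) weighted_fin.

End weighted_measure.

End density.

(** * Tilts and shifts of the normal distribution on the line *)

Section gaussian_integrals.
Context {R : realType}.
Notation leb := (@lebesgue_measure R).
Notation N01 := (@normal_prob R 0 1).

Lemma normal_pdf01E (m x : R) : normal_pdf m 1 x = normal_peak 1 * expR (- (x - m) ^+ 2 / 2).
Proof. by rewrite normal_pdfE ?oner_neq0//= /normal_fun expr1n. Qed.

(** Completing the square in the exponent. *)
Lemma normal_pdf_tilt (u x : R) :
  normal_pdf u 1 x = expR (u * x - u ^+ 2 / 2) * normal_pdf 0 1 x.
Proof.
rewrite !normal_pdf01E mulrCA -expRD subr0; congr (_ * expR _).
by field.
Qed.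

Lemma ge0_integral_normal_prob (g : R -> \bar R) :
  measurable_fun setT g -> (forall x, 0 <= g x)%E ->
  (\int[N01]_x g x = \int[leb]_x (g x * (normal_pdf 0 1 x)%:E))%E.
Proof.
move=> mg g0; apply: ge0_integral_density => //; first exact: measurable_normal_pdf.
by move=> x; exact: normal_pdf_ge0.
Qed.

Lemma normal_prob_tilt (u : R) (A : set R) : measurable A ->
  (\int[N01]_(x in A) (expR (u * x - u ^+ 2 / 2))%:E = normal_prob u 1 A)%E.
Proof.
move=> mA; rewrite integral_mkcond ge0_integral_normal_prob; last 2 first.
- apply/(measurable_restrictT _ _).1 => //; apply/measurable_EFinP.
  apply: measurable_funTS; apply: continuous_measurable_fun => x.
  by apply: continuous_comp; [apply: cvgB; [apply: cvgM => //; exact: cvg_cst|exact: cvg_cst]|exact: continuous_expR].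
- by move=> x; rewrite /patch; case: ifPn => // _; rewrite lee_fin expR_ge0.
rewrite /normal_prob [RHS]integral_mkcond; apply: eq_integral => x _.
rewrite /patch; case: ifPn => _; last by rewrite mul0e.
by rewrite [in RHS]normal_pdf_tilt -EFinM.
Qed.

Lemma integral_normal_tilt (u : R) :
  (\int[N01]_x (expR (u * x - u ^+ 2 / 2))%:E = 1)%E.
Proof. by rewrite normal_prob_tilt// probability_setT. Qed.

End gaussian_integrals.

Section normal_shift.
Context {R : realType}.
Notation leb := (@lebesgue_measure R).

Lemma measurable_shift (u : R) :
  measurable_fun [set: measurableTypeR R] ((fun x => x + u) : measurableTypeR R -> measurableTypeR R).
Proof.
by have m : measurable_fun [set: R] (fun x => x + u) by exact: measurable_funD.
Qed.

Lemma lebesgue_measure_shift (u : R) (A : set R) : measurable A ->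
  leb ((fun x => x + u) @^-1` A) = leb A.
Proof.
move=> mA; have mS := measurable_shift u.
apply/esym; rewrite -[RHS]/(pushforward leb ((fun x => x + u) : measurableTypeR R -> measurableTypeR R) A).
apply: lebesgue_measure_unique => // _ [[a b] _ <-] /=; rewrite /pushforward.
rewrite (_ : _ @^-1` _ = `]a - u, b - u]%classic); last first.
  by apply/seteqP; split=> x /=; rewrite !in_itv/= ltrBlDr lerBrDr.
rewrite !lebesgue_measure_itv/= !lte_fin ltrD2r; case: ifP => // _.
by rewrite -!EFinD; congr EFin; ring.
Qed.

Lemma ge0_integral_shift (u : R) (g : R -> \bar R) : measurable_fun setT g ->
  (forall x, 0 <= g x)%E -> (\int[leb]_x g (x + u)%R = \int[leb]_x g x)%E.
Proof.
move=> mg g0.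
rewrite -[LHS](ge0_integral_pushforward (measurable_shift u) leb measurableT mg)//.
apply: (@eq_measure_integral _ _ _ _ _ (pushforward leb _)).
  exact: measurable_shift.
by move=> mS A mA _; exact: lebesgue_measure_shift.
Qed.

Lemma normal_prob_shift (u : R) (A : set R) : measurable A ->
  normal_prob 0 1 [set x | A (x + u)] = normal_prob u 1 A.
Proof.
move=> mA; rewrite /normal_prob [LHS]integral_mkcond [RHS]integral_mkcond.
rewrite -[RHS](ge0_integral_shift u).
- apply: eq_integral => x _; rewrite /patch.
  have -> : (x \in [set x | A (x + u)]) = (x + u \in A) by apply/idP/idP; rewrite !inE.
  by case: ifP => // _; rewrite !normal_pdf01E subr0 addrK.
- apply/(measurable_restrictT _ _).1 => //; apply/measurable_EFinP.
  by apply: measurable_funTS; exact: measurable_normal_pdf.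
- by move=> x; rewrite /patch; case: ifP => // _; rewrite lee_fin normal_pdf_ge0.
Qed.

End normal_shift.

(** * Exponential moments of Gaussian vectors *)

Section exponential_moments.
Context {R : realType} dT (T : measurableType dT) (Pr : probability T R).
Notation N01 := (@normal_prob R 0 1).

Lemma ge0_integral_std_normal (X : {RV Pr >-> R}) (g : R -> \bar R) :
  is_std_normal X -> measurable_fun setT g -> (forall x, 0 <= g x)%E ->
  (\int[Pr]_t g (X t) = \int[N01]_x g x)%E.
Proof.
move=> hX mg g0.
pose X' : T -> measurableTypeR R := X.
have mX' : measurable_fun setT X' 
  by have mX : measurable_fun setT X by []; move=> mT A mA; exact: mX mT A mA.
rewrite -[LHS](ge0_integral_pushforward mX' Pr measurableT mg)//.
by apply: eq_measure_integral => A mA _; exact: hX.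
Qed.

Lemma measurable_fun_cst_expR (f : R -> R) : continuous f ->
  measurable_fun setT (fun x => (expR (f x))%:E).
Proof.
move=> cf; apply/measurable_EFinP; apply: continuous_measurable_fun => x.
by apply: continuous_comp; [exact: cf|exact: continuous_expR].
Qed.

Lemma integral_expR_std_normal (X : {RV Pr >-> R}) (u : R) : is_std_normal X ->
  (\int[Pr]_t (expR (u * X t))%:E = (expR (u ^+ 2 / 2))%:E)%E.
Proof.
move=> hX.
rewrite (ge0_integral_std_normal (g := fun x => (expR (u * x))%:E) hX); last 2 first.
- by apply: measurable_fun_cst_expR; exact: mulrl_continuous.
- by move=> x; rewrite lee_fin expR_ge0.
under eq_integral => x _.
  rewrite (_ : expR (u * x) = expR (u ^+ 2 / 2) * expR (u * x - u ^+ 2 / 2)); last first.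
    by rewrite -expRD; congr expR; ring.
  rewrite EFinM; over.
rewrite ge0_integralZl_EFin//.
- by rewrite integral_normal_tilt mule1.
- by apply: measurable_fun_cst_expR => x; apply: cvgB; [exact: mulrl_continuous|exact: cvg_cst].
Qed.

Variables (d : nat) (Z : 'I_d -> {RV Pr >-> R}).
Hypothesis hZ : forall i, is_std_normal (Z i).

Definition normZ (t : T) : R := \sum_i `|Z i t|.

Lemma normZ_ge0 t : 0 <= normZ t. Proof. exact: sumr_ge0. Qed.

Lemma le_normZ i t : `|Z i t| <= normZ t.
Proof. by rewrite /normZ (bigD1 i)//= lerDl sumr_ge0. Qed.

Lemma measurable_normZ : measurable_fun setT normZ.
Proof.
by apply: measurable_sum => i; exact: measurableT_comp.
Qed.

Lemma integrable_expR_normZ (b : R) :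
  Pr.-integrable setT (fun t => (expR (b * normZ t))%:E).
Proof.
wlog b0 : b / 0 <= b.
  move=> W; apply: le_integrable (W `|b| (normr_ge0 _)) => //.
    apply/measurable_EFinP; apply: measurableT_comp => //.
    by apply: measurable_funM => //; exact: measurable_normZ.
  move=> t _; rewrite !gee0_abs ?lee_fin ?expR_ge0// ler_expR.
  by rewrite ler_wpM2r ?normZ_ge0// ler_norm.
(* For an index i of largest modulus, b times the sum of all |Z_k| is at most K |Z_i|, and e^(K |z|)
   <= e^(K z) + e^(-K z), whose expectation is known. *)
pose K := b * d.+1%:R.
have le t : expR (b * normZ t) <= 1 + \sum_i (expR (K * Z i t) + expR (- K * Z i t)).
  have [d0|/existsP[i0 hi]] := boolP [forall i, `|Z i t| == 0].
    rewrite /normZ big1 ?mulr0 ?expR0; last by move=> i _; apply/eqP/(forallP d0).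
    by rewrite lerDl; apply: sumr_ge0 => i _; rewrite addr_ge0 ?expR_ge0.
  have [i _ iM] := @arg_maxP _ _ _ i0 xpredT (fun i => `|Z i t|) isT.
  apply: (@le_trans _ _ (expR (K * `|Z i t|))).
    rewrite ler_expR /K -mulrA; apply: ler_wpM2l => //.
    rewrite mulr_natl (le_trans (ler_sum _ (fun k _ => iM k isT)))//.
    by rewrite sumr_const card_ord; apply: ler_wpMn2l.
  rewrite ler_wpDl// (bigD1 i)//= ler_wpDr//.
    by apply: sumr_ge0 => k _; rewrite addr_ge0 ?expR_ge0.
  case: (leP 0 (Z i t)) => Zi.
    by rewrite ger0_norm// lerDl expR_ge0.
  by rewrite ltr0_norm// mulrN mulNr lerDr expR_ge0.
have iK (k : R) i : Pr.-integrable setT (EFin \o (fun t => expR (k * Z i t))).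
  apply/integrableP; split.
    apply/measurable_EFinP; apply: measurableT_comp => //.
    by apply: measurable_funM => //; exact: measurable_funP.
  under eq_integral do rewrite /= ger0_norm ?expR_ge0//.
  by rewrite integral_expR_std_normal// ltry.
apply: (@le_integrable _ _ _ Pr setT measurableT _ (EFin \o (fun t => 1 + \sum_i (expR (K * Z i t) + expR (- K * Z i t))))).
- apply/measurable_EFinP; apply: measurableT_comp => //.
  by apply: measurable_funM => //; exact: measurable_normZ.
- move=> t _ /=; rewrite lee_fin ger0_norm ?expR_ge0//.
  by apply: (le_trans (le t)); exact: ler_norm.
- have i1 : Pr.-integrable setT (EFin \o cst (1 : R)).
    exact: finite_measure_integrable_cst.
  have i2 : Pr.-integrable setT
      (EFin \o (fun t => \sum_i (expR (K * Z i t) + expR (- K * Z i t)))).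
    rewrite (_ : _ \o _ = (fun t => (\sum_i (expR (K * Z i t) + expR (- K * Z i t))%R%:E)%E)); last first.
      by apply/funext => t; rewrite /= sumEFin.
    apply: integrable_sum => // i _.
    exact: (integrableD measurableT (iK K i) (iK (- K) i)).
  exact: (integrableD measurableT i1 i2).
Qed.

Lemma integrable_le_expR (X : T -> R) (C b : R) : measurable_fun setT X ->
  (forall t, `|X t| <= C * expR (b * normZ t)) ->
  Pr.-integrable setT (EFin \o X).
Proof.
move=> mX XC.
apply: (@le_integrable _ _ _ Pr setT measurableT _ (EFin \o (fun t => C * expR (b * normZ t)))).
- exact/measurable_EFinP.
- by move=> t _; rewrite lee_fin (le_trans (XC t))// ler_norm.
- exact: (@integrableZl _ _ _ Pr setT measurableT C _ (integrable_expR_normZ b)).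
Qed.

End exponential_moments.

(** * The Cameron-Martin formula *)

Section cameron_martin.
Context {R : realType} dT (T : measurableType dT) (Pr : probability T R).
Variables (d : nat) (Z : 'I_d -> {RV Pr >-> R}).
Hypothesis hZ : std_normal_vector Z.
Notation N01 := (@normal_prob R 0 1).
Implicit Types (u : 'I_d -> R) (s : seq 'I_d) (A : 'I_d -> set R).

Let hZ1 : forall i, is_std_normal (Z i) := hZ.1.

Definition tilt u s (t : T) : R :=
  \prod_(k <- s) expR (u k * Z k t - u k ^+ 2 / 2).

Lemma tilt_ge0 u s t : 0 <= tilt u s t.
Proof. by apply: prodr_ge0 => k _; exact: expR_ge0. Qed.

Lemma measurable_tilt u s : measurable_fun setT (tilt u s).
Proof.
apply: measurable_prod => k _; apply: measurableT_comp => //.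
by apply: measurable_funB => //; apply: measurable_funM.
Qed.

Lemma integrable_tilt u s : Pr.-integrable setT (EFin \o tilt u s).
Proof.
pose U := \sum_(k <- s) `|u k|.
apply: (@integrable_le_expR _ _ _ Pr _ Z hZ1 _ 1 U); first exact: measurable_tilt.
move=> t; rewrite ger0_norm ?tilt_ge0// mul1r /tilt /U {U}.
elim: s => [|k s IH]; first by rewrite !big_nil mul0r expR0.
rewrite [in leLHS]big_cons [in leRHS]big_cons mulrDl [leRHS]expRD.
apply: ler_pM; [exact: expR_ge0|exact: tilt_ge0| |exact: IH].
rewrite ler_expR lerBlDr ler_wpDr ?divr_ge0 ?sqr_ge0//.
by rewrite (le_trans (ler_norm _))// normrM ler_wpM2l// le_normZ.
Qed.

Definition box A : set T := [set t | forall i, A i (Z i t)].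

Lemma measurable_box A : (forall i, measurable (A i)) -> measurable (box A).
Proof.
move=> mA; have -> : box A = \bigcap_(i in [set: 'I_d]) (Z i @^-1` A i).
  by apply/seteqP; split=> t /= h i; [move=> _|]; exact: h.
apply: fin_bigcap_measurable => // i _.
by rewrite -[X in measurable X]setTI; exact: measurable_funP.
Qed.

Lemma probability_box A : (forall i, measurable (A i)) ->
  Pr (box A) = (\prod_i N01 (A i))%E.
Proof.
move=> mA; have -> : box A = \bigcap_(i in [set` [set: 'I_d]%SET]) (Z i @^-1` A i).
  apply/seteqP; split=> t /= h i; first by move=> _; exact: h.
  by apply: h; rewrite /= finset.in_setT.
rewrite hZ.2// (eq_bigl xpredT); last by move=> i; rewrite finset.in_setT.
by apply: eq_bigr => i _; exact: hZ1.
Qed.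

(** Induction on the tilted coordinates. Tilt in the coordinates of s and restrict to the box in all
    coordinates but k: by induction the law of Z_k is then c N(0, 1), and the tilt in coordinate k
    turns N(0, 1) into N(u_k, 1). *)
Lemma integral_tilt_box u s A : (forall i, measurable (A i)) -> uniq s ->
  (\int[Pr]_(t in box A) (tilt u s t)%:E =
   \prod_i (if i \in s then normal_prob (u i) 1 (A i) else N01 (A i)))%E.
Proof.
elim: s A => [|k s IH] A mA.
  move=> _; under eq_integral do rewrite /tilt big_nil.
  by rewrite integral_cst ?mul1e; [exact: probability_box|exact: measurable_box].
rewrite /= => /andP[ks us].
pose A' (B : set R) i := if i == k then B else A i.
have mA' B : measurable B -> forall i, measurable (A' B i).
  by move=> mB i; rewrite /A'; case: eqP.
pose c := (\prod_(i | i != k) (if i \in s then normal_prob (u i) 1 (A i) else N01 (A i)))%E.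
have c0 : (0 <= c)%E.
  by apply: prode_ge0 => i _; case: ifP => _; exact: measure_ge0.
have cfin : c \is a fin_num.
  rewrite /c; elim/big_ind : _ => //; first by move=> x y; exact: fin_numM.
  by move=> i _; case: ifP => _; apply: fin_num_measure; exact: mA.
have IHB B : measurable B ->
    (\int[Pr]_(t in box (A' B)) (tilt u s t)%:E = c * N01 B)%E.
  move=> mB; rewrite IH//; last exact: mA'.
  rewrite (bigD1 k)//= (negPf ks) {1}/A' eqxx muleC; congr (_ * _)%E.
  by apply: eq_bigr => i ik; rewrite /A' (negPf ik).
(* [A' setT] leaves coordinate k free, so that only the event that Z_k lies in B varies below. *)
pose f t := tilt u s t * \1_(box (A' setT)) t.
have mbox B : measurable B -> measurable (box (A' B)).
  by move=> mB; apply: measurable_box; exact: mA'.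
have f0 t : 0 <= f t by rewrite mulr_ge0 ?tilt_ge0.
have mf : measurable_fun setT f.
  apply: measurable_funM; first exact: measurable_tilt.
  by apply: measurable_indic; exact: mbox.
have intf : Pr.-integrable setT (EFin \o f).
  apply: le_integrable (integrable_tilt u s) => //; first exact/measurable_EFinP.
  move=> t _; rewrite lee_fin normrM ler_piMr//.
  by rewrite indicE; case: (_ \in _); rewrite ?normr1 ?normr0.
have fE (g : T -> \bar R) B : measurable B ->
    (\int[Pr]_(t in box (A' B)) (g t * (tilt u s t)%:E) =
     \int[Pr]_(t in Z k @^-1` B) (g t * (f t)%:E))%E.
  move=> mB; rewrite [LHS]integral_mkcond [RHS]integral_mkcond.
  apply: eq_integral => t _; rewrite /patch /f.
  have -> : (t \in box (A' B)) = (t \in Z k @^-1` B) && (t \in box (A' setT)).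
    apply/idP/andP; rewrite !inE.
      move=> h; split; first by have := h k; rewrite /A' eqxx.
      by move=> i; have := h i; rewrite /A'; case: eqP.
    by move=> [h1 h2] i; have := h2 i; rewrite /A'; case: eqP => // ->.
  rewrite indicE; case: (t \in Z k @^-1` B) => //=.
  by case: (t \in _); rewrite ?mulr1// mulr0 mule0.
pose nu := weighted f0 intf.
pose X : T -> measurableTypeR R := Z k.
have mX : measurable_fun setT X.
  by have mX : measurable_fun setT (Z k) by []; move=> mT B mB; exact: mX mT B mB.
have nuE (B : set R) : measurable B -> (pushforward nu X B = c * N01 B)%E.
  move=> mB; rewrite -IHB// /pushforward /nu /weighted.
  transitivity (\int[Pr]_(t in Z k @^-1` B) (cst 1 t * (f t)%:E))%E.
    by apply: eq_integral => t _; rewrite mul1e.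
  by rewrite -fE//; apply: eq_integral => t _; rewrite mul1e.
have cE : c = (fine c)%:E by rewrite fineK.
pose e (x : R) := expR (u k * x - u k ^+ 2 / 2).
have me : measurable_fun setT (EFin \o e).
  by apply: measurable_fun_cst_expR => x; apply: cvgB; [exact: mulrl_continuous|exact: cvg_cst].
have -> : box A = box (A' (A k)).
  by congr box; apply/funext => i; rewrite /A'; case: eqP => [->|].
transitivity (\int[Pr]_(t in box (A' (A k))) ((EFin \o e \o Z k) t * (tilt u s t)%:E))%E.
  by apply: eq_integral => t _; rewrite /tilt big_cons EFinM.
rewrite fE// integral_mkcond.
pose eA := (EFin \o e) \_ (A k).
have meA : measurable_fun setT eA.
  by apply/(measurable_restrictT _ _).1 => //; exact: measurable_funTS.
have eA0 x : (0 <= eA x)%E.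
  by rewrite /eA /patch; case: ifP => // _; rewrite lee_fin expR_ge0.
transitivity (\int[Pr]_t (eA (X t) * (f t)%:E))%E.
  apply: eq_integral => t _; rewrite /patch /eA /patch.
  have -> : (t \in Z k @^-1` A k) = (X t \in A k) by apply/idP/idP; rewrite !inE.
  by case: ifP => //; rewrite mul0e.
rewrite -(@ge0_integral_density _ _ _ Pr (weighted f0 intf) f (eA \o X))//; last 2 first.
- exact: (measurableT_comp meA mX).
- by move=> t; exact: eA0.
rewrite -(ge0_integral_pushforward mX (weighted f0 intf) measurableT meA)//.
pose c' := NngNum (fine_ge0 c0).
rewrite (eq_measure_integral (mscale c' N01)); last first.
  by move=> B mB _; rewrite [LHS]nuE// cE.
rewrite ge0_integral_mscale// -cE -integral_mkcond normal_prob_tilt//.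
rewrite (bigD1 k)//= inE eqxx /= muleC; congr (_ * _)%E.
by apply: eq_bigr => i ik; rewrite inE (negPf ik).
Qed.

(** Tuples carry the product sigma-algebra, on which measures can be compared through boxes. *)
Definition tup (X : 'I_d -> T -> R) (t : T) : d.-tuple (measurableTypeR R) :=
  [tuple X i t | i < d].

Lemma measurable_tup (X : 'I_d -> T -> R) : (forall i, measurable_fun setT (X i)) ->
  measurable_fun setT (tup X).
Proof.
move=> mX; apply/measurable_fun_tnthP => i.
rewrite (_ : _ \o _ = X i); last by apply/funext => t; rewrite /= tnth_mktuple.
by move=> mT B mB; exact: mX.
Qed.

(** Both sides are finite measures in [B] that agree on boxes, a generating class stable under
    intersection. On a box, shift and tilt both factor over the coordinates. *)
Lemma cameron_martin_measure u (B : set (d.-tuple (measurableTypeR R))) :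
  measurable B ->
  Pr (tup (fun i t => Z i t + u i) @^-1` B) =
  (\int[Pr]_(t in tup Z @^-1` B) (tilt u (enum 'I_d) t)%:E)%E.
Proof.
pose G := [set B : set (d.-tuple (measurableTypeR R)) | exists2 A : 'I_d -> set R,
  (forall i, measurable (A i)) & B = [set x | forall i, A i (tnth x i)]].
have mZu : measurable_fun setT (tup (fun i t => Z i t + u i)).
  by apply: measurable_tup => i; apply: measurable_funD.
have mZ : measurable_fun setT (tup Z) by apply: measurable_tup => i.
pose mu1 := pushforward Pr (tup (fun i t => Z i t + u i)).
pose w := weighted (tilt_ge0 u (enum 'I_d)) (integrable_tilt u (enum 'I_d)).
pose mu2 := pushforward w (tup Z).
have Gm : G `<=` measurable.
  move=> _ [A mA ->].
  rewrite (_ : [set _ | _] = \bigcap_(i in [set: 'I_d]) ((fun x : d.-tuple (measurableTypeR R) => tnth x i) @^-1` A i)); last first.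
    by apply/seteqP; split=> x /= h i; [move=> _|]; exact: h.
  apply: fin_bigcap_measurable => // i _.
  by rewrite -[X in measurable X]setTI; apply: measurable_tnth => //; exact: mA.
move=> mB.
have sB : <<s G >> B.
  move: B mB; apply: smallest_sub; first exact: smallest_sigma_algebra.
  move=> B hB; apply: sub_sigma_algebra; move: hB.
  rewrite -bigcup_seq => -[/= i _ [C mC <-]].
  exists (fun j => if j == i then C else setT).
    by move=> j; case: eqP.
  apply/seteqP; split=> x /=.
    by move=> [_ Cx] j; case: eqP => // ->.
  by move=> /(_ i); rewrite eqxx.
apply: (@g_sigma_algebra_measure_unique _ R _ G Gm (fun=> setT) _ _ mu1 mu2 _ _ _ B sB).
- by move=> _; exists (fun=> setT) => //; apply/seteqP; split.
- by rewrite bigcup_const.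
- move=> _ _ [A1 mA1 ->] [A2 mA2 ->]; exists (fun i => A1 i `&` A2 i).
    by move=> i; exact: measurableI.
  apply/seteqP; split=> x /=; first by move=> [h1 h2] i; split.
  by move=> h; split=> i; have [] := h i.
- move=> _ [A mA ->]; rewrite /mu1 /mu2 /pushforward /w /weighted.
  pose A' i := [set x | A i (x + u i)].
  have mA' i : measurable (A' i).
    rewrite /A' -[X in measurable X]setTI.
    by apply: measurable_funD.
  transitivity (Pr (box A')).
    suff -> : box A' = tup (fun i t => Z i t + u i) @^-1` [set x | forall i, A i (tnth x i)] by [].
    by apply/seteqP; split=> t /= h i; have := h i; rewrite tnth_mktuple.
  transitivity (\int[Pr]_(t in box A) (tilt u (enum 'I_d) t)%:E)%E; last first.
    congr (integral Pr _ _).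
    by apply/seteqP; split=> t /= h i; have := h i; rewrite tnth_mktuple.
  rewrite probability_box// integral_tilt_box ?enum_uniq//.
  apply: eq_bigr => i _; rewrite mem_enum.
  exact: normal_prob_shift.
- move=> _; rewrite /mu1 /pushforward.
  apply: (@le_lt_trans _ _ 1%E); last exact: ltry.
  by apply: probability_le1; rewrite preimage_setT.
Qed.

Lemma ge0_cameron_martin u (F : 'cV[R]_d -> R) : continuous F -> (forall x, 0 <= F x) ->
  (\int[Pr]_t (F (rvec Z t + \col_i u i))%:E =
   \int[Pr]_t (F (rvec Z t) * tilt u (enum 'I_d) t)%:E)%E.
Proof.
move=> cF F0.
pose G (x : d.-tuple (measurableTypeR R)) := (F (\col_i tnth x i))%:E.
have mG : measurable_fun setT G.
  apply/measurable_EFinP; apply: measurable_continuous_col => // i mT B mB.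
  by apply: measurable_tnth => //; exact: mB.
have G0 x : (0 <= G x)%E by rewrite lee_fin.
have mZu : measurable_fun setT (tup (fun i t => Z i t + u i)).
  by apply: measurable_tup => i; apply: measurable_funD.
have mZ : measurable_fun setT (tup Z) by apply: measurable_tup => i.
pose w := weighted (tilt_ge0 u (enum 'I_d)) (integrable_tilt u (enum 'I_d)).
transitivity (\int[Pr]_t G (tup (fun i t => (Z i t + u i)%R) t))%E.
  apply: eq_integral => t _; rewrite /G; congr ((F _)%:E).
  by apply/matrixP => i j; rewrite !mxE tnth_mktuple.
rewrite -[LHS](ge0_integral_pushforward mZu Pr measurableT mG)//.
rewrite (eq_measure_integral (pushforward w (tup Z))); last first.
  by move=> B mB _; exact: cameron_martin_measure.
rewrite (ge0_integral_pushforward mZ w measurableT mG)//.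
rewrite (@ge0_integral_density _ _ _ Pr w (tilt u (enum 'I_d)) (G \o tup Z)) //.
- apply: eq_integral => t _; rewrite /G /= -EFinM; congr ((F _ * _)%:E).
  by apply/matrixP => i j; rewrite !mxE tnth_mktuple.
- exact: measurable_tilt.
- by move=> t; exact: tilt_ge0.
- exact: (measurableT_comp mG mZ).
- by move=> t; exact: G0.
Qed.

End cameron_martin.

(** * The Ornstein-Uhlenbeck semigroup *)

Section one_norm.
Context {R : realType} (d : nat).
Implicit Types (x y : 'cV[R]_d) (F G : 'cV[R]_d -> R).

Definition norm1 x : R := \sum_i `|x i 0|.

Lemma norm1_ge0 x : 0 <= norm1 x. Proof. exact: sumr_ge0. Qed.

Lemma le_norm1 x i : `|x i 0| <= norm1 x.
Proof. by rewrite /norm1 (bigD1 i)//= lerDl sumr_ge0. Qed.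

Lemma norm10 : norm1 0 = 0.
Proof. by rewrite /norm1 big1// => i _; rewrite mxE normr0. Qed.

Lemma norm1D x y : norm1 (x + y) <= norm1 x + norm1 y.
Proof.
by rewrite /norm1 -big_split; apply: ler_sum => i _; rewrite mxE ler_normD.
Qed.

Lemma norm1N x : norm1 (- x) = norm1 x.
Proof. by apply: eq_bigr => i _; rewrite mxE normrN. Qed.

Lemma norm1Z (a : R) x : norm1 (a *: x) = `|a| * norm1 x.
Proof. by rewrite /norm1 mulr_sumr; apply: eq_bigr => i _; rewrite mxE normrM. Qed.

Lemma norm1_delta i : norm1 (delta_mx i 0) = 1.
Proof.
rewrite /norm1 (bigD1 i)//= big1 ?addr0; first by rewrite mxE !eqxx normr1.
by move=> k ki; rewrite mxE (negPf ki) normr0.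
Qed.

Lemma norm1_mulmx (M : 'M[R]_d) x :
  norm1 (M *m x) <= (\sum_i \sum_j `|M i j|) * norm1 x.
Proof.
rewrite /norm1 mulr_suml; apply: ler_sum => i _.
rewrite mxE (le_trans (ler_norm_sum _ _ _))// mulr_suml; apply: ler_sum => j _.
by rewrite normrM ler_wpM2l// le_norm1.
Qed.

Lemma continuous_realM F G : continuous F -> continuous G -> continuous (fun x => F x * G x).
Proof. by move=> cF cG x; apply: continuousM; [exact: cF|exact: cG]. Qed.

Lemma continuous_realD F G : continuous F -> continuous G -> continuous (fun x => F x + G x).
Proof. by move=> cF cG x; apply: continuousD; [exact: cF|exact: cG]. Qed.

Lemma continuous_realZ (c : R) F : continuous F -> continuous (fun x => c * F x).
Proof. by move=> cF; apply: continuous_realM => // x; exact: cst_continuous. Qed.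

Lemma continuous_real_expR F : continuous F -> continuous (fun x => expR (F x)).
Proof.
move=> cF x; apply: (@continuous_comp _ _ _ F expR); first exact: cF.
exact: continuous_expR.
Qed.

Lemma continuous_norm1 : continuous norm1.
Proof.
apply: continuous_big => [|i _ x]; first exact: add_continuous.
apply: (@continuous_comp _ _ _ (fun y : 'cV[R]_d => y i 0) (fun y : R => `|y|)).
  exact: coord_continuous.
exact: norm_continuous.
Qed.

Definition exp_bounded F :=
  exists C a : R, [/\ 0 <= C, 0 <= a & forall x, `|F x| <= C * expR (a * norm1 x)].

(** The class on which the semigroup acts below: it makes Gaussian expectations finite and contains
    the partial derivatives of h o g up to the last order at which they exist everywhere. *)
Definition exp_lipschitz F :=
  exists C a : R, [/\ 0 <= C, 0 <= a &
    forall x y, `|F x - F y| <= C * norm1 (x - y) * expR (a * (norm1 x + norm1 y))].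

Lemma ler_expR1 (x : R) : x <= expR x.
Proof. by apply: le_trans (expR_ge1Dx x); rewrite lerDr. Qed.

Lemma exp_lipschitz_bounded F : exp_lipschitz F -> exp_bounded F.
Proof.
move=> [C [a [C0 a0 FC]]]; exists (`|F 0| + C), (a + 1); split=> [||x].
- by rewrite addr_ge0.
- by rewrite addr_ge0.
have -> : F x = F 0 + (F x - F 0) by ring.
rewrite (le_trans (ler_normD _ _))// mulrDl lerD//.
  rewrite ler_peMr// -expR0 ler_expR mulr_ge0 ?addr_ge0 ?norm1_ge0//.
rewrite (le_trans (FC _ _))// subr0 norm10 addr0 mulrDl mul1r addrC expRD mulrA.
by rewrite ler_wpM2r ?expR_ge0// ler_wpM2l// ler_expR1.
Qed.

Lemma exp_lipschitz_continuous F : exp_lipschitz F -> continuous F.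
Proof.
move=> [C [a [C0 a0 FC]]] x.
pose e y := C * norm1 (x - y) * expR (a * (norm1 x + norm1 y)).
have ce : e y @[y --> x] --> (0 : R).
  have -> : 0 = e x by rewrite /e subrr norm10 mulr0 mul0r.
  suff : {for x, continuous e} by [].
  apply: continuousM.
    apply: continuousM; first exact: cst_continuous.
    apply: (@continuous_comp _ _ _ (fun y => x - y) norm1); last exact: continuous_norm1.
    by apply: continuousB; [exact: cst_continuous|].
  apply: (@continuous_comp _ _ _ (fun y => a * (norm1 x + norm1 y)) expR); last exact: continuous_expR.
  apply: continuousM; first exact: cst_continuous.
  by apply: continuousD; [exact: cst_continuous|exact: continuous_norm1].
rewrite /continuous_at; apply/(@cvgrPdist_le _ _ _ (nbhs x) _ F (F x)) => eps eps0.
move: ce => /cvgr0Pnorm_le/(_ _ eps0); apply: filterS => y; rewrite /e.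
by move=> h; apply: le_trans (FC _ _) (le_trans (ler_norm _) h).
Qed.

Lemma exp_boundedM F G : exp_bounded F -> exp_bounded G -> exp_bounded (F \* G).
Proof.
move=> [C [a [C0 a0 FC]]] [D [b [D0 b0 GD]]].
exists (C * D), (a + b); split=> [||x]; [exact: mulr_ge0|exact: addr_ge0|].
by rewrite normrM mulrDl expRD mulrACA ler_pM.
Qed.

Lemma exp_bounded_cst (c : R) : exp_bounded (cst c).
Proof.
exists `|c|, 0; split=> // x.
by rewrite mul0r expR0 mulr1.
Qed.

Lemma exp_lipschitz_cst (c : R) : exp_lipschitz (cst c).
Proof.
by exists 0, 0; split=> // x y; rewrite subrr normr0 !mul0r.
Qed.

Lemma exp_bounded_exp (a : R) : exp_bounded (fun x : 'cV[R]_d => expR (a * norm1 x)).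
Proof.
exists 1, `|a|; split=> // x; rewrite mul1r ger0_norm ?expR_ge0// ler_expR.
by rewrite ler_wpM2r ?norm1_ge0// ler_norm.
Qed.

Lemma exp_boundedZ (c : R) F : exp_bounded F -> exp_bounded (fun x => c * F x).
Proof. by move=> bF; apply: (exp_boundedM (F := cst c)) => //; exact: exp_bounded_cst. Qed.

Lemma exp_boundedD F G : exp_bounded F -> exp_bounded G -> exp_bounded (fun x => F x + G x).
Proof.
move=> [C [a [C0 a0 FC]]] [D [b [D0 b0 GD]]].
exists (C + D), (a + b); split; rewrite ?addr_ge0// => x.
rewrite (le_trans (ler_normD _ _))// mulrDl lerD//.
  by rewrite (le_trans (FC x))// ler_wpM2l// ler_expR ler_wpM2r ?norm1_ge0// lerDl.
by rewrite (le_trans (GD x))// ler_wpM2l// ler_expR ler_wpM2r ?norm1_ge0// lerDr.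
Qed.

Lemma continuous_exp_norm1 (a : R) : continuous (fun x : 'cV[R]_d => expR (a * norm1 x)).
Proof.
move=> x; apply: (@continuous_comp _ _ _ (fun y => a * norm1 y) expR); last exact: continuous_expR.
by apply: continuousM; [exact: cst_continuous|exact: continuous_norm1].
Qed.

Lemma exp_bounded_shift F (v : 'cV[R]_d) : exp_bounded F -> exp_bounded (fun x : 'cV[R]_d => F (x + v)).
Proof.
move=> [C [a [C0 a0 FC]]]; exists (C * expR (a * norm1 v)), a.
split=> [||x]; rewrite ?mulr_ge0 ?expR_ge0//.
rewrite (le_trans (FC _))// -mulrA -expRD ler_wpM2l// ler_expR -mulrDr.
by rewrite ler_wpM2l// addrC norm1D.
Qed.

Lemma continuous_shift F (v : 'cV[R]_d) : continuous F -> continuous (fun x : 'cV[R]_d => F (x + v)).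
Proof.
move=> cF x; apply: (@continuous_comp _ _ _ (fun y => y + v) F); last exact: cF.
by apply: continuousD; [|exact: cst_continuous].
Qed.

End one_norm.

(** * Gaussian integration by parts *)

Section gaussian_expectation.
Context {R : realType} dT (T : measurableType dT) (Pr : probability T R).
Variables (d : nat) (Z : 'I_d -> {RV Pr >-> R}).
Hypothesis hZ : std_normal_vector Z.
Implicit Types (F G : 'cV[R]_d -> R) (v : 'cV[R]_d).

Let hZ1 : forall i, is_std_normal (Z i) := hZ.1.

Lemma ExE (X : T -> R) : Ex Pr X = \int[Pr]_t X t.
Proof. by rewrite /Ex unlock. Qed.

Lemma norm1_rvec t : norm1 (rvec Z t) = normZ Z t.
Proof. by apply: eq_bigr => i _; rewrite mxE. Qed.

Lemma measurable_rvec F : continuous F -> measurable_fun setT (fun t => F (rvec Z t)).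
Proof. by move=> cF; exact: (measurable_continuous_col (Y := Z)). Qed.

Lemma integrable_rvec F : continuous F -> exp_bounded F ->
  Pr.-integrable setT (EFin \o (fun t => F (rvec Z t))).
Proof.
move=> cF [C [a [C0 a0 FC]]].
apply: (integrable_le_expR hZ1 (C := C) (b := a)); first exact: measurable_rvec.
by move=> t; rewrite -norm1_rvec.
Qed.

Lemma tiltE (u : 'I_d -> R) t :
  tilt Z u (enum 'I_d) t = expR (\sum_k u k * Z k t - \sum_k u k ^+ 2 / 2).
Proof. by rewrite /tilt big_enum/= -expR_sum sumrB. Qed.

Lemma cameron_martin F v : continuous F -> exp_bounded F ->
  Ex Pr (fun t => F (rvec Z t + v)) =
  Ex Pr (fun t => F (rvec Z t) *
    expR (\sum_k v k 0 * Z k t - \sum_k v k 0 ^+ 2 / 2)).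
Proof.
move=> cF bF; have [C [a [C0 a0 FC]]] := bF.
(* Adding its exponential majorant makes [F] nonnegative; the formula for nonnegative integrands is
   then applied to F + E and to E. *)
pose E (x : 'cV[R]_d) : R := C * expR (a * norm1 x).
have cE : continuous E.
  by apply: continuous_realZ; exact: continuous_exp_norm1.
have bE : exp_bounded E by apply: exp_boundedZ; exact: exp_bounded_exp.
pose F1 x := F x + E x.
have cF1 : continuous F1 by exact: continuous_realD.
have bF1 : exp_bounded F1 by exact: exp_boundedD.
have F10 x : 0 <= F1 x by have := FC x; rewrite ler_norml /F1 /E; lra.
have E0 x : 0 <= E x by rewrite mulr_ge0 ?expR_ge0.
pose tl t := expR (\sum_k v k 0 * Z k t - \sum_k v k 0 ^+ 2 / 2).
have key G : continuous G -> exp_bounded G -> (forall x, 0 <= G x) ->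
    \int[Pr]_t G (rvec Z t + v) = \int[Pr]_t (G (rvec Z t) * tl t).
  move=> cG bG G0; congr fine.
  have := ge0_cameron_martin hZ (fun i => v i 0) cG G0.
  rewrite (_ : \col_i v i 0 = v); last by apply/matrixP => i j; rewrite mxE ord1.
  by move=> ->; apply: eq_integral => t _; rewrite tiltE.
have itl G : continuous G -> exp_bounded G ->
    Pr.-integrable setT (EFin \o (fun t => G (rvec Z t) * tl t)).
  move=> cG bG.
  pose G' (x : 'cV[R]_d) := G x * expR (\sum_k v k 0 * x k 0 - \sum_k v k 0 ^+ 2 / 2).
  rewrite (_ : (fun t => _) = (fun t => G' (rvec Z t))); last first.
    apply/funext => t; rewrite /tl /G'.
    by under [in RHS]eq_bigr do rewrite mxE.
  apply: integrable_rvec.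
    apply: continuous_realM => //; apply: continuous_real_expR.
    apply: continuous_realD; last by move=> x; exact: cst_continuous.
    apply: continuous_big => [|k _ x]; first exact: add_continuous.
    by apply: continuousM; [exact: cst_continuous|exact: coord_continuous].
  apply: exp_boundedM => //.
  exists 1, (norm1 v); split => // [|x]; first exact: norm1_ge0.
  rewrite mul1r ger0_norm ?expR_ge0// ler_expR lerBlDr ler_wpDr//.
    by apply: sumr_ge0 => k _; rewrite divr_ge0// sqr_ge0.
  rewrite (le_trans (ler_norm _))// (le_trans (ler_norm_sum _ _ _))//.
  rewrite mulr_suml; apply: ler_sum => k _.
  by rewrite normrM ler_wpM2l// le_norm1.
rewrite !ExE.
have FE x : F x = F1 x - E x by rewrite /F1; ring.
transitivity (\int[Pr]_t (F1 (rvec Z t + v) - E (rvec Z t + v))).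
  by congr fine; apply: eq_integral => t _; rewrite FE.
rewrite RintegralB//; last 2 first.
- by apply: (integrable_rvec (F := fun x => F1 (x + v))); [exact: continuous_shift|exact: exp_bounded_shift].
- by apply: (integrable_rvec (F := fun x => E (x + v))); [exact: continuous_shift|exact: exp_bounded_shift].
rewrite !key// -RintegralB//; [|exact: itl..].
by congr fine; apply: eq_integral => t _; rewrite [in RHS]FE mulrBl.
Qed.

Lemma norm_expR_sub1 (y : R) : `|expR y - 1| <= `|y| * expR `|y|.
Proof.
have h1 := expR_ge1Dx y; have h2 := expR_ge1Dx (- y).
have e0 := expR_gt0 y.
have [y0|y0] := leP 0 y.
  have e1 : 1 <= expR y by rewrite -expR0 ler_expR.
  rewrite (ger0_norm y0) ger0_norm ?subr_ge0//.
  have : expR y * expR (- y) = 1 by rewrite expRN mulfV// gt_eqF.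
  nra.
have e1 : expR y <= 1 by rewrite -expR0 ler_expR ltW.
rewrite (ltr0_norm y0) ler0_norm ?subr_le0//.
have : 1 <= expR (- y) by rewrite -expR0 ler_expR; lra.
nra.
Qed.

(** Integration by parts for a function that is only continuous: Cameron-Martin moves the shift into
    the exponential weight, whose derivative at 0 is v . Z. *)
Lemma is_derive_gaussian_shift F v : continuous F -> exp_bounded F ->
  is_derive (0 : R) 1 (fun tau : R => Ex Pr (fun t => F (rvec Z t + tau *: v)))
    (Ex Pr (fun t => (\sum_k v k 0 * Z k t) * F (rvec Z t))).
Proof.
move=> cF bF.
pose q := \sum_k v k 0 ^+ 2 / 2.
have q0 : 0 <= q by apply: sumr_ge0 => k _; rewrite divr_ge0// sqr_ge0.
pose l (x : 'cV[R]_d) := \sum_k v k 0 * x k 0.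
have cl : continuous l.
  apply: continuous_big => [|k _ x]; first exact: add_continuous.
  by apply: continuousM; [exact: cst_continuous|exact: coord_continuous].
have ll x : `|l x| <= norm1 v * norm1 x.
  rewrite (le_trans (ler_norm_sum _ _ _))// mulr_suml; apply: ler_sum => k _.
  by rewrite normrM ler_wpM2l// le_norm1.
pose H (tau : R) x := F x * expR (tau * l x - tau ^+ 2 * q).
have -> : (fun tau : R => Ex Pr (fun t => F (rvec Z t + tau *: v))) =
    (fun tau => \int[Pr]_t H tau (rvec Z t)).
  apply/funext => tau; rewrite cameron_martin// ExE; congr fine.
  apply: eq_integral => t _; rewrite /H /l /q !mulr_sumr.
  under eq_bigr do rewrite mxE -mulrA.
  under [X in _ - X]eq_bigr do rewrite mxE exprMn -mulrA.
  by under [in RHS]eq_bigr do rewrite mxE.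
have lZ t : \sum_k v k 0 * Z k t = l (rvec Z t).
  by apply: eq_bigr => k _; rewrite mxE.
rewrite ExE; under eq_Rintegral do rewrite lZ.
(* Domination: |e^y - 1| <= |y| e^|y| with |y| <= |tau| M, and M e^M <= e^(2 M), where M = |v| |x| +
   q. *)
pose L x := F x * expR (2 * (norm1 v * norm1 x + q)).
have cL : continuous (fun x : 'cV[R]_d => expR (2 * (norm1 v * norm1 x + q))).
  apply: continuous_real_expR; apply: continuous_realZ; apply: continuous_realD.
    by apply: continuous_realZ; exact: continuous_norm1.
  by move=> x; exact: cst_continuous.
have bL : exp_bounded (fun x : 'cV[R]_d => expR (2 * (norm1 v * norm1 x + q))).
  exists (expR (2 * q)), (2 * norm1 v); split; rewrite ?expR_ge0 ?mulr_ge0 ?norm1_ge0// => x.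
  by rewrite ger0_norm ?expR_ge0// -expRD ler_expR; lra.
have habs (tau : R) x : `|tau| <= 1 ->
    `|tau * l x - tau ^+ 2 * q| <= `|tau| * (norm1 v * norm1 x + q).
  move=> t1; rewrite (le_trans (ler_normB _ _))// mulrDr !normrM lerD//.
    by rewrite ler_wpM2l.
  rewrite (ger0_norm q0) ler_wpM2r// -[leRHS]mulr1 ler_wpM2l//.
apply: (proj2 (@is_derive_integral _ _ R Pr setT (fun tau t => H tau (rvec Z t))
  (fun t => l (rvec Z t) * F (rvec Z t)) (fun t => `|L (rvec Z t)|) measurableT _ _ _ _)).
- move=> tau tau1; apply: integrable_rvec.
    apply: continuous_realM => //; apply: continuous_real_expR.
    apply: continuous_realD; first exact: continuous_realZ.
    by move=> x; exact: cst_continuous.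
  apply: exp_boundedM => //.
  exists (expR q), (norm1 v); split; rewrite ?expR_ge0 ?norm1_ge0// => x.
  rewrite ger0_norm ?expR_ge0// -expRD ler_expR.
  rewrite (le_trans (ler_norm _))// (le_trans (habs _ _ tau1))//.
  by rewrite addrC ler_piMl// addr_ge0// mulr_ge0 ?norm1_ge0.
- rewrite (_ : EFin \o _ = abse \o (EFin \o (fun t => L (rvec Z t))))//.
  apply: integrable_abse; apply: integrable_rvec; last exact: exp_boundedM.
  exact: continuous_realM.
- move=> tau t tau1 _; rewrite /H /L mul0r expr0n/= mul0r subrr expR0.
  rewrite -mulrBr !normrM mulrCA ler_wpM2l// (le_trans (norm_expR_sub1 _))//.
  set y := _ - _; set M := norm1 v * _ + q.
  have yM : `|y| <= `|tau| * M by exact: habs.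
  have M0 : 0 <= M by rewrite addr_ge0// mulr_ge0 ?norm1_ge0.
  rewrite (ger0_norm (expR_ge0 _)); clearbody M.
  apply: (@le_trans _ _ (`|tau| * M * expR M)).
    rewrite ler_pM ?expR_ge0// ler_expR (le_trans yM)// ler_piMl//.
  rewrite (_ : 2 * M = M + M); last by ring.
  by rewrite expRD -mulrA ler_wpM2l// ler_wpM2r ?expR_ge0// ler_expR1.
- move=> t _; rewrite /H.
  set a := l _; set c := F _.
  pose y (tau : R) : R := tau * a - tau ^+ 2 * q.
  have Hd : is_derive (0 : R) 1 y a.
    by apply: is_derive_eq; rewrite /GRing.scale/=; ring.
  have He : is_derive (y 0) 1 expR 1.
    by rewrite /y mul0r expr0n/= mul0r subrr; apply: is_derive_eq; rewrite expR0.
  have H1 := is_deriveM (is_derive_cst c (0 : R) 1) (is_derive1_comp He Hd).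
  apply: is_derive_eq H1 _.
  by rewrite /GRing.scale/= /y; ring.
Qed.

End gaussian_expectation.

(** * Mehler's formula with a weight *)

Section mehler.
Context {R : realType} dT (T : measurableType dT) (Pr : probability T R).
Variables (d : nat) (Z : 'I_d -> {RV Pr >-> R}) (S : 'M[R]_d).
Hypothesis hZ : std_normal_vector Z.
Implicit Types (kap psi : 'cV[R]_d -> R) (w x y z : 'cV[R]_d) (be : R).
Local Notation e_ i := (delta_mx i 0 : 'cV[R]_d).

(* At [be] = (1 - e^(-2s))^(1/2) and [x] = e^(-s) w this is Mehler's formula for
   P_s psi (w), weighted by [kap]. *)
Definition mehler kap be psi x : R :=
  Ex Pr (fun t => kap (rvec Z t) * psi (x + be *: (S *m rvec Z t))).

Let KS : R := \sum_i \sum_j `|S i j|.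
Let KS0 : 0 <= KS. Proof. by apply: sumr_ge0 => i _; exact: sumr_ge0. Qed.

Lemma exp_lipschitz_affine psi x be : exp_lipschitz psi ->
  exp_lipschitz (fun z : 'cV[R]_d => psi (x + be *: (S *m z))).
Proof.
move=> [C [a [C0 a0 FC]]].
exists (C * (`|be| * KS) * expR (2 * a * norm1 x)), (a * (`|be| * KS)).
split=> [||z z']; rewrite ?mulr_ge0 ?expR_ge0//.
have K y : norm1 (be *: (S *m y)) <= `|be| * KS * norm1 y.
  by rewrite norm1Z -mulrA ler_wpM2l// norm1_mulmx.
rewrite (le_trans (FC _ _))//.
have -> : x + be *: (S *m z) - (x + be *: (S *m z')) = be *: (S *m (z - z')).
  by rewrite mulmxBr scalerBr opprD addrACA subrr add0r.
have h z1 : norm1 (x + be *: (S *m z1)) <= norm1 x + `|be| * KS * norm1 z1.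
  by rewrite (le_trans (norm1D _ _))// lerD2l.
apply: (@le_trans _ _ (C * (`|be| * KS * norm1 (z - z')) * (expR (2 * a * norm1 x) * expR (a * (`|be| * KS) * (norm1 z + norm1 z'))))); last first.
  by rewrite le_eqVlt; apply/orP; left; apply/eqP; ring.
apply: ler_pM; rewrite ?expR_ge0// ?mulr_ge0 ?norm1_ge0//.
  by rewrite ler_wpM2l.
rewrite -expRD ler_expR (_ : 2 * a * norm1 x + _ = a * (norm1 x + `|be| * KS * norm1 z + (norm1 x + `|be| * KS * norm1 z'))); last by ring.
by rewrite ler_wpM2l// lerD.
Qed.

Lemma norm1_affine x be z : `|be| <= 1 ->
  norm1 (x + be *: (S *m z)) <= norm1 x + KS * norm1 z.
Proof.
move=> b1; rewrite (le_trans (norm1D _ _))// lerD2l norm1Z.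
rewrite (le_trans _ (norm1_mulmx S z))// ler_piMl// norm1_ge0//.
Qed.

Lemma integrable_mehler kap be psi x :
  continuous kap -> exp_bounded kap -> exp_lipschitz psi ->
  Pr.-integrable setT
    (EFin \o (fun t => kap (rvec Z t) * psi (x + be *: (S *m rvec Z t)))).
Proof.
move=> ck bk lp; have la := exp_lipschitz_affine x be lp.
apply: (@integrable_rvec _ _ _ _ _ _ hZ (fun z => kap z * psi (x + be *: (S *m z)))).
  by apply: continuous_realM => //; exact: exp_lipschitz_continuous.
by apply: exp_boundedM => //; exact: exp_lipschitz_bounded.
Qed.

(** The dependence on the radius M is kept explicit because the growth of the semigroup in w is read
    off from it. *)
Lemma mehler_lipschitz_pt_growth kap psi : exp_bounded kap -> exp_lipschitz psi ->
  exists C c b : R, [/\ 0 <= C, 0 <= c, 0 <= b & forall (M : R) be be' x x' z,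
    `|be| <= 1 -> `|be'| <= 1 -> norm1 x <= M -> norm1 x' <= M ->
    `|kap z * psi (x + be *: (S *m z)) - kap z * psi (x' + be' *: (S *m z))|
      <= (norm1 (x - x') + `|be - be'|) * (C * expR (c * M) * expR (b * norm1 z))].
Proof.
move=> [D [a [D0 a0 kD]]] [C [c [C0 c0 pC]]].
exists (D * C), (2 * c), (a + KS + 2 * c * KS).
split=> [|||M be be' x x' z b1 b1' xM xM']; rewrite ?addr_ge0 ?mulr_ge0 ?expR_ge0//.
rewrite -mulrBr normrM (le_trans (ler_pM _ _ (kD z) (pC _ _)))//.
set N := norm1 z; have N0 : 0 <= N by exact: norm1_ge0.
set dl := _ + `|be - be'|.
have dl0 : 0 <= dl by rewrite addr_ge0 ?norm1_ge0.
have h1 : norm1 (x + be *: (S *m z) - (x' + be' *: (S *m z))) <= dl * expR (KS * N).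
  have -> : x + be *: (S *m z) - (x' + be' *: (S *m z)) = (x - x') + (be - be') *: (S *m z).
    by rewrite scalerBl opprD addrACA.
  rewrite (le_trans (norm1D _ _))// norm1Z.
  have KN : norm1 (S *m z) <= KS * N by exact: norm1_mulmx.
  have e1 : 1 <= expR (KS * N) by rewrite -expR0 ler_expR mulr_ge0.
  rewrite mulrDl lerD//; first by rewrite ler_peMr// norm1_ge0.
  by rewrite ler_wpM2l// (le_trans KN)// ler_expR1.
have h2 : expR (c * (norm1 (x + be *: (S *m z)) + norm1 (x' + be' *: (S *m z)))) <=
    expR (2 * c * M) * expR (2 * c * KS * N).
  rewrite -expRD ler_expR.
  have := norm1_affine x z b1; have := norm1_affine x' z b1'.
  rewrite -/N; set p := norm1 _; set q := norm1 (_ + _ *: _); nra.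
apply: (@le_trans _ _ (D * expR (a * N) * (C * (dl * expR (KS * N)) * (expR (2 * c * M) * expR (2 * c * KS * N))))).
  rewrite ler_wpM2l ?mulr_ge0 ?expR_ge0// ler_pM ?expR_ge0// ?mulr_ge0 ?norm1_ge0//.
  by rewrite ler_wpM2l.
by rewrite !mulrDl !expRD; rewrite le_eqVlt; apply/orP; left; apply/eqP; ring.
Qed.

Lemma mehler_lipschitz_pt kap psi (M : R) : exp_bounded kap -> exp_lipschitz psi ->
  exists C b : R, [/\ 0 <= C, 0 <= b & forall be be' x x' z,
    `|be| <= 1 -> `|be'| <= 1 -> norm1 x <= M -> norm1 x' <= M ->
    `|kap z * psi (x + be *: (S *m z)) - kap z * psi (x' + be' *: (S *m z))|
      <= (norm1 (x - x') + `|be - be'|) * (C * expR (b * norm1 z))].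
Proof.
move=> bk lp; have [C [c [b [C0 c0 b0 H]]]] := mehler_lipschitz_pt_growth bk lp.
by exists (C * expR (c * M)), b; split; rewrite ?mulr_ge0 ?expR_ge0// => *; exact: H.
Qed.

Lemma RintegralB_le (f g L : T -> R) (k : R) :
  Pr.-integrable setT (EFin \o f) -> Pr.-integrable setT (EFin \o g) ->
  Pr.-integrable setT (EFin \o L) ->
  (forall t, `|f t - g t| <= k * L t) ->
  `|\int[Pr]_t f t - \int[Pr]_t g t| <= k * \int[Pr]_t L t.
Proof.
move=> iF ig iL fgL.
rewrite -RintegralB// -RintegralZl//.
have ifg : Pr.-integrable setT (EFin \o (fun t => f t - g t)).
  exact: (integrableB measurableT iF ig).
apply: (le_trans (le_normr_Rintegral _ ifg)) => //.
apply: le_Rintegral => //.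
- exact: (integrable_norm ifg).
- exact: (@integrableZl _ _ _ Pr setT measurableT k _ iL).
Qed.

Lemma mehler_lipschitz_growth kap psi :
  continuous kap -> exp_bounded kap -> exp_lipschitz psi ->
  exists C c : R, [/\ 0 <= C, 0 <= c & forall (M : R) be be' x x',
    `|be| <= 1 -> `|be'| <= 1 -> norm1 x <= M -> norm1 x' <= M ->
    `|mehler kap be psi x - mehler kap be' psi x'| <=
      (norm1 (x - x') + `|be - be'|) * (C * expR (c * M))].
Proof.
move=> ck bk lp.
have [C [c [b [C0 c0 b0 H]]]] := mehler_lipschitz_pt_growth bk lp.
exists (C * \int[Pr]_t expR (b * normZ Z t)), c; split=> //.
  by rewrite mulr_ge0//; apply: Rintegral_ge0 => t _; rewrite expR_ge0.
move=> M be be' x x' b1 b1' xM xM'; rewrite /mehler !ExE.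
rewrite mulrAC -RintegralZl//; last exact: integrable_expR_normZ hZ.1 b.
apply: RintegralB_le.
- exact: integrable_mehler.
- exact: integrable_mehler.
- exact: (@integrableZl _ _ _ Pr setT measurableT _ _ (integrable_expR_normZ hZ.1 b)).
- by move=> t; rewrite -norm1_rvec; exact: H.
Qed.

Lemma mehler_lipschitz kap psi (M : R) :
  continuous kap -> exp_bounded kap -> exp_lipschitz psi ->
  exists C : R, 0 <= C /\ forall be be' x x',
    `|be| <= 1 -> `|be'| <= 1 -> norm1 x <= M -> norm1 x' <= M ->
    `|mehler kap be psi x - mehler kap be' psi x'| <= (norm1 (x - x') + `|be - be'|) * C.
Proof.
move=> ck bk lp; have [C [c [C0 c0 H]]] := mehler_lipschitz_growth ck bk lp.
by exists (C * expR (c * M)); split; [rewrite mulr_ge0 ?expR_ge0|move=> *; exact: H].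
Qed.

Lemma is_derive_mehler kap be psi psi' i x : `|be| <= 1 ->
  continuous kap -> exp_bounded kap -> exp_lipschitz psi ->
  (forall y, is_derive y (e_ i) psi (psi' y)) ->
  is_derive x (e_ i) (mehler kap be psi) (mehler kap be psi' x).
Proof.
move=> b1 ck bk lp dp.
have [C [b [C0 b0 H]]] := mehler_lipschitz_pt (norm1 x + 1) bk lp.
apply/is_derive_lineP.
rewrite /mehler; under [X in is_derive _ _ X]eq_fun do rewrite ExE.
rewrite ExE.
apply: (proj2 (@is_derive_integral _ _ R Pr setT (fun tau t => kap (rvec Z t) * psi (tau *: e_ i + x + be *: (S *m rvec Z t)))
  _ (fun t => C * expR (b * normZ Z t)) measurableT _ _ _ _)).
- move=> tau _.
  exact: integrable_mehler.
- exact: (@integrableZl _ _ _ Pr setT measurableT C _ (integrable_expR_normZ hZ.1 b)).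
- move=> tau t tau1 _.
  rewrite -norm1_rvec (le_trans (H be be _ _ _ b1 b1 _ _))//.
  + rewrite (le_trans (norm1D _ _))// addrC lerD2l norm1Z norm1_delta mulr1//.
  + by rewrite scale0r add0r lerDl.
  + by rewrite scale0r add0r addrK subrr normr0 addr0 norm1Z norm1_delta mulr1.
- move=> t _.
  have := dp (x + be *: (S *m rvec Z t)) => /is_derive_lineP h.
  have h1 := is_deriveM (is_derive_cst (kap (rvec Z t)) (0 : R) 1) h.
  under eq_fun do rewrite -addrA.
  by apply: is_derive_eq h1 _; rewrite scaler0 addr0.
Qed.


Lemma is_derive_scale (F : 'cV[R]_d -> R) (al : R) w v l :
  is_derive (al *: w) v F l -> is_derive w v (fun w => F (al *: w)) (al * l).
Proof.
move=> /is_derive_lineP h; apply/is_derive_lineP.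
have h1 : is_derive (0 : R) 1 (fun t : R => al * t) al.
  by apply: is_derive_eq; rewrite /GRing.scale/=; ring.
pose G (t : R) := F (t *: v + al *: w).
have h2 : is_derive (al * 0) 1 G l by rewrite mulr0.
have := is_derive1_comp h2 h1.
rewrite (_ : G \o _ = fun t : R => F (al *: (t *: v + w))).
  by move=> H; apply: is_derive_eq H _; rewrite mulrC.
by apply/funext => t; rewrite /G /= scalerDr scalerA.
Qed.

Section sqrt_invertible.
Hypotheses (Ssym : S^T = S) (Sunit : S \in unitmx).

(* The first and second order Hermite polynomials in S^(-1) z: the weights
   produced by one and two Gaussian integrations by parts. *)
Definition dual i (z : 'cV[R]_d) : R := (invmx S *m z) i 0.
Definition dual2 i j (z : 'cV[R]_d) : R :=
  dual i z * dual j z - (invmx S *m invmx S) i j.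

Let invS_sym : (invmx S)^T = invmx S. Proof. by rewrite trmx_inv Ssym. Qed.

Lemma dual2C i j : dual2 i j = dual2 j i.
Proof.
apply/funext => z; rewrite /dual2 mulrC; congr (_ - _).
by rewrite -[in LHS](trmxK (invmx S *m invmx S)) mxE trmx_mul invS_sym.
Qed.

Lemma continuous_dual i : continuous (dual i).
Proof.
rewrite (_ : dual i = fun z => \sum_k invmx S i k * z k 0); last first.
  by apply/funext => z; rewrite /dual mxE.
apply: continuous_big => [|k _]; first exact: add_continuous.
by apply: continuous_realZ; exact: coord_continuous.
Qed.

Lemma exp_bounded_dual i : exp_bounded (dual i).
Proof.
exists (\sum_k \sum_j `|invmx S k j|), 1.
split=> [||z]; rewrite ?ler01//.
  by apply: sumr_ge0 => k _; exact: sumr_ge0.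
rewrite (le_trans (le_norm1 _ i))// (le_trans (norm1_mulmx _ _))//.
rewrite ler_wpM2l ?mul1r ?ler_expR1//.
by apply: sumr_ge0 => k _; exact: sumr_ge0.
Qed.

Lemma continuous_dual2 i j : continuous (dual2 i j).
Proof.
apply: continuous_realD => [|z]; last exact: cst_continuous.
by apply: continuous_realM; exact: continuous_dual.
Qed.

Lemma exp_bounded_dual2 i j : exp_bounded (dual2 i j).
Proof.
apply: exp_boundedD; last exact: exp_bounded_cst.
by apply: exp_boundedM; exact: exp_bounded_dual.
Qed.

(** The direction v with be S v = e_j: shifting Z by tau v shifts x by tau e_j. *)
Let dir be j : 'cV[R]_d := be^-1 *: (invmx S *m e_ j).

Let S_dir be j : be != 0 -> be *: (S *m dir be j) = e_ j.
Proof. by move=> b0; rewrite /dir -scalemxAr scalerA mulfV// scale1r mulKVmx. Qed.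

Let dir_dual be j t : \sum_k dir be j k 0 * Z k t = be^-1 * dual j (rvec Z t).
Proof.
rewrite /dual mxE mulr_sumr; apply: eq_bigr => k _.
rewrite /dir -colE !mxE -mulrA; congr (_ * (_ * _)).
by rewrite -[in LHS]invS_sym mxE.
Qed.

(** The translation of x is absorbed into a translation of Z, which Gaussian integration by parts
    differentiates. *)
Lemma is_derive_mehler_cst be psi x j : be != 0 -> exp_lipschitz psi ->
  is_derive x (e_ j) (mehler (cst 1) be psi) (be^-1 * mehler (dual j) be psi x).
Proof.
move=> b0 lp; apply/is_derive_lineP.
pose F (z : 'cV[R]_d) := psi (x + be *: (S *m z)).
have lF : exp_lipschitz F by exact: exp_lipschitz_affine.
have cF := exp_lipschitz_continuous lF; have bF := exp_lipschitz_bounded lF.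
have H := is_derive_gaussian_shift hZ (dir be j) cF bF.
rewrite (_ : (fun t : R => _) = (fun tau : R => Ex Pr (fun t => F (rvec Z t + tau *: dir be j)))); last first.
  apply/funext => tau; rewrite /mehler; congr (Ex Pr _); apply/funext => t.
  rewrite mul1r /F; congr psi.
  rewrite mulmxDr scalerDr -scalemxAr scalerA mulrC -scalerA S_dir//.
  by rewrite [tau *: _ + x]addrC -addrA; congr (_ + _); exact: addrC.
apply: is_derive_eq H _.
rewrite /mehler !ExE -RintegralZl//; last first.
  by apply: integrable_mehler => //; [exact: continuous_dual|exact: exp_bounded_dual].
by apply: eq_Rintegral => t _; rewrite dir_dual mulrA.
Qed.

Lemma is_derive_mehler_dual be psi x i j : be != 0 -> exp_lipschitz psi ->
  is_derive x (e_ j) (mehler (dual i) be psi) (be^-1 * mehler (dual2 i j) be psi x).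
Proof.
move=> b0 lp; apply/is_derive_lineP.
pose F (z : 'cV[R]_d) := psi (x + be *: (S *m z)).
have lF : exp_lipschitz F by exact: exp_lipschitz_affine.
have cF := exp_lipschitz_continuous lF; have bF := exp_lipschitz_bounded lF.
pose G z := dual i z * F z.
have cG : continuous G by apply: continuous_realM => //; exact: continuous_dual.
have bG : exp_bounded G by apply: exp_boundedM => //; exact: exp_bounded_dual.
set v := dir be j.
have HF := is_derive_gaussian_shift hZ v cF bF.
have HG := is_derive_gaussian_shift hZ v cG bG.
pose f (tau : R) := Ex Pr (fun t => F (rvec Z t + tau *: v)).
pose g (tau : R) := Ex Pr (fun t => G (rvec Z t + tau *: v)).
have iF tau : Pr.-integrable setT (EFin \o (fun t => F (rvec Z t + tau *: v))).
  apply: (integrable_rvec hZ (F := fun z => F (z + tau *: v))).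
    exact: continuous_shift.
  exact: exp_bounded_shift.
have iG tau : Pr.-integrable setT (EFin \o (fun t => G (rvec Z t + tau *: v))).
  apply: (integrable_rvec hZ (F := fun z => G (z + tau *: v))).
    exact: continuous_shift.
  exact: exp_bounded_shift.
(* The weight is not translated along with psi: dual i Z = dual i (Z + tau v) - tau dual i v. The
   correction yields the constant subtracted in [dual2]. *)
rewrite (_ : (fun t : R => _) = (fun tau : R => g tau - dual i v * (tau * f tau))); last first.
  apply/funext => tau; rewrite mulrA.
  have -> : dual i v * tau * f tau =
      \int[Pr]_t (dual i v * tau * F (rvec Z t + tau *: v)).
    by rewrite RintegralZl//; congr (_ * _); exact: ExE.
  rewrite /g /mehler !ExE.
  rewrite -RintegralB//; last exact: (@integrableZl _ _ _ Pr setT measurableT (dual i v * tau) _ (iF tau)).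
  apply: eq_Rintegral => t _.
  have -> : psi (tau *: e_ j + x + be *: (S *m rvec Z t)) = F (rvec Z t + tau *: v).
    rewrite /F; congr psi.
    rewrite mulmxDr scalerDr -scalemxAr [in RHS]scalerA [be * tau]mulrC -scalerA S_dir//.
    by rewrite [tau *: _ + x]addrC -addrA; congr (_ + _); exact: addrC.
  have dD : dual i (rvec Z t + tau *: v) = dual i (rvec Z t) + tau * dual i v.
    by rewrite /dual mulmxDr -scalemxAr mxE [X in _ + X]mxE.
  by rewrite /G dD; ring.
have Hid := is_derive_id (0 : R) 1.
have H1 := is_deriveB HG (is_deriveM (is_derive_cst (dual i v) (0 : R) 1) (is_deriveM Hid HF)).
apply: is_derive_eq H1 _.
have dv : dual i v = be^-1 * (invmx S *m invmx S) i j.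
  by rewrite /dual /v /dir -scalemxAr mulmxA -colE mxE [X in _ * X]mxE.
have E1 : Ex Pr (fun t => (\sum_k v k 0 * Z k t) * G (rvec Z t)) =
    be^-1 * \int[Pr]_t (dual j (rvec Z t) * (dual i (rvec Z t) * F (rvec Z t))).
  rewrite ExE -RintegralZl//.
    by apply: eq_Rintegral => t _; rewrite dir_dual mulrA.
  apply: (integrable_rvec hZ (F := fun z => dual j z * G z)).
    by apply: continuous_realM => //; exact: continuous_dual.
  by apply: exp_boundedM => //; exact: exp_bounded_dual.
have E2 : Ex Pr (fun t => F (rvec Z t + 0 *: v)) = \int[Pr]_t F (rvec Z t).
  by rewrite ExE; apply: eq_Rintegral => t _; rewrite scale0r addr0.
have E3 : mehler (dual2 i j) be psi x =
    \int[Pr]_t (dual j (rvec Z t) * (dual i (rvec Z t) * F (rvec Z t))) -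
    (invmx S *m invmx S) i j * \int[Pr]_t F (rvec Z t).
  rewrite /mehler ExE -RintegralZl//; last exact: (integrable_rvec hZ).
  rewrite -RintegralB//.
  - by apply: eq_Rintegral => t _; rewrite /dual2 /F; ring.
  - apply: (integrable_rvec hZ (F := fun z => dual j z * G z)).
      by apply: continuous_realM => //; exact: continuous_dual.
    by apply: exp_boundedM => //; exact: exp_bounded_dual.
  - exact: (@integrableZl _ _ _ Pr setT measurableT ((invmx S *m invmx S) i j) _ (integrable_rvec hZ cF bF)).
rewrite E1 E2 E3 dv /GRing.scale/=; ring.
Qed.

End sqrt_invertible.


Section polynomial_growth.
Variables (A B : R) (r : 'I_d -> R).
Hypotheses (A0 : 0 <= A) (B0 : 0 <= B) (r0 : forall k, 0 <= r k).

Let Zc k t := (S *m rvec Z t) k 0.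

(** At tau = 0 this is the bracket of (1) for the weight 1 and the bracket of (2) for the weight
    [dual S l]. *)
Definition growth_bound kap (tau : R) w : R :=
  A * Ex Pr (fun t => `|kap (rvec Z t)|) +
  B * \sum_k (2 `^ r k * ((`|w k 0| + tau) `^ r k * Ex Pr (fun t => `|kap (rvec Z t)|) +
     Ex Pr (fun t => `|kap (rvec Z t)| * `|Zc k t| `^ r k))).

(** a + b is at most twice the maximum; this is the origin of the factors 2^(r_i). *)
Lemma powRD_le (p a b : R) : 0 <= p -> 0 <= a -> 0 <= b ->
  (a + b) `^ p <= 2 `^ p * (a `^ p + b `^ p).
Proof.
move=> p0 a0 b0.
wlog ab : a b a0 b0 / a <= b.
  move=> W; have [/W|/ltW/W] := leP a b; first exact.
  by rewrite addrC [_ `^ _ + _]addrC; apply.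
apply: (@le_trans _ _ ((2 * b) `^ p)).
  by apply: ge0_ler_powR; rewrite ?nnegrE ?addr_ge0 ?mulr_ge0//; lra.
by rewrite powRM// ler_wpM2l ?powR_ge0// lerDr powR_ge0.
Qed.

Lemma powR_le_expR (p y : R) : 0 <= p -> 0 <= y -> y `^ p <= expR (p * y).
Proof.
move=> p0; rewrite le_eqVlt => /predU1P[<-|y0].
  by rewrite mulr0 expR0 /powR eqxx; case: (p == 0); rewrite /= ?ler01.
rewrite /powR gt_eqF// ler_expR ler_wpM2l//.
by rewrite -ler_expR lnK ?posrE// ler_expR1.
Qed.

Lemma integrable_normr_kap kap : continuous kap -> exp_bounded kap ->
  Pr.-integrable setT (EFin \o (fun t => `|kap (rvec Z t)|)).
Proof. by move=> ck bk; exact: integrable_norm (integrable_rvec hZ ck bk). Qed.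

Lemma integrable_kap_powR kap k : continuous kap -> exp_bounded kap ->
  Pr.-integrable setT (EFin \o (fun t => `|kap (rvec Z t)| * `|Zc k t| `^ r k)).
Proof.
move=> ck [C [a [C0 a0 kC]]].
apply: (integrable_le_expR hZ.1 (C := C) (b := a + r k * KS)).
  apply: measurable_funM.
    by apply: measurableT_comp => //; exact: measurable_rvec.
  apply: (@measurableT_comp _ _ _ _ _ _ (fun x : R => x `^ r k)).
    exact: measurable_powR.
  apply: measurableT_comp => //.
  rewrite (_ : Zc k = fun t => \sum_j S k j * Z j t); last first.
    by apply/funext => t; rewrite /Zc mxE; apply: eq_bigr => j _; rewrite mxE.
  by apply: measurable_sum => j; apply: measurable_funM.
move=> t; rewrite -norm1_rvec normrM normr_id (ger0_norm (powR_ge0 _ _)) mulrDl expRD mulrA.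
rewrite ler_pM ?powR_ge0//.
rewrite (le_trans (powR_le_expR _ _))// ler_expR -mulrA ler_wpM2l//.
by rewrite (le_trans (le_norm1 _ k))// norm1_mulmx.
Qed.

Lemma growth_bound_ge0 kap (tau : R) w : 0 <= tau -> 0 <= growth_bound kap tau w.
Proof.
move=> t0; have E0 (X : T -> R) : (forall t, 0 <= X t) -> 0 <= Ex Pr X.
  by move=> X0; rewrite ExE; apply: Rintegral_ge0.
rewrite addr_ge0 ?mulr_ge0 ?E0//; apply: sumr_ge0 => k _.
rewrite mulr_ge0 ?powR_ge0// addr_ge0//.
  by rewrite mulr_ge0 ?powR_ge0 ?E0.
by apply: E0 => t; rewrite mulr_ge0 ?powR_ge0.
Qed.

Lemma Qpow_affine_le (al be u : R) w z : 0 <= al <= 1 -> 0 <= be <= 1 ->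
  Qpow A B r `|al * u| (al *: w + be *: (S *m z)) <=
  A + B * \sum_k (2 `^ r k * ((`|w k 0| + `|u|) `^ r k + `|(S *m z) k 0| `^ r k)).
Proof.
move=> /andP[a0 a1] /andP[b0 b1].
rewrite lerD2l ler_wpM2l//; apply: ler_sum => k _.
apply: (le_trans _ (powRD_le (r0 k) (addr_ge0 (normr_ge0 _) (normr_ge0 _)) (normr_ge0 _))).
apply: ge0_ler_powR; rewrite ?nnegrE ?addr_ge0//.
rewrite !mxE normrM (ger0_norm a0) -/(Zc _ _).
have h1 : al * `|u| <= `|u| by rewrite ler_piMl.
rewrite addrAC lerD//.
rewrite (le_trans (ler_normD _ _))// !normrM (ger0_norm a0) (ger0_norm b0) lerD//.
  by rewrite ler_piMl.
by rewrite ler_piMl.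
Qed.

(** A step u of w becomes the step al u inside psi, which produces the factor al = e^(-s) of each
    derivative. *)
Lemma mehler_diff_le kap psi (H al be u : R) i w :
  continuous kap -> exp_bounded kap -> exp_lipschitz psi ->
  0 <= H -> 0 <= al <= 1 -> 0 <= be <= 1 ->
  (forall (t : R) i w, `|psi (t *: e_ i + w) - psi w| <= `|t| * (H * Qpow A B r `|t| w)) ->
  `|mehler kap be psi (al *: (u *: e_ i + w)) - mehler kap be psi (al *: w)| <=
    al * `|u| * (H * growth_bound kap `|u| w).
Proof.
move=> ck bk lp H0 al01 be01 Hpsi; have [/andP[a0 a1] /andP[b0 b1]] := (al01, be01).
pose L t := `|kap (rvec Z t)| *
  (A + B * \sum_k (2 `^ r k * ((`|w k 0| + `|u|) `^ r k + `|(S *m rvec Z t) k 0| `^ r k))).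
pose L' t := A * `|kap (rvec Z t)| + \sum_k (B * (2 `^ r k * (`|w k 0| + `|u|) `^ r k) *  `|kap (rvec Z t)| + B * 2 `^ r k * (`|kap (rvec Z t)| * `|Zc k t| `^ r k)).
have LL' : L = L'.
  apply/funext => t; rewrite /L /L' mulrDr [_ * A]mulrC; congr (_ + _).
  rewrite mulrCA mulr_sumr mulr_sumr; apply: eq_bigr => k _; rewrite /Zc; ring.
have iL1 := integrable_normr_kap ck bk.
have iL2 k := integrable_kap_powR k ck bk.
have iZ (c : R) f : Pr.-integrable setT (EFin \o f) ->
    Pr.-integrable setT (EFin \o (fun t => c * f t)).
  by move=> h; exact: (@integrableZl _ _ _ Pr setT measurableT c _ h).
have iD f g : Pr.-integrable setT (EFin \o f) -> Pr.-integrable setT (EFin \o g) ->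
    Pr.-integrable setT (EFin \o (fun t => f t + g t)).
  by move=> h h'; exact: (integrableD measurableT h h').
have iS (s : seq 'I_d) (f : 'I_d -> T -> R) : (forall k, Pr.-integrable setT (EFin \o f k)) ->
    Pr.-integrable setT (EFin \o (fun t => \sum_(k <- s) f k t)) /\
    \int[Pr]_t (\sum_(k <- s) f k t) = \sum_(k <- s) \int[Pr]_t f k t.
  move=> h; elim: s => [|k s [IH1 IH2]].
    split.
      rewrite (_ : _ \o _ = EFin \o cst 0); last by apply/funext => t; rewrite /= big_nil.
      exact: finite_measure_integrable_cst.
    under eq_Rintegral do rewrite big_nil.
    by rewrite big_nil Rintegral_cst// mul0r.
  split.
    rewrite (_ : _ \o _ = EFin \o (fun t => f k t + \sum_(j <- s) f j t)); first exact: iD.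
    by apply/funext => t; rewrite /= big_cons.
  under eq_Rintegral do rewrite big_cons.
  by rewrite RintegralD// big_cons IH2.
have iS1 s f h := (iS s f h).1; have iS2 s f h := (iS s f h).2.
have iL : Pr.-integrable setT (EFin \o L).
  rewrite LL'; apply: (iD); first exact: iZ.
  by apply: (iS1) => k; apply: (iD); exact: iZ.
have -> : growth_bound kap `|u| w = \int[Pr]_t L t.
  rewrite LL' /L' RintegralD//; last 2 first.
  - exact: iZ.
  - by apply: (iS1) => k; apply: (iD); exact: iZ.
  rewrite RintegralZl// iS2; last by move=> k; apply: (iD); exact: iZ.
  rewrite /growth_bound ExE mulr_sumr; congr (_ + _); apply: eq_bigr => k _.
  rewrite RintegralD//; [|exact: iZ|exact: iZ].
  by rewrite !RintegralZl// !ExE; ring.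
rewrite mulrA /mehler !ExE; apply: RintegralB_le => //; [exact: integrable_mehler..|].
move=> t; rewrite -mulrBr normrM mulrCA; apply: ler_wpM2l => //.
have -> : al *: (u *: e_ i + w) + be *: (S *m rvec Z t) =
    (al * u) *: e_ i + (al *: w + be *: (S *m rvec Z t)).
  by rewrite scalerDr scalerA addrA.
have Q := @Qpow_affine_le al be u w (rvec Z t) al01 be01.
have n : `|al * u| = al * `|u| by rewrite normrM ger0_norm.
apply: (le_trans (Hpsi _ _ _)); rewrite n in Q *.
by rewrite -[leRHS]mulrA ler_wpM2l ?mulr_ge0// ler_wpM2l.
Qed.

End polynomial_growth.

End mehler.

(** * Integrals over the half line *)

Section half_line_integrals.
Context {R : realType}.
Notation leb := (@lebesgue_measure R).
Notation D := (`]0%R, +oo[%classic : set R).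
Implicit Types (f g F G : R -> R) (s : R).

(** The integrand may blow up at 0, as e^(-2s) (1 - e^(-2s))^(-1/2) does, so the fundamental theorem
    is applied on [1/(n+1), +oo[ and followed by monotone convergence. *)
Lemma ge0_integral_FTC_half_line f F (l0 l : R) :
  (forall x : R, 0 < x -> 0 <= f x) -> (forall x : R, 0 < x -> {for x, continuous f}) ->
  (forall x : R, 0 < x -> is_derive x 1 F (f x)) ->
  F x @[x --> 0^'+] --> l0 -> F x @[x --> +oo] --> l ->
  leb.-integrable D (EFin \o f) /\ \int[leb]_(x in D) f x = l - l0.
Proof.
move=> f0 cf dF F0 Fl.
pose E n : set R := `[n.+1%:R^-1, +oo[%classic.
have n0 n : 0 < n.+1%:R^-1 :> R by rewrite invr_gt0 ltr0n.
have DE : D = \bigcup_n E n.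
  apply/seteqP; split=> x /=; rewrite in_itv/= andbT; last first.
    by move=> [n _]; rewrite /E /= in_itv/= andbT; exact: lt_le_trans.
  move=> x0; have := near_infty_natSinv_lt (PosNum x0).
  by move=> /filter_ex[n /= hn]; exists n => //; rewrite /E /= in_itv/= andbT ltW.
have mf : measurable_fun D f.
  apply: open_continuous_measurable_fun; first exact: interval_open.
  by move=> x; rewrite inE/= in_itv/= andbT => /cf.
have fE n : (\int[leb]_(x in E n) (f x)%:E = l%:E - (F n.+1%:R^-1)%:E)%E.
  apply: ge0_continuous_FTC2y => //.
  - by move=> x nx; apply: f0; exact: lt_le_trans nx.
  - apply/continuous_within_itvcyP; split=> [x|].
      by rewrite in_itv/= andbT => nx; apply: cf; exact: lt_trans nx.
    by apply: cvg_at_right_filter; exact: cf.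
  - by move=> x nx; have [] := dF x (lt_trans (n0 n) nx).
  - apply: cvg_at_right_filter; apply: differentiable_continuous.
    by apply/derivable1_diffP; have [] := dF _ (n0 n).
  - move=> x; rewrite in_itv/= andbT => nx.
    by have [h <-] := dF x (lt_trans (n0 n) nx); rewrite derive1E.
have c1 : (\int[leb]_(x in E n) (f x)%:E)%E @[n --> \oo] --> (\int[leb]_(x in D) (f x)%:E)%E.
  rewrite DE; apply: ge0_nondecreasing_set_cvg_integral.
  - move=> n m nm; apply/subsetPset => x; rewrite /E /= !in_itv/= !andbT.
    by apply: le_trans; rewrite lef_pV2 ?posrE ?ltr0n// ler_nat.
  - by move=> n; rewrite /E.
  - move=> n; apply/measurable_EFinP; apply: measurable_funS mf => //.
    by move=> x; rewrite /E /= !in_itv/= !andbT; exact: lt_le_trans.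
  - move=> n x; rewrite /E /= in_itv/= andbT => nx; rewrite lee_fin; apply: f0.
    exact: lt_le_trans nx.
have c2 : (\int[leb]_(x in E n) (f x)%:E)%E @[n --> \oo] --> (l - l0)%:E.
  under eq_cvg do rewrite fE -EFinB.
  apply: cvg_EFin; first exact: nearW.
  apply: cvgB; first exact: cvg_cst.
  move/cvg_at_rightP : F0; apply; split; first exact: n0.
  exact: cvg_harmonic.
have I : (\int[leb]_(x in D) (f x)%:E)%E = (l - l0)%:E.
  exact: cvg_unique c1 c2.
split; last by rewrite /Rintegral I.
apply/integrableP; split; first exact/measurable_EFinP.
under eq_integral => x xD.
  rewrite gee0_abs; last by rewrite lee_fin f0//; move: xD; rewrite inE/= in_itv/= andbT.
  over.
by rewrite I ltry.
Qed.

(** The signed case follows from the nonnegative one for g and for f + g. *)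
Lemma integral_FTC_half_line f F g G (l0 l k0 k : R) :
  (forall x : R, 0 < x -> `|f x| <= g x) ->
  (forall x : R, 0 < x -> {for x, continuous f}) ->
  (forall x : R, 0 < x -> {for x, continuous g}) ->
  (forall x : R, 0 < x -> is_derive x 1 F (f x)) ->
  (forall x : R, 0 < x -> is_derive x 1 G (g x)) ->
  F x @[x --> 0^'+] --> l0 -> F x @[x --> +oo] --> l ->
  G x @[x --> 0^'+] --> k0 -> G x @[x --> +oo] --> k ->
  leb.-integrable D (EFin \o f) /\ \int[leb]_(x in D) f x = l - l0.
Proof.
move=> fg cf cg dF dG F0 Fl G0 Gk.
have mD : @measurable _ (measurableTypeR R) D by [].
have [ig Ig] := ge0_integral_FTC_half_line
  (fun x x0 => le_trans (normr_ge0 _) (fg x x0)) cg dG G0 Gk.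
have [ih Ih] : leb.-integrable D (EFin \o (fun x => f x + g x)) /\
    \int[leb]_(x in D) (f x + g x) = (l + k) - (l0 + k0).
  apply: (@ge0_integral_FTC_half_line _ (fun x => F x + G x)).
  - by move=> x /fg; rewrite ler_norml; lra.
  - by move=> x x0; apply: continuousD; [exact: cf|exact: cg].
  - by move=> x x0; apply: is_deriveD; [exact: dF|exact: dG].
  - exact: cvgD.
  - exact: cvgD.
have fE : f = (fun x => (f x + g x) - g x) by apply/funext => x; ring.
split.
  rewrite (_ : EFin \o f = ((EFin \o (fun x => (f x + g x)%R)) \- (EFin \o g))%E).
    exact: (integrableB mD ih ig).
  by apply/funext => x; rewrite {1}fE.
rewrite (_ : \int[leb]_(x in D) f x = \int[leb]_(x in D) ((f x + g x) - g x)); last by rewrite {1}fE.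
by rewrite RintegralB// Ih Ig; ring.
Qed.

Definition decay (s : R) : R := expR (- s).
Definition spread (s : R) : R := Num.sqrt (1 - expR (- (2 * s))).

Lemma decay_gt0 s : 0 < decay s. Proof. exact: expR_gt0. Qed.

Lemma decay_lt1 s : 0 < s -> decay s < 1.
Proof. by move=> s0; rewrite /decay -expR0 ltr_expR ltrNl oppr0. Qed.

Lemma decay01 s : 0 <= s -> 0 <= decay s <= 1.
Proof. by move=> s0; rewrite expR_ge0 /decay -expR0 ler_expR lerNl oppr0. Qed.

Lemma decay_exp k s : decay s ^+ k = expR (- (k%:R * s)).
Proof. by rewrite /decay -expRM_natr; congr expR; ring. Qed.

Lemma spread_sqr s : 0 <= s -> spread s ^+ 2 = 1 - decay s ^+ 2.
Proof.
move=> s0; by rewrite decay_exp /spread sqr_sqrtr// subr_ge0 -expR0 ler_expR lerNl oppr0 mulr_ge0.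
Qed.

Lemma spread_ge0 s : 0 <= spread s. Proof. exact: sqrtr_ge0. Qed.

Lemma spread_gt0 s : 0 < s -> 0 < spread s.
Proof. by move=> s0; rewrite sqrtr_gt0 subr_gt0 -expR0 ltr_expR ltrNl oppr0 mulr_gt0. Qed.

Lemma spread_le1 s : spread s <= 1.
Proof. by rewrite -sqrtr1 ler_sqrt// lerBlDr lerDl expR_ge0. Qed.

Lemma spread01 s : 0 <= spread s <= 1.
Proof. by rewrite spread_ge0 spread_le1. Qed.

Lemma normr_spread s : `|spread s| <= 1.
Proof. by rewrite ger0_norm ?spread_le1 ?spread_ge0. Qed.

Lemma spread_sub1 s : 0 <= s -> `|spread s - 1| <= decay s.
Proof.
move=> s0; have := spread_sqr s0; have /andP[? ?] := decay01 s0.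
have /andP[? ?] := spread01 s; rewrite ler_norml; nra.
Qed.

Lemma is_derive_decay s : is_derive s 1 decay (- decay s).
Proof.
rewrite /decay; have h : is_derive s 1 (fun s : R => - s) (- 1).
  exact: is_deriveN.
have := is_derive1_comp (is_derive_expR (- s)) h.
by move=> H; apply: is_derive_eq H _; rewrite mulrN1.
Qed.

Lemma is_derive_spread s : 0 < s -> is_derive s 1 spread (decay s ^+ 2 / spread s).
Proof.
move=> s0; rewrite /spread.
have h : is_derive s 1 (fun s : R => 1 - expR (- (2 * s))) (2 * decay s ^+ 2).
  pose m (s : R) : R := - (2 * s).
  have h1 : is_derive s 1 m (- 2).
    by apply: is_derive_eq; rewrite /GRing.scale/=; ring.
  have h2 := is_deriveB (is_derive_cst (1 : R) s 1) (is_derive1_comp (is_derive_expR (m s)) h1).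
  by apply: is_derive_eq h2 _; rewrite decay_exp /m; ring.
pose y s : R := 1 - expR (- (2 * s)).
have p : 0 < y s by rewrite subr_gt0 -expR0 ltr_expR ltrNl oppr0 mulr_gt0.
have {}h : is_derive s 1 y (2 * decay s ^+ 2) by [].
have h3 := is_derive1_comp (is_derive1_sqrt p) h.
apply: is_derive_eq h3 _; rewrite -/(spread s).
by field; rewrite gt_eqF// spread_gt0.
Qed.

Lemma continuous_decay : continuous decay.
Proof.
move=> s; apply: differentiable_continuous; apply/derivable1_diffP.
by have [] := is_derive_decay s.
Qed.

Lemma continuous_spread : continuous spread.
Proof.
move=> s; apply: (@continuous_comp _ _ _ (fun s : R => 1 - expR (- (2 * s))) Num.sqrt).
  apply: continuousB; first exact: cst_continuous.
  apply: (@continuous_comp _ _ _ (fun s : R => - (2 * s)) expR); last exact: continuous_expR.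
  by apply: continuousN; exact: mulrl_continuous.
exact: sqrt_continuous.
Qed.

Lemma cvg_decay_pinfty : decay s @[s --> +oo] --> (0 : R).
Proof. by apply: cvgr_expR. Qed.

Lemma cvg_spread_pinfty : spread s @[s --> +oo] --> (1 : R).
Proof.
apply/cvgrPdist_le => e e0.
have /cvgrPdist_le/(_ _ e0) := cvg_decay_pinfty.
apply: filterS2 (nbhs_pinfty_ge (num_real 0)) => s s0.
rewrite sub0r normrN distrC => h.
by rewrite (le_trans (spread_sub1 s0))// (le_trans (ler_norm _)).
Qed.

Lemma cvg_at_right0 f : continuous f -> f x @[x --> 0^'+] --> f 0.
Proof. by move=> cf; apply: cvg_at_right_filter; exact: cf. Qed.

Lemma decay0 : decay 0 = 1. Proof. by rewrite /decay oppr0 expR0. Qed.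

Lemma spread0 : spread 0 = 0.
Proof. by rewrite /spread mulr0 oppr0 expR0 subrr sqrtr0. Qed.

Lemma continuous_decay_exp k : continuous (fun s => decay s ^+ k).
Proof.
move=> s; apply: (@continuous_comp _ _ _ decay (fun x => x ^+ k)); first exact: continuous_decay.
exact: exprn_continuous.
Qed.

Lemma integral_decay k : (0 < k)%N ->
  leb.-integrable D (EFin \o (fun s => decay s ^+ k)) /\
  \int[leb]_(s in D) decay s ^+ k = k%:R^-1.
Proof.
move=> k0; pose F s := - k%:R^-1 * decay s ^+ k.
have kn0 : k%:R != 0 :> R by rewrite pnatr_eq0 -lt0n.
have cF : continuous F.
  by move=> s; apply: (@continuousM _ _ (cst (- k%:R^-1)) (fun s => decay s ^+ k)); [exact: cst_continuous|exact: continuous_decay_exp].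
have [] := @ge0_integral_FTC_half_line (fun s => decay s ^+ k) F (- k%:R^-1) 0.
- by move=> s _; rewrite exprn_ge0// ltW// decay_gt0.
- by move=> s _; exact: continuous_decay_exp.
- move=> s _.
  have h := is_deriveM (is_derive_cst (- k%:R^-1 : R) s 1) (is_deriveX k (is_derive_decay s)).
  have FE : cst (- k%:R^-1 : R) * decay ^+ k = F.
    by apply/funext => x; rewrite /F exprfctE.
  rewrite FE in h; apply: is_derive_eq h _; rewrite /GRing.scale/=.
  case: k k0 kn0 {F cF FE} => // k _ kn0; rewrite exprS /=.
  rewrite -mulr_natl mulr0 addr0; move: kn0; set K := k.+1%:R => kn0.
  by rewrite exprS; field.
- by rewrite -[X in _ --> X](_ : F 0 = _); [exact: cvg_at_right0|rewrite /F decay0 expr1n mulr1].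
- have -> : 0 = - k%:R^-1 * 0 ^+ k :> R by rewrite expr0n gtn_eqF// mulr0.
  apply: cvgM; first exact: cvg_cst.
  apply: (@cvg_comp _ _ _ decay (fun x => x ^+ k)); first exact: cvg_decay_pinfty.
  exact: exprn_continuous.
by move=> h1 h2; split=> //; rewrite h2 sub0r opprK.
Qed.

Lemma continuous_decay_spread k s : 0 < s -> {for s, continuous (fun s => decay s ^+ k / spread s)}.
Proof.
move=> s0; apply: continuousM; first exact: continuous_decay_exp.
apply: continuousV; first by rewrite gt_eqF// spread_gt0.
exact: continuous_spread.
Qed.

(** [spread] is an antiderivative of the integrand and increases from 0 to 1. *)
Lemma integral_decay_spread :
  leb.-integrable D (EFin \o (fun s => decay s ^+ 2 / spread s)) /\
  \int[leb]_(s in D) (decay s ^+ 2 / spread s) = 1.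
Proof.
have [] := @ge0_integral_FTC_half_line (fun s => decay s ^+ 2 / spread s) spread 0 1.
- by move=> s s0; rewrite divr_ge0 ?sqr_ge0// spread_ge0.
- by move=> s; exact: continuous_decay_spread.
- by move=> s; exact: is_derive_spread.
- by rewrite -[X in _ --> X]spread0; apply: cvg_at_right0; exact: continuous_spread.
- exact: cvg_spread_pinfty.
by rewrite subr0.
Qed.

(** If e^(-s) >= 1/2 the first term suffices; otherwise [spread s] is at least 1/2 and the second
    one does. *)
Lemma decay_div_spread_le s : 0 < s ->
  decay s / spread s <= 2 * (decay s ^+ 2 / spread s + decay s).
Proof.
move=> s0; have b0 := spread_gt0 s0; have a0 := decay_gt0 s.
have := spread_sqr (ltW s0); move: b0 a0; move: (decay s) (spread s) => a b b0 a0 ab.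
have -> : 2 * (a ^+ 2 / b + a) = 2 * (a ^+ 2 + a * b) / b by field; rewrite gt_eqF.
rewrite ler_pM2r ?invr_gt0//.
have [h|h] := leP (1 / 2) a; first nra.
suff : 1 / 2 <= b by nra.
nra.
Qed.

Lemma integrable_decay_spread k : (0 < k)%N ->
  leb.-integrable D (EFin \o (fun s => decay s ^+ k / spread s)).
Proof.
move=> k0; have mD : @measurable _ (measurableTypeR R) D by [].
have [i1 _] := integral_decay_spread; have [i2 _] := @integral_decay 1 isT.
apply: (@le_integrable _ _ _ leb D mD _ (EFin \o (fun s => 2 * (decay s ^+ 2 / spread s + decay s ^+ 1)))).
- apply/measurable_EFinP; apply: open_continuous_measurable_fun; first exact: interval_open.
  by move=> x; rewrite inE/= in_itv/= andbT; exact: continuous_decay_spread.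
- move=> s; rewrite /= in_itv/= andbT => s0; rewrite lee_fin.
  have /andP[a0 a1] := decay01 (ltW s0).
  rewrite !ger0_norm ?mulr_ge0 ?addr_ge0 ?mulr_ge0 ?invr_ge0 ?spread_ge0 ?exprn_ge0//.
  rewrite expr1 (le_trans _ (decay_div_spread_le s0))// ler_wpM2r ?invr_ge0 ?spread_ge0//.
  by rewrite -[leRHS]expr1 ler_wiXn2l.
- have i3 : leb.-integrable D (EFin \o (fun s => decay s ^+ 2 / spread s + decay s ^+ 1)).
    exact: (integrableD mD i1 i2).
  exact: (@integrableZl _ _ _ leb D mD 2 _ i3).
Qed.

End half_line_integrals.

(** * Time integrals of the semigroup *)

Section weighted_mehler.
Context {R : realType} dT (T : measurableType dT) (Pr : probability T R).
Variables (d : nat) (Z : 'I_d -> {RV Pr >-> R}) (S : 'M[R]_d).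
Hypothesis hZ : std_normal_vector Z.
Notation leb := (@lebesgue_measure R).
Notation D := (`]0%R, +oo[%classic : set R).
Implicit Types (kap psi : 'cV[R]_d -> R) (w : 'cV[R]_d) (rho : R -> R) (s c : R).
Local Notation e_ i := (delta_mx i 0 : 'cV[R]_d).

Let mD : @measurable _ (measurableTypeR R) D. Proof. by []. Qed.

Definition ou kap psi s w : R := mehler Z S kap (spread s) psi (decay s *: w).

(** Subtracting c makes the integral converge when rho does not decay: for rho = 1, kap = 1 and c
    the mean of psi it is, up to sign, the Stein solution for psi. *)
Definition weighted_ou rho kap psi c w : R :=
  \int[leb]_(s in D) (rho s * (ou kap psi s w - c)).

Lemma norm1_decay s w : 0 < s -> norm1 (decay s *: w) <= norm1 w.
Proof.
move=> s0; rewrite norm1Z (ger0_norm (ltW (decay_gt0 s))).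
by apply: ler_piMl; [exact: norm1_ge0|exact/ltW/decay_lt1].
Qed.

Section regular.
Variables (kap psi : 'cV[R]_d -> R).
Hypotheses (ck : continuous kap) (bk : exp_bounded kap) (lp : exp_lipschitz psi).

Lemma continuous_ou w s : 0 < s -> {for s, continuous (fun s => ou kap psi s w)}.
Proof.
move=> s0.
have [C [C0 H]] := mehler_lipschitz S hZ (norm1 w) ck bk lp.
pose g x := (`|decay s - decay x| * norm1 w + `|spread s - spread x|) * C.
have cg : g x @[x --> s] --> (0 : R).
  have -> : 0 = g s by rewrite /g !subrr normr0 mul0r addr0 mul0r.
  suff : {for s, continuous g} by [].
  apply: (@continuousM _ _ _ (cst C)); last exact: cst_continuous.
  apply: (@continuousD _ _ _ (fun x => `|decay s - decay x| * norm1 w)).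
    apply: (@continuousM _ _ _ (cst (norm1 w))); last exact: cst_continuous.
    apply: (@continuous_comp _ _ _ (fun x => decay s - decay x) (fun x : R => `|x|)).
      by apply: continuousB; [exact: cst_continuous|exact: continuous_decay].
    exact: norm_continuous.
  apply: (@continuous_comp _ _ _ (fun x => spread s - spread x) (fun x : R => `|x|)).
    by apply: continuousB; [exact: cst_continuous|exact: continuous_spread].
  exact: norm_continuous.
rewrite /prop_for /continuous_at.
apply/(@cvgrPdist_le _ _ _ (nbhs s) _ (fun s => ou kap psi s w)) => e e0.
have := lt_nbhsr s0; move/cvgr0Pnorm_le : cg => /(_ _ e0).
apply: filterS2 => x gx x0; move: gx.
apply: le_trans; rewrite (le_trans _ (ler_norm _))// /ou.
rewrite (le_trans (H _ _ _ _ _ _ _ _)) ?normr_spread ?norm1_decay//.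
by rewrite /g -scalerBl norm1Z.
Qed.

Lemma ou_bounded w : exists K, forall s, 0 < s -> `|ou kap psi s w| <= K.
Proof.
have [C [C0 H]] := mehler_lipschitz S hZ (norm1 w) ck bk lp.
exists (`|mehler Z S kap 0 psi 0| + (norm1 w + 1) * C) => s s0.
rewrite -[ou _ _ _ _](subrK (mehler Z S kap 0 psi 0)) addrC.
rewrite (le_trans (ler_normD _ _))// lerD2l.
rewrite (le_trans (H _ _ _ _ _ _ _ _)) ?normr_spread ?norm1_decay ?normr0 ?norm10 ?norm1_ge0//.
rewrite ler_wpM2r// !subr0 lerD ?norm1_decay ?normr_spread//.
Qed.

(** The contraction from w to e^(-s) w supplies the factor [decay s] that makes increments
    integrable in s. *)
Lemma ou_lipschitz w : exists C, 0 <= C /\ forall s i (t : R), 0 < s -> `|t| <= 1 ->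
  `|ou kap psi s (t *: e_ i + w) - ou kap psi s w| <= `|t| * (decay s * C).
Proof.
have [C [C0 H]] := mehler_lipschitz S hZ (norm1 w + 1) ck bk lp.
exists C; split=> // s i t s0 t1.
have n1 : norm1 (t *: e_ i + w) <= norm1 w + 1.
  by rewrite (le_trans (norm1D _ _))// addrC lerD2l norm1Z norm1_delta mulr1.
rewrite (le_trans (H _ _ _ _ _ _ _ _)) ?normr_spread//.
- by rewrite (le_trans (norm1_decay _ _)).
- by rewrite (le_trans (norm1_decay _ _))// lerDl.
- rewrite subrr normr0 addr0 -scalerBr addrK !norm1Z norm1_delta mulr1.
  by rewrite (ger0_norm (ltW (decay_gt0 s))) mulrA [decay s * _]mulrC.
Qed.

Lemma integrable_weighted_ou rho c w (g : R -> R) :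
  (forall s, 0 < s -> {for s, continuous rho}) ->
  leb.-integrable D (EFin \o g) ->
  (forall s, 0 < s -> `|rho s * (ou kap psi s w - c)| <= g s) ->
  leb.-integrable D (EFin \o (fun s => rho s * (ou kap psi s w - c))).
Proof.
move=> cr ig le_g.
apply: (@le_integrable _ _ _ leb D mD _ (EFin \o g)) => //.
- apply/measurable_EFinP; apply: open_continuous_measurable_fun; first exact: interval_open.
  move=> x; rewrite inE/= in_itv/= andbT => x0.
  apply: (@continuousM _ _ rho (fun s => ou kap psi s w - c)); first exact: cr.
  by apply: (@continuousB _ _ _ (fun s => ou kap psi s w) (cst c)); [exact: continuous_ou|exact: cst_continuous].
- move=> s; rewrite /= in_itv/= andbT => s0.
  by rewrite lee_fin (le_trans (le_g s s0))// ler_norm.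
Qed.

Lemma integrable_weighted_ou0 rho c w :
  (forall s, 0 < s -> {for s, continuous rho}) -> (forall s, 0 < s -> 0 <= rho s) ->
  leb.-integrable D (EFin \o rho) ->
  leb.-integrable D (EFin \o (fun s => rho s * (ou kap psi s w - c))).
Proof.
move=> cr r0 ir; have [K hK] := ou_bounded w.
apply: (integrable_weighted_ou (g := fun s => (K + `|c|) * rho s)) => //.
  exact: (@integrableZl _ _ _ leb D mD (K + `|c|) _ ir).
move=> s s0; rewrite normrM ger0_norm ?r0// mulrC ler_wpM2r ?r0//.
by rewrite (le_trans (ler_normB _ _))// lerD// hK.
Qed.

Lemma is_derive_weighted_ou rho c w i (G : R -> R) :
  (forall s, 0 < s -> 0 <= rho s) ->
  leb.-integrable D (EFin \o (fun s => rho s * decay s)) ->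
  (forall w, leb.-integrable D (EFin \o (fun s => rho s * (ou kap psi s w - c)))) ->
  (forall s, 0 < s -> is_derive w (e_ i) (ou kap psi s) (G s)) ->
  leb.-integrable D (EFin \o (fun s => rho s * G s)) /\
  is_derive w (e_ i) (weighted_ou rho kap psi c) (\int[leb]_(s in D) (rho s * G s)).
Proof.
move=> r0 ird io dG; have [C [C0 H]] := ou_lipschitz w.
have [||||i1 i2] := @is_derive_integral _ _ R leb D
  (fun t s => rho s * (ou kap psi s (t *: e_ i + w) - c)) (fun s => rho s * G s)
  (fun s => C * (rho s * decay s)) mD.
- by move=> t _; exact: io.
- exact: (@integrableZl _ _ _ leb D mD C _ ird).
- move=> t s t1; rewrite /= in_itv/= andbT => s0.
  rewrite scale0r add0r -mulrBr opprB addrA subrK normrM (ger0_norm (r0 _ s0)).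
  apply: (le_trans (ler_wpM2l (r0 _ s0) (H s i t s0 t1))).
  by rewrite le_eqVlt; apply/orP; left; apply/eqP; ring.
- move=> s; rewrite /= in_itv/= andbT => s0.
  have /is_derive_lineP h := dG s s0.
  have h1 := is_deriveM (is_derive_cst (rho s) (0 : R) 1) (is_deriveB h (is_derive_cst c (0 : R) 1)).
  apply: is_derive_eq h1 _.
  by rewrite /GRing.scale/=; ring.
split => //; exact/is_derive_lineP.
Qed.

End regular.

End weighted_mehler.

(** * Partial derivatives of the Stein solution *)

Section difference_quotients.
Context {R : realType}.

Lemma cvg_powR_normr (a p : R) : 0 <= a -> 0 <= p ->
  (a + `|t|) `^ p @[t --> (0:R)^'] --> a `^ p.
Proof.
move=> a0 p0.
have cn : `|t| @[t --> (0:R)^'] --> (0 : R).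
  apply: cvg_within_filter.
  have h : {for 0, continuous (fun t : R => `|t|)} by exact: norm_continuous.
  by move: h; rewrite /prop_for /continuous_at normr0.
have [->|p_neq0] := eqVneq p 0.
  under eq_fun do rewrite powRr0.
  by rewrite powRr0; exact: cvg_cst.
move: a0; rewrite le_eqVlt => /predU1P[<-|a0].
  rewrite powR0//; apply/cvgr0Pnorm_le => e e0.
  have d0 : 0 < e `^ p^-1 by rewrite powR_gt0.
  move/cvgr0Pnorm_le : cn => /(_ _ d0); apply: filterS => t.
  rewrite normr_id add0r (ger0_norm (powR_ge0 _ _)) => h.
  rewrite (_ : e = (e `^ p^-1) `^ p); last by rewrite -powRrM mulVf// powRr1// ltW.
  by apply: ge0_ler_powR; rewrite ?nnegrE ?powR_ge0.
have h1 : ln (a + `|t|) @[t --> (0:R)^'] --> ln a.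
  have h : a + `|t| @[t --> (0:R)^'] --> a.
    by rewrite -[X in _ --> X]addr0; apply: cvgD => //; exact: cvg_cst.
  exact: (@cvg_comp _ _ _ (fun t : R => a + `|t|) (@ln R) _ _ _ h (continuous_ln a0)).
have h2 : expR (p * ln (a + `|t|)) @[t --> (0:R)^'] --> expR (p * ln a).
  have h : p * ln (a + `|t|) @[t --> (0:R)^'] --> p * ln a.
    by apply: cvgM => //; exact: cvg_cst.
  exact: (@cvg_comp _ _ _ (fun t : R => p * ln (a + `|t|)) (@expR R) _ _ _ h (@continuous_expR R _)).
rewrite {2}/powR gt_eqF//; apply: cvg_trans h2; apply: near_eq_cvg.
apply: nearW => t /=; rewrite /powR gt_eqF//.
by rewrite (lt_le_trans a0)// lerDl.
Qed.

(** Where the derivative does not exist its value is 0 and l >= 0 suffices, so increment bounds pass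
    to the total derivative at every point. *)
Lemma derive_norm_le (V : normedModType R) (u : V -> R) (w v : V) (b : R -> R) (l : R) :
  0 <= l -> b t @[t --> (0:R)^'] --> l ->
  (forall t : R, `|t| <= 1 -> `|u (t *: v + w) - u w| <= `|t| * b t) ->
  `|'D_v u w| <= l.
Proof.
move=> l0 bl H.
have [cu|nu] := pselect (derivable u w v); last first.
  by rewrite /derive dvgP// normr0.
have q : `|h^-1 *: (u (h *: v + w) - u w)| @[h --> (0:R)^'] --> `|'D_v u w|.
  by apply: cvg_norm; exact: cu.
apply: (ler_cvg_to q bl); near=> h.
have h0 : h != 0 by near: h; exact: nbhs_dnbhs_neq.
have h1 : `|h| <= 1.
  near: h; apply: dnbhs0_le; exact: ltr01.
by rewrite normrM normfV ler_pdivrMl ?normr_gt0// H.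
Unshelve. all: by end_near. Qed.

End difference_quotients.

(** * Formulas and bounds for the derivatives of the Stein solution *)

Section stein_solution.
Context {R : realType} dT (T : measurableType dT) (Pr : probability T R).
Variables (d : nat) (Z : 'I_d -> {RV Pr >-> R}) (S : 'M[R]_d).
Hypothesis hZ : std_normal_vector Z.
Notation leb := (@lebesgue_measure R).
Notation D := (`]0%R, +oo[%classic : set R).
Implicit Types (kap psi : 'cV[R]_d -> R) (w : 'cV[R]_d) (rho : R -> R) (s c : R).
Local Notation e_ i := (delta_mx i 0 : 'cV[R]_d).
Local Notation ou := (ou Z S).
Local Notation weighted_ou := (weighted_ou Z S).
Local Notation one := (cst (1 : R) : 'cV[R]_d -> R).

Let mD : @measurable _ (measurableTypeR R) D. Proof. by []. Qed.

(** Weights after k derivatives that fall on psi; in [wspread] one additional derivative has been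
    removed by integration by parts. *)
Definition wdecay k s : R := decay s ^+ k.
Definition wspread k s : R := decay s ^+ k.+1 / spread s.

Let cone : continuous one. Proof. by move=> x; exact: cst_continuous. Qed.
Let bone : exp_bounded one. Proof. exact: exp_bounded_cst. Qed.

Lemma wdecay_ge0 k s : 0 <= wdecay k s.
Proof. by rewrite exprn_ge0// ltW// decay_gt0. Qed.

Lemma wspread_ge0 k s : 0 <= wspread k s.
Proof. by rewrite divr_ge0 ?spread_ge0// exprn_ge0// ltW// decay_gt0. Qed.

(** For k = 0 only the difference P_s psi - E psi is small: both terms are values of [mehler], at
    arguments within e^(-s) (|w| + 1) of each other. *)
Lemma integrable_wdecay_ou psi k c w : exp_lipschitz psi ->
  (0 < k)%N \/ c = Ex Pr (fun t => psi (S *m rvec Z t)) ->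
  leb.-integrable D (EFin \o (fun s => wdecay k s * (ou one psi s w - c))).
Proof.
move=> lp [k0|->].
  apply: (@integrable_weighted_ou0 _ _ _ _ _ _ S hZ _ _ cone bone lp (wdecay k)) => [s _|s _|].
  - exact: continuous_decay_exp.
  - exact: wdecay_ge0.
  - exact: (integral_decay k0).1.
have [C [C0 H]] := mehler_lipschitz S hZ (norm1 w) cone bone lp.
have [i1 _] := @integral_decay R 1 isT.
apply: (integrable_weighted_ou hZ cone bone lp (g := fun s => ((norm1 w + 1) * C) * decay s ^+ 1)).
- by move=> s _; exact: continuous_decay_exp.
- exact: (@integrableZl _ _ _ leb D mD _ _ i1).
move=> s s0; rewrite (_ : Ex _ _ = mehler Z S one 1 psi 0); last first.
  by rewrite /mehler; congr (Ex Pr _); apply/funext => t; rewrite mul1r add0r scale1r.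
have /andP[a0 a1] := decay01 (ltW s0).
rewrite normrM ger0_norm ?wdecay_ge0//.
apply: (@le_trans _ _ (1 * ((decay s * norm1 w + decay s) * C))); last by rewrite expr1; lra.
apply: ler_pM => //; [exact: wdecay_ge0|by rewrite exprn_ile1|].
rewrite (le_trans (H _ _ _ _ _ _ _ _)) ?normr_spread ?norm1_decay ?normr1 ?norm10 ?norm1_ge0//.
rewrite ler_wpM2r// subr0 lerD//; last exact: spread_sub1 (ltW s0).
by rewrite norm1Z ger0_norm.
Qed.

Lemma is_derive_wdecay_ou psi psi' k c w i : exp_lipschitz psi ->
  (0 < k)%N \/ c = Ex Pr (fun t => psi (S *m rvec Z t)) ->
  (forall y, is_derive y (e_ i) psi (psi' y)) ->
  is_derive w (e_ i) (weighted_ou (wdecay k) one psi c) (weighted_ou (wdecay k.+1) one psi' 0 w).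
Proof.
move=> lp kc dp.
have [||||_ h] := @is_derive_weighted_ou R _ _ _ d Z S hZ one psi cone bone lp (wdecay k) c w i (fun s => decay s * ou one psi' s w).
- by move=> s _; exact: wdecay_ge0.
- rewrite (_ : _ \o _ = EFin \o (fun s => decay s ^+ k.+1)).
    exact: (integral_decay _).1.
  by apply/funext => s; rewrite /= /wdecay exprSr.
- by move=> w'; exact: integrable_wdecay_ou.
- move=> s s0; apply: is_derive_scale; apply: is_derive_mehler => //.
  exact: normr_spread.
apply: is_derive_eq h _; rewrite /weighted_ou; apply: eq_Rintegral => s _.
by rewrite subr0 /wdecay exprSr mulrA.
Qed.

Section invertible.
Hypotheses (Ssym : S^T = S) (Sunit : S \in unitmx).

Lemma is_derive_wdecay_ou_cst psi k c w i : exp_lipschitz psi ->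
  (0 < k)%N \/ c = Ex Pr (fun t => psi (S *m rvec Z t)) ->
  is_derive w (e_ i) (weighted_ou (wdecay k) one psi c) (weighted_ou (wspread k) (dual S i) psi 0 w).
Proof.
move=> lp kc.
have [||||_ h] := @is_derive_weighted_ou R _ _ _ d Z S hZ one psi cone bone lp (wdecay k) c w i (fun s => decay s * ((spread s)^-1 * ou (dual S i) psi s w)).
- by move=> s _; exact: wdecay_ge0.
- rewrite (_ : _ \o _ = EFin \o (fun s => decay s ^+ k.+1)).
    exact: (integral_decay _).1.
  by apply/funext => s; rewrite /= /wdecay exprSr.
- by move=> w'; exact: integrable_wdecay_ou.
- move=> s s0; apply: is_derive_scale; apply: is_derive_mehler_cst => //.
  by rewrite gt_eqF// spread_gt0.
apply: is_derive_eq h _; rewrite /weighted_ou; apply: eq_Rintegral => s _.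
by rewrite subr0 /wdecay /wspread exprSr !mulrA.
Qed.

Lemma integrable_wspread_ou kap psi k w : continuous kap -> exp_bounded kap -> exp_lipschitz psi ->
  leb.-integrable D (EFin \o (fun s => wspread k s * (ou kap psi s w - 0))).
Proof.
move=> ck bk lp; apply: (@integrable_weighted_ou0 _ _ _ _ _ _ S hZ _ _ ck bk lp (wspread k)).
- by move=> s; exact: continuous_decay_spread.
- by move=> s _; exact: wspread_ge0.
- exact: integrable_decay_spread.
Qed.

Let integrable_wspread_decay k :
  leb.-integrable D (EFin \o (fun s => wspread k s * decay s)).
Proof.
rewrite (_ : _ \o _ = EFin \o (fun s => decay s ^+ k.+2 / spread s)).
  exact: integrable_decay_spread.
by apply/funext => s; rewrite /= /wspread [in RHS]exprSr mulrAC.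
Qed.

Lemma is_derive_wspread_ou psi psi' k w i l : exp_lipschitz psi ->
  (forall y, is_derive y (e_ i) psi (psi' y)) ->
  is_derive w (e_ i) (weighted_ou (wspread k) (dual S l) psi 0) (weighted_ou (wspread k.+1) (dual S l) psi' 0 w).
Proof.
move=> lp dp.
have [||||_ h] := @is_derive_weighted_ou R _ _ _ d Z S hZ (dual S l) psi (continuous_dual (i := l)) (exp_bounded_dual S l) lp (wspread k) 0 w i (fun s => decay s * ou (dual S l) psi' s w).
- by move=> s _; exact: wspread_ge0.
- exact: integrable_wspread_decay.
- move=> w'; apply: integrable_wspread_ou => //; [exact: continuous_dual|exact: exp_bounded_dual].
- move=> s s0; apply: is_derive_scale; apply: is_derive_mehler => //.
  + exact: normr_spread.
  + exact: continuous_dual.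
  + exact: exp_bounded_dual.
apply: is_derive_eq h _; rewrite /weighted_ou; apply: eq_Rintegral => s _.
by rewrite subr0 /wspread [in RHS]exprSr; ring.
Qed.

(** After a second integration by parts the weight behaves like 1/s at 0. Integrability comes from
    the factor multiplying it: its product with [decay s / spread s] is a derivative of [ou],
    bounded through [ou_lipschitz]. *)
Lemma is_derive_wspread_ou_dual psi k w i l : exp_lipschitz psi ->
  leb.-integrable D (EFin \o (fun s => wspread k s * (decay s / spread s * ou (dual2 S l i) psi s w))) /\
  is_derive w (e_ i) (weighted_ou (wspread k) (dual S l) psi 0)
    (\int[leb]_(s in D) (wspread k s * (decay s / spread s * ou (dual2 S l i) psi s w))).
Proof.
move=> lp.
have [||||h1 h2] := @is_derive_weighted_ou R _ _ _ d Z S hZ (dual S l) psi (continuous_dual (i := l)) (exp_bounded_dual S l) lp (wspread k) 0 w i (fun s => decay s / spread s * ou (dual2 S l i) psi s w).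
- by move=> s _; exact: wspread_ge0.
- exact: integrable_wspread_decay.
- move=> w'; apply: integrable_wspread_ou => //; [exact: continuous_dual|exact: exp_bounded_dual].
- move=> s s0; rewrite -mulrA; apply: is_derive_scale; apply: is_derive_mehler_dual => //.
  by rewrite gt_eqF// spread_gt0.
by split.
Qed.

End invertible.


Section formulas.
Variables (phi : 'cV[R]_d -> R) (N : nat).
Hypotheses (phi_exist : partials_exist N phi)
  (phi_lip : forall s : seq 'I_d, (size s <= N)%N -> exp_lipschitz (partials s phi)).

Local Notation f := (stein_solution Z S phi).
Let c0 := Ex Pr (fun t => phi (S *m rvec Z t)).
(** The constant disappears with the first derivative. *)
Let const (s : seq 'I_d) := if s is [::] then c0 else 0.

Let constP (s : seq 'I_d) : (0 < size s)%N \/ const s = Ex Pr (fun t => partials s phi (S *m rvec Z t)).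
Proof. by case: s => [|i s]; [right|left]. Qed.

Let is_derive_phi i (s : seq 'I_d) y : (size s < N)%N ->
  is_derive y (e_ i) (partials s phi) (partials (i :: s) phi y).
Proof. by move=> sN; apply: DeriveDef => //; exact: phi_exist. Qed.

Lemma partials_stein (s : seq 'I_d) : (size s <= N)%N ->
  partials s f = (fun w => - weighted_ou (wdecay (size s)) one (partials s phi) (const s) w).
Proof.
elim: s => [_|i s IH sN].
  apply/funext => w; rewrite /= /stein_solution /weighted_ou; congr (- _).
  rewrite -Rintegral_itv_obnd_cbnd//=.
    apply: eq_Rintegral => s _; rewrite /wdecay expr0 mul1r.
    by congr (Ex _ _ - _); apply/funext => t; rewrite mul1r.
  have := integrable_wdecay_ou (k := 0) w (phi_lip (s := [::]) isT) (or_intror erefl).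
  rewrite (_ : EFin \o _ = EFin \o (fun s => ou one phi s w - c0)) => [h|]; last first.
    by apply/funext => s; rewrite /= /wdecay expr0 mul1r.
  rewrite (_ : EFin \o _ = EFin \o (fun s => ou one phi s w - c0))//.
  apply/funext => s; rewrite /=; congr ((Ex _ _ - _)%:E).
  by apply/funext => t; rewrite mul1r.
have sN' : (size s < N)%N by [].
apply/funext => w; rewrite [LHS]/= (IH (ltnW sN')).
have lp := phi_lip (ltnW sN').
have h := is_deriveN (is_derive_wdecay_ou w lp (constP s) (fun y => is_derive_phi i y sN')).
by rewrite derive_val.
Qed.

Lemma partials_exist_stein : partials_exist N f.
Proof.
move=> s i w sN; rewrite (partials_stein (ltnW sN)).
have lp := phi_lip (ltnW sN).
by have [] := is_deriveN (is_derive_wdecay_ou w lp (constP s) (fun y => is_derive_phi i y sN)).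
Qed.

Lemma partials_stein_derivable (s : seq 'I_d) i w : size s = N ->
  (forall y, derivable (partials s phi) y (e_ i)) -> derivable (partials s f) w (e_ i).
Proof.
move=> sN dphi; have sN' : (size s <= N)%N by rewrite sN.
rewrite (partials_stein sN').
have lp := phi_lip sN'.
have dp y : is_derive y (e_ i) (partials s phi) ('D_(e_ i) (partials s phi) y) by exact: DeriveDef.
by have [] := is_deriveN (is_derive_wdecay_ou w lp (constP s) dp).
Qed.

Section invertible.
Hypotheses (Ssym : S^T = S) (Sunit : S \in unitmx).

(** The derivatives in b, taken first, fall on phi; the one in l is integrated by parts; those in a
    fall on phi again. *)
Lemma partials_stein_spread (a b : seq 'I_d) l : (size a + size b <= N)%N ->
  partials (a ++ l :: b) f =
  (fun w => - weighted_ou (wspread (size a + size b)) (dual S l) (partials (a ++ b) phi) 0 w).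
Proof.
elim: a => [|i a IH] abN.
  apply/funext => w; rewrite /= (partials_stein abN).
  have h := is_deriveN (is_derive_wdecay_ou_cst Ssym Sunit w l (phi_lip abN) (constP b)).
  by rewrite derive_val.
have abN' : (size (a ++ b) < N)%N by rewrite size_cat.
apply/funext => w; rewrite [LHS]/= IH; last by rewrite -size_cat ltnW.
have lp := phi_lip (ltnW abN').
have h := is_deriveN (is_derive_wspread_ou (size a + size b) w l lp (fun y => is_derive_phi i y abN')).
by rewrite derive_val.
Qed.

(** Two integrations by parts add two orders to the N derivatives of phi. *)
Lemma partials_exist_stein_spread : partials_exist N.+2 f.
Proof.
move=> s i w; case: s => [_|l b bN].
  rewrite (partials_stein (s := [::]) isT).
  by have [] := is_deriveN (is_derive_wdecay_ou_cst Ssym Sunit w i (phi_lip (s := [::]) isT) (constP [::])).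
have bN' : (size (Nil 'I_d) + size b <= N)%N by [].
rewrite (partials_stein_spread l bN').
have lp : exp_lipschitz (partials ([::] ++ b) phi) by exact: phi_lip.
by have [] := is_deriveN (is_derive_wspread_ou_dual Ssym Sunit (size (Nil 'I_d) + size b) w i l lp).2.
Qed.

Lemma partials_stein_top (a b : seq 'I_d) i l w : (size a + size b <= N)%N ->
  partials (i :: a ++ l :: b) f w =
    - \int[leb]_(s in D) (wspread (size a + size b) s *
     (decay s / spread s * ou (dual2 S l i) (partials (a ++ b) phi) s w)).
Proof.
move=> abN; rewrite [LHS]/= (partials_stein_spread l abN).
have lp : exp_lipschitz (partials (a ++ b) phi) by apply: phi_lip; rewrite size_cat.
have h := is_deriveN (is_derive_wspread_ou_dual Ssym Sunit (size a + size b) w i l lp).2.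
by rewrite derive_val.
Qed.

End invertible.

End formulas.

Section bounds.
Variables (A B : R) (r : 'I_d -> R) (H : R).
Hypotheses (A0 : 0 <= A) (B0 : 0 <= B) (r0 : forall k, 0 <= r k) (H0 : 0 <= H).
Variable psi : 'cV[R]_d -> R.
Hypotheses (lp : exp_lipschitz psi)
  (psiH : forall (t : R) i w, `|psi (t *: e_ i + w) - psi w| <= `|t| * (H * Qpow A B r `|t| w)).

Local Notation growth := (growth_bound Z S A B r).

Lemma cvg_growth_bound kap w : growth kap `|t| w @[t --> (0:R)^'] --> growth kap 0 w.
Proof.
rewrite /growth_bound; apply: cvgD; first exact: cvg_cst.
apply: cvgM; first exact: cvg_cst.
apply: cvg_big => [|k _]; first exact: add_continuous.
apply: cvgM; first exact: cvg_cst.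
apply: cvgD; last exact: cvg_cst.
apply: cvgM; last exact: cvg_cst.
by rewrite addr0; exact: cvg_powR_normr.
Qed.

(** Increments of psi stand in for its gradient. They contribute one more factor e^(-s), and
    int_0^oo e^(-(k+1)s) ds = 1/(k+1). *)
Lemma weighted_ou_derive_bound k c w i :
  (0 < k)%N \/ c = Ex Pr (fun t => psi (S *m rvec Z t)) ->
  `|'D_(e_ i) (fun w => - weighted_ou (wdecay k) one psi c w) w| <=
    H / k.+1%:R * growth one 0 w.
Proof.
move=> kc.
have n0 : 0 <= k.+1%:R^-1 :> R by rewrite invr_ge0 ler0n.
apply: (derive_norm_le (b := fun t => H / k.+1%:R * growth one `|t| w)).
- by rewrite !mulr_ge0// growth_bound_ge0.
- by apply: cvgM; [exact: cvg_cst|exact: cvg_growth_bound].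
move=> t t1; have i1 := integrable_wdecay_ou (t *: e_ i + w) lp kc.
have i2 := integrable_wdecay_ou w lp kc.
rewrite -opprD normrN /weighted_ou -RintegralB//.
have [id Id] := @integral_decay R k.+1 isT.
have i12 : leb.-integrable D (EFin \o (fun s => wdecay k s * (ou one psi s (t *: e_ i + w) - c) - wdecay k s * (ou one psi s w - c))).
  exact: (integrableB mD i1 i2).
apply: (le_trans (le_normr_Rintegral mD i12)).
pose K := `|t| * (H * growth one `|t| w).
have iK : leb.-integrable D (EFin \o (fun s => K * decay s ^+ k.+1)).
  exact: (@integrableZl _ _ _ leb D mD K _ id).
apply: (@le_trans _ _ (\int[leb]_(s in D) (K * decay s ^+ k.+1))).
  apply: le_Rintegral => //; first exact: integrable_norm.
  move=> s; rewrite /= in_itv/= andbT => s0.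
  rewrite -mulrBr opprB addrA subrK normrM (ger0_norm (wdecay_ge0 k s)) exprSr.
  rewrite [leRHS]mulrCA ler_wpM2l ?wdecay_ge0//.
  have := @mehler_diff_le R _ _ _ d Z S hZ A B r B0 r0 one psi H (decay s) (spread s) t i w cone bone lp H0 (decay01 (ltW s0)) (spread01 s) psiH.
  by rewrite /ou /K; rewrite -mulrA mulrC.
rewrite RintegralZl// Id /K.
by rewrite le_eqVlt; apply/orP; left; apply/eqP; ring.
Qed.

Section invertible.
Hypotheses (Ssym : S^T = S) (Sunit : S \in unitmx).

(** The second order weight is not estimated directly: the expression is a derivative of
    [ou (dual S l) psi s], whose increments involve only |dual l| and increments of psi. *)
Lemma ou_dual2_bound s w i l : 0 < s ->
  `|decay s / spread s * ou (dual2 S l i) psi s w| <= decay s * (H * growth (dual S l) 0 w).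
Proof.
move=> s0; have b0 : spread s != 0 by rewrite gt_eqF// spread_gt0.
have dd : is_derive w (e_ i) (ou (dual S l) psi s) (decay s * ((spread s)^-1 * ou (dual2 S l i) psi s w)).
  by apply: is_derive_scale; exact: is_derive_mehler_dual.
rewrite -mulrA -(derive_val (is_derive := dd)).
have a0 := ltW (decay_gt0 s).
apply: (derive_norm_le (b := fun t => decay s * (H * growth (dual S l) `|t| w))).
- by rewrite !mulr_ge0// growth_bound_ge0.
- apply: cvgM; first exact: cvg_cst.
  by apply: cvgM; [exact: cvg_cst|exact: cvg_growth_bound].
move=> t t1.
have := @mehler_diff_le R _ _ _ d Z S hZ A B r B0 r0 (dual S l) psi H (decay s) (spread s) t i w (continuous_dual (i := l)) (exp_bounded_dual S l) lp H0 (decay01 (ltW s0)) (spread01 s) psiH.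
by rewrite -mulrA mulrCA.
Qed.

Lemma stein_top_bound k w i l :
  `|- \int[leb]_(s in D) (wspread k s * (decay s / spread s * ou (dual2 S l i) psi s w))|
    <= H * growth (dual S l) 0 w.
Proof.
have [i1 _] := is_derive_wspread_ou_dual Ssym Sunit k w i l lp.
have [i2 I2] := @integral_decay_spread R.
rewrite normrN (le_trans (le_normr_Rintegral mD i1))//.
set K := H * _.
have K0 : 0 <= K by rewrite !mulr_ge0// growth_bound_ge0.
rewrite -[leRHS]mulr1 -I2 -RintegralZl//.
apply: le_Rintegral => //.
- exact: integrable_norm.
- exact: (@integrableZl _ _ _ leb D mD K _ i2).
move=> s; rewrite /= in_itv/= andbT => s0.
rewrite normrM (ger0_norm (wspread_ge0 k s)).
have /andP[a0 a1] := decay01 (ltW s0).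
(* As [wspread k] is at most [wspread 0], the total weight is at most e^(-2s) / spread s, of
   integral 1. *)
apply: (@le_trans _ _ (wspread 0 s * (decay s * K))).
  apply: ler_pM => //; first exact: wspread_ge0.
    rewrite /wspread ler_wpM2r ?invr_ge0 ?spread_ge0// exprS expr1.
    by rewrite ler_piMr// exprn_ile1.
  exact: ou_dual2_bound.
by rewrite /wspread expr1 le_eqVlt; apply/orP; left; apply/eqP; ring.
Qed.

End invertible.

End bounds.

End stein_solution.

(** * Exponential growth of the derivatives of h o g *)

Section regularity.
Context {R : realType} (d : nat).
Local Notation e_ i := (delta_mx i 0 : 'cV[R]_d).

(** Pass from y to x one coordinate at a time. Intermediate points have norm at most |y| + D and
    steps have size at most D, where D = |x - y| <= |x| + |y|; the exponent is thus at most rho (|y|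
    + 2 D) <= 3 rho (|x| + |y|). *)
Lemma exp_lipschitz_coord (psi : 'cV[R]_d -> R) (C rho : R) : 0 <= C -> 0 <= rho ->
  (forall (t : R) i w, `|psi (t *: e_ i + w) - psi w| <= `|t| * (C * expR (rho * (norm1 w + `|t|)))) ->
  exp_lipschitz psi.
Proof.
move=> C0 rho0 H; exists C, (3 * rho); split=> [||x y]; rewrite ?mulr_ge0//.
pose dl i := (x - y) i 0; pose D := norm1 (x - y).
pose E := expR (rho * (norm1 y + 2 * D)).
have D0 : 0 <= D by exact: norm1_ge0.
have key (l : seq 'I_d) : \sum_(i <- l) `|dl i| <= D ->
    norm1 (\sum_(i <- l) dl i *: e_ i + y) <= \sum_(i <- l) `|dl i| + norm1 y /\
    `|psi (\sum_(i <- l) dl i *: e_ i + y) - psi y| <= (\sum_(i <- l) `|dl i|) * (C * E).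
  elim: l => [_|i l IH].
    by rewrite !big_nil !add0r subrr normr0 mul0r.
  rewrite !big_cons => lD.
  have s0 : 0 <= \sum_(j <- l) `|dl j| by exact: sumr_ge0.
  have [|n1 n2] := IH; first by rewrite (le_trans _ lD)// lerDr.
  split.
    rewrite -!addrA (le_trans (norm1D _ _))// norm1Z norm1_delta mulr1 lerD2l//.
  rewrite -addrA -[X in psi X - _]/(dl i *: e_ i + (\sum_(j <- l) dl j *: e_ j + y)).
  set z := _ + y in n1 n2 *.
  have -> : psi (dl i *: e_ i + z) - psi y = (psi (dl i *: e_ i + z) - psi z) + (psi z - psi y) by ring.
  rewrite (le_trans (ler_normD _ _))// mulrDl lerD//.
  rewrite (le_trans (H _ _ _))// ler_wpM2l// ler_wpM2l// ler_expR ler_wpM2l//.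
  have : `|dl i| <= D by rewrite (le_trans _ lD)// lerDl.
  have : \sum_(j <- l) `|dl j| <= D by rewrite (le_trans _ lD)// lerDr.
  by move: n1; lra.
have [|_] := key (index_enum 'I_d); first exact: lexx.
have -> : \sum_(i <- index_enum 'I_d) dl i *: e_ i = x - y.
  apply/matrixP => i j; rewrite ord1 summxE (bigD1 i)//= big1.
    by rewrite addr0 mxE [delta_mx _ _ _ _]mxE !eqxx mulr1.
  by move=> k ki; rewrite !mxE eq_sym (negPf ki) mulr0.
rewrite subrK => h; apply: (le_trans h).
rewrite -/(norm1 _) -/D mulrCA -mulrA ler_wpM2l// ler_wpM2l// ler_expR -mulrA mulrCA ler_wpM2l//.
have : D <= norm1 x + norm1 y by rewrite -(norm1N y); exact: norm1D.
by have := norm1_ge0 x; lra.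
Qed.

Variables (A B : R) (r : 'I_d -> R).
Hypotheses (A0 : 0 <= A) (B0 : 0 <= B) (r0 : forall i, 0 <= r i).

Lemma Qpow_ge0 (t : R) w : 0 <= Qpow A B r t w.
Proof. by rewrite addr_ge0// mulr_ge0// sumr_ge0// => k _; exact: powR_ge0. Qed.

Lemma Qpow_le_expR (t : R) w : 0 <= t ->
  Qpow A B r t w <= (A + B * d%:R) * expR ((\sum_k r k) * (norm1 w + t)).
Proof.
move=> t0; have E1 : 1 <= expR ((\sum_k r k) * (norm1 w + t)).
  by rewrite -expR0 ler_expR mulr_ge0 ?addr_ge0 ?norm1_ge0// sumr_ge0.
rewrite mulrDl lerD//; first by rewrite ler_peMr.
rewrite -mulrA ler_wpM2l//.
rewrite -[d in d%:R]card_ord -sum1_card natr_sum mulr_suml; apply: ler_sum => k _.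
rewrite mul1r (le_trans (powR_le_expR _ _)) ?addr_ge0// ler_expR.
rewrite ler_pM ?addr_ge0//; last by rewrite lerD2r le_norm1.
by rewrite (bigD1 k)//= lerDl sumr_ge0.
Qed.

Lemma exp_lipschitz_partials_comp n (h : R -> R) (g : 'cV[R]_d -> R) (s : seq 'I_d) :
  in_Cb n.+1 h -> in_CP n.+1 (Ppow A B r) g -> (size s <= n)%N ->
  exp_lipschitz (partials s (h \o g)).
Proof.
move=> hC gC sn; set K := A + B * d%:R; set rho := \sum_k r k.
have K0 : 0 <= K by rewrite addr_ge0// mulr_ge0.
have rho0 : 0 <= rho by exact: sumr_ge0.
have hn0 : 0 <= hnorm (size s).+1 h by exact: hnorm_ge0.
apply: (@exp_lipschitz_coord _ (hnorm (size s).+1 h * (1 + K)) rho) => //.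
  by apply: mulr_ge0 => //; exact: addr_ge0.
move=> t i w.
rewrite (le_trans (comp_partials_lipschitz A0 B0 r0 i w t hC gC sn))//.
rewrite ler_wpM2l// -mulrA ler_wpM2l//.
have Q0 := Qpow_ge0 `|t| w.
set p := (_ / _ : R).
have p0 : 0 <= p by rewrite divr_ge0.
have p1 : p <= 1 by rewrite /p ler_pdivrMr ?ltr0n// mul1r ler_nat ltnS.
have E1 : 1 <= expR (rho * (norm1 w + `|t|)).
  by rewrite -expR0 ler_expR mulr_ge0 ?addr_ge0 ?norm1_ge0.
(* The exponent p is at most 1, and Q^p <= 1 + Q. *)
apply: (@le_trans _ _ (1 + Qpow A B r `|t| w)); last first.
  by rewrite mulrDl mul1r lerD// Qpow_le_expR.
apply: (@le_trans _ _ ((1 + Qpow A B r `|t| w) `^ p)).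
  by apply: ge0_ler_powR => //; rewrite ?nnegrE ?lerDr// addr_ge0.
have a1 : 1 <= 1 + Qpow A B r `|t| w by rewrite lerDl.
by have := ler_powR a1 p1; rewrite powRr1// addr_ge0.
Qed.

Lemma partials_comp_top n (h : R -> R) (g : 'cV[R]_d -> R) (s : seq 'I_d) :
  in_Cb n.+1 h -> in_CP n.+1 (Ppow A B r) g -> size s = n ->
  forall (t : R) i w, `|partials s (h \o g) (t *: e_ i + w) - partials s (h \o g) w| <=
    `|t| * (hnorm n.+1 h * Qpow A B r `|t| w).
Proof.
move=> hC gC sn t i w.
have := comp_partials_lipschitz A0 B0 r0 i w t hC gC (eq_leq sn).
by rewrite sn divff ?pnatr_eq0// powRr1// Qpow_ge0.
Qed.

End regularity.

(** * Square roots of positive definite matrices *)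

Section square_roots.
Context {R : realType} (d : nat).
Implicit Types M S : 'M[R]_d.

Lemma pos_definite_unit M : pos_definite M -> M \in unitmx.
Proof.
move=> [_ Mpos]; rewrite -row_free_unit -kermx_eq0.
apply/eqP/row_matrixP => i; rewrite row0.
set u := row i (kermx M).
have uM : u *m M = 0.
  by rewrite /u -row_mul mulmx_ker row0.
apply/eqP; apply/negPn/negP => u0.
have ut0 : u^T != 0 by apply: contraNneq u0 => h; rewrite -(trmxK u) h trmx0.
by have := Mpos _ ut0; rewrite trmxK uM mul0mx mxE ltxx.
Qed.

Lemma sqrtmx_unit M S : pos_definite M -> is_sqrtmx M S -> S \in unitmx.
Proof.
by move=> /pos_definite_unit + [_ SM]; rewrite -SM unitmx_mul => /andP[].
Qed.

(** (S - 1) (S + 1) = 0, and S + 1 is positive definite, hence invertible. *)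
Lemma sqrtmx1 S : is_sqrtmx 1%:M S -> S = 1%:M.
Proof.
move=> [[Ssym Spos] SS].
have Su : (S + 1%:M) \in unitmx.
  apply: pos_definite_unit; split.
    by rewrite raddfD /= Ssym trmx1.
  move=> v v0; rewrite mulmxDr mulmxDl mulmx1 mxE ltr_wpDl//.
  rewrite mxE lt_def; apply/andP; split; last first.
    by apply: sumr_ge0 => k _; rewrite mxE -expr2 sqr_ge0.
  apply: contra v0 => /eqP h; apply/eqP/matrixP => i j; rewrite ord1 mxE.
  have sq k : 0 <= v^T 0 k * v k 0 by rewrite mxE -expr2 sqr_ge0.
  have := psumr_eq0P (fun k _ => sq k) h => /(_ i isT)/eqP.
  by rewrite mxE -expr2 sqrf_eq0 => /eqP.
have : (S - 1%:M) *m (S + 1%:M) = 0.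
  by rewrite mulmxDr mulmxBl mulmxBl !mulmx1 !mul1mx SS addrA subrK subrr.
move/(congr1 (mulmx^~ (invmx (S + 1%:M)))).
by rewrite mulmxK// mul0mx => /eqP; rewrite subr_eq0 => /eqP.
Qed.

End square_roots.

(** * Moments of standard normal variables *)

Section gaussian_moments.
Context {R : realType} dT (T : measurableType dT) (Pr : probability T R).
Variables (d : nat) (Z : 'I_d -> {RV Pr >-> R}).
Hypothesis hZ : std_normal_vector Z.
Local Notation e_ i := (delta_mx i 0 : 'cV[R]_d).

Lemma Ex_powR_normal l (p : R) : 0 <= p ->
  Ex Pr (fun t => `|Z l t| `^ p) = normal_absmoment p.
Proof.
move=> p0; rewrite /Ex /normal_absmoment unlock; congr fine.
apply: (ge0_integral_std_normal (g := fun x => (`|x| `^ p)%:E) (hZ.1 l)).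
  apply/measurable_EFinP; apply: (@measurableT_comp _ _ _ _ _ _ (fun x : R => x `^ p)).
    exact: measurable_powR.
  exact: normr_measurable.
by move=> x; rewrite lee_fin powR_ge0.
Qed.

Lemma Rintegral_probability_cst (c : R) : \int[Pr]_t c = c.
Proof.
rewrite Rintegral_cst// -[RHS]mulr1; congr (_ * _).
exact: (congr1 fine (probability_setT Pr)).
Qed.

(** Integration by parts for a coordinate: the derivative of E (Z_l + tau) in tau is 1 and also E
    Z_l^2. *)
Lemma Ex_sqr_normal l : Ex Pr (fun t => Z l t ^+ 2) = 1.
Proof.
pose F (z : 'cV[R]_d) : R := z l 0.
have cF : continuous F by exact: coord_continuous.
have bF : exp_bounded F.
  exists 1, 1; split => // x.
  by rewrite !mul1r (le_trans (le_norm1 x l))// ler_expR1.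
have H := is_derive_gaussian_shift hZ (e_ l) cF bF.
have E1 (tau : R) : Ex Pr (fun t => F (rvec Z t + tau *: e_ l)) = Ex Pr (Z l) + tau.
  rewrite !ExE -[X in _ + X]mulr1.
  have -> : tau * 1 = \int[Pr]_t cst tau t :> R.
    by rewrite Rintegral_probability_cst mulr1.
  rewrite -RintegralD//.
  - by apply: eq_Rintegral => t _; rewrite /F !mxE !eqxx mulr1.
  - have := integrable_rvec hZ cF bF.
    by congr (Pr.-integrable _ _); apply/funext => t; rewrite /F /= mxE.
  - exact: finite_measure_integrable_cst.
have H2 : is_derive (0 : R) 1 (fun tau : R => Ex Pr (Z l) + tau) 1.
  by have := is_deriveD (is_derive_cst (Ex Pr (Z l)) (0 : R) 1) (is_derive_id (0 : R) 1); rewrite add0r.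
have := derive_val (is_derive := H).
rewrite (_ : (fun tau : R => _) = (fun tau : R => Ex Pr (Z l) + tau)); last by apply/funext.
rewrite (derive_val (is_derive := H2)) => ->.
congr (Ex Pr _); apply/funext => t.
rewrite (bigD1 l)//= big1 ?addr0; last first.
  by move=> k kl; rewrite mxE (negPf kl) mul0r.
by rewrite /F !mxE !eqxx mul1r expr2.
Qed.

Lemma integrable_powR_normal l (p : R) : 0 <= p ->
  Pr.-integrable setT (EFin \o (fun t => `|Z l t| `^ p)).
Proof.
move=> p0; apply: (integrable_le_expR hZ.1 (C := 1) (b := p)).
  apply: (@measurableT_comp _ _ _ _ _ _ (fun x : R => x `^ p)).
    exact: measurable_powR.
  exact: measurableT_comp.
move=> t; rewrite mul1r ger0_norm ?powR_ge0// (le_trans (powR_le_expR _ _))// ler_expR.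
by rewrite ler_wpM2l// le_normZ.
Qed.

(** |z| <= (z^2 + 1) / 2 and E Z_l^2 = 1. *)
Lemma Ex_normr_normal_le1 l : Ex Pr (fun t => `|Z l t|) <= 1.
Proof.
have i1 : Pr.-integrable setT (EFin \o (fun t => `|Z l t|)).
  have := @integrable_powR_normal l 1 ler01.
  by congr (Pr.-integrable _ _); apply/funext => t; rewrite /= powRr1.
have i2 : Pr.-integrable setT (EFin \o (fun t => Z l t ^+ 2)).
  have := @integrable_powR_normal l 2%:R (ler0n _ _).
  by congr (Pr.-integrable _ _); apply/funext => t; rewrite /= powR_mulrn// -normrX ger0_norm// sqr_ge0.
have i3 : Pr.-integrable setT (EFin \o (fun t => 2^-1 * Z l t ^+ 2)).
  exact: (@integrableZl _ _ _ Pr setT measurableT 2^-1 _ i2).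
have i4 : Pr.-integrable setT (EFin \o cst (2^-1 : R)).
  exact: finite_measure_integrable_cst.
rewrite (_ : 1 = \int[Pr]_t (2^-1 * Z l t ^+ 2 + 2^-1)); last first.
  rewrite RintegralD// RintegralZl// Rintegral_probability_cst -ExE Ex_sqr_normal; lra.
rewrite ExE; apply: le_Rintegral => //; first exact: (integrableD measurableT i3 i4).
move=> t _; rewrite -[Z l t ^+ 2](ger0_norm (sqr_ge0 _)) normrX.
by move: `|Z l t| => z; have := sqr_ge0 (z - 1); lra.
Qed.

Lemma young_powR (p a b : R) : 0 <= p -> 0 <= a -> 0 <= b ->
  a * b `^ p <= (1 + p)^-1 * a `^ (p + 1) + p * (1 + p)^-1 * b `^ (p + 1).
Proof.
rewrite le_eqVlt => /predU1P[<-|p0] a0 b0.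
  by rewrite powRr0 addr0 add0r invr1 !mul1r mul0r mul0r addr0 powRr1// mulr1.
have p1 : 0 < p + 1 by rewrite addr_gt0.
have pn0 : p != 0 by rewrite gt_eqF.
have p1n0 : p + 1 != 0 by rewrite gt_eqF.
have p1n0' : 1 + p != 0 by rewrite addrC.
have := @conjugate_powR R a (b `^ p) (p + 1) ((p + 1) / p) a0 (powR_ge0 _ _) p1.
rewrite divr_gt0// => /(_ isT).
have -> : (p + 1)^-1 + ((p + 1) / p)^-1 = 1 by field; rewrite p1n0 pn0.
move=> /(_ erefl) h; apply: (le_trans h).
rewrite -powRrM (_ : p * ((p + 1) / p) = p + 1); last by field.
rewrite le_eqVlt; apply/orP; left; apply/eqP; field.
by rewrite p1n0' pn0.
Qed.

(** The coefficients in Young's inequality with exponents p + 1 and (p + 1) / p add up to 1, and all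
    coordinates have the same moments. The indices k and l may coincide. *)
Lemma Ex_normr_powR_le k l (p : R) : 0 <= p ->
  Ex Pr (fun t => `|Z l t| * `|Z k t| `^ p) <= normal_absmoment (p + 1).
Proof.
move=> p0; have p1 : 0 <= p + 1 by rewrite addr_ge0.
have i1 := integrable_powR_normal l p1; have i2 := integrable_powR_normal k p1.
have j1 : Pr.-integrable setT (EFin \o (fun t => (1 + p)^-1 * `|Z l t| `^ (p + 1))).
  exact: (@integrableZl _ _ _ Pr setT measurableT (1 + p)^-1 _ i1).
have j2 : Pr.-integrable setT (EFin \o (fun t => p * (1 + p)^-1 * `|Z k t| `^ (p + 1))).
  exact: (@integrableZl _ _ _ Pr setT measurableT (p * (1 + p)^-1) _ i2).
have j3 : Pr.-integrable setT (EFin \o (fun t => (1 + p)^-1 * `|Z l t| `^ (p + 1) + p * (1 + p)^-1 * `|Z k t| `^ (p + 1))).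
  exact: (integrableD measurableT j1 j2).
rewrite (_ : normal_absmoment (p + 1) = \int[Pr]_t ((1 + p)^-1 * `|Z l t| `^ (p + 1) + p * (1 + p)^-1 * `|Z k t| `^ (p + 1))).
  rewrite ExE; apply: le_Rintegral => //; last by move=> t _; exact: young_powR.
  apply: le_integrable j3 => //.
    apply/measurable_EFinP; apply: measurable_funM.
      exact: measurableT_comp.
    apply: (@measurableT_comp _ _ _ _ _ _ (fun x : R => x `^ p)).
      exact: measurable_powR.
    exact: measurableT_comp.
  move=> t _; rewrite /= lee_fin [leLHS]ger0_norm ?mulr_ge0 ?powR_ge0//.
  by rewrite (le_trans (young_powR _ _ _))// ler_norm.
rewrite RintegralD// !RintegralZl// -!ExE !Ex_powR_normal//.
by field; rewrite gt_eqF// ltr_pwDl.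
Qed.

End gaussian_moments.

(** * Cases (1) and (2) *)

Section part_one_two.
Context {R : realType} dT (T : measurableType dT) (Pr : probability T R).
Variables (d : nat) (Z : 'I_d -> {RV Pr >-> R}) (S : 'M[R]_d).
Hypothesis hZ : std_normal_vector Z.
Variables (A B : R) (r : 'I_d -> R).
Hypotheses (A0 : 0 <= A) (B0 : 0 <= B) (r0 : forall i, 0 <= r i).
Local Notation e_ i := (delta_mx i 0 : 'cV[R]_d).
Variables (n : nat) (h : R -> R) (g : 'cV[R]_d -> R).
Hypotheses (hC : in_Cb n.+1 h) (gC : in_CP n.+1 (Ppow A B r) g).
Local Notation f := (stein_solution Z S (h \o g)).

Let phi_exist : partials_exist n (h \o g) := comp_partials_exist hC gC.1.
Let phi_lip (s : seq 'I_d) (sn : (size s <= n)%N) : exp_lipschitz (partials s (h \o g)) :=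
  exp_lipschitz_partials_comp A0 B0 r0 hC gC sn.

Lemma stein_partials_exist : partials_exist n f.
Proof. exact: (partials_exist_stein hZ phi_exist phi_lip). Qed.

Lemma stein_partials_existS :
  (forall x, derivable (derive1n n h) x 1) -> partials_exist n.+1 f.
Proof.
move=> hd s i w; rewrite ltnS leq_eqVlt => /predU1P[sn|]; last exact: stein_partials_exist.
apply: (partials_stein_derivable hZ phi_exist phi_lip) => // y.
apply: (partials_comp_derivable gC.1) => //; last by rewrite sn.
by move=> k x kn; case: hC => + _ _; apply.
Qed.

Lemma stein_partials_bound (i : n.+1.-tuple 'I_d) w :
  `|partials i f w| <= hnorm n.+1 h / n.+1%:R *
    (A + B * \sum_k (2 `^ r k *
       (`|w k 0| `^ r k + Ex Pr (fun t => `|(S *m rvec Z t) k 0| `^ r k)))).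
Proof.
case: i => [[|i s] //= /eqP[sn]].
have sn' : (size s <= n)%N by rewrite sn.
rewrite (partials_stein S hZ phi_exist phi_lip sn').
have kc : (0 < size s)%N \/ (if s is [::] then Ex Pr (fun t => (h \o g) (S *m rvec Z t)) else 0) =
    Ex Pr (fun t => partials s (h \o g) (S *m rvec Z t)).
  by case: (s) => [|? ?]; [right|left].
have H0 : 0 <= hnorm n.+1 h by exact: hnorm_ge0.
have := weighted_ou_derive_bound hZ A0 B0 r0 H0 (phi_lip sn') (partials_comp_top A0 B0 r0 hC gC sn) w i kc.
rewrite sn => /le_trans; apply; rewrite le_eqVlt; apply/orP; left; apply/eqP.
congr (_ * _); rewrite /growth_bound.
have -> : Ex Pr (fun t => `|cst 1 (rvec Z t)|) = 1 :> R.
  by rewrite ExE; under eq_Rintegral do rewrite normr1; exact: Rintegral_probability_cst.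
rewrite mulr1; congr (_ + _ * _); apply: eq_bigr => k _.
rewrite mulr1 addr0; congr (_ * (_ + _)); congr (Ex Pr _).
by apply/funext => t; rewrite normr1 mul1r.
Qed.

Section invertible.
Hypotheses (Ssym : S^T = S) (Sunit : S \in unitmx).

Lemma stein_partials_existSS : partials_exist n.+2 f.
Proof. exact: (partials_exist_stein_spread hZ phi_exist phi_lip Ssym Sunit). Qed.

(** If l occurs behind the outermost index, integrate by parts there and treat the outermost
    derivative by increments. If l is the outermost index, integrate by parts in the next one and
    use the symmetry of [dual2], so that the order of the derivatives of f is never changed. *)
Lemma stein_partials_bound_mem (i : n.+2.-tuple 'I_d) w l : l \in (i : seq 'I_d) ->
  `|partials i f w| <= hnorm n.+1 h * growth_bound Z S A B r (dual S l) 0 w.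
Proof.
have H0 : 0 <= hnorm n.+1 h by exact: hnorm_ge0.
have key (a b : seq 'I_d) j k : (size a + size b)%N = n ->
  `|partials (j :: a ++ k :: b) f w| <= hnorm n.+1 h * growth_bound Z S A B r (dual S k) 0 w.
  move=> abn.
  rewrite (partials_stein_top hZ phi_exist phi_lip Ssym Sunit); last by rewrite abn.
  apply: stein_top_bound => //.
  - by apply: phi_lip; rewrite size_cat abn.
  - by apply: partials_comp_top => //; rewrite size_cat.
case: i => [[|i0 s] //= /eqP[sn]]; rewrite inE => /predU1P[->|]; last first.
  move=> ls; have [a [b E]] : exists a b, s = a ++ l :: b.
    by have /splitPr[a b] := ls; exists a, b.
  by rewrite E; apply: key; move: sn; rewrite E size_cat/= addnS => -[].
case: s sn => [//|j b] /= -[bn].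
rewrite -[leLHS]/(`|partials (i0 :: [::] ++ j :: b) f w|).
rewrite (partials_stein_top hZ phi_exist phi_lip Ssym Sunit); last by rewrite bn.
rewrite (dual2C Ssym); apply: stein_top_bound => //.
- by apply: phi_lip; rewrite bn.
- exact: partials_comp_top.
Qed.

End invertible.

End part_one_two.

Lemma min_over_mem (R : realType) (I : eqType) (s : seq I) (F : I -> R) : s != [::] ->
  exists2 l, l \in s & min_over s F = F l.
Proof.
case: s => [//|l s] _; rewrite /min_over.
elim: s => [|k s [j js E]]; first by exists l; rewrite ?big_nil ?mem_head.
rewrite big_cons E /Num.min /Order.min; case: ifP => _.
  by exists k; rewrite // !inE eqxx orbT.
by exists j => //; move: js; rewrite !inE => /orP[->|->]; rewrite ?orbT.
Qed.

(** * Case (3) *)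

Section part_three.
Context {R : realType} dT (T : measurableType dT) (Pr : probability T R).
Variables (d : nat) (Z : 'I_d -> {RV Pr >-> R}).
Hypothesis hZ : std_normal_vector Z.
Variables (A B : R) (r : 'I_d -> R).
Hypotheses (A0 : 0 <= A) (B0 : 0 <= B) (r0 : forall i, 0 <= r i).

Lemma growth_bound_identity l w :
  growth_bound Z 1%:M A B r (dual 1%:M l) 0 w <=
  A + B * \sum_k (2 `^ r k * (`|w k 0| `^ r k + normal_absmoment (r k + 1))).
Proof.
have E t : dual 1%:M l (rvec Z t) = Z l t by rewrite /dual invmx1 mul1mx mxE.
rewrite /growth_bound.
have -> : Ex Pr (fun t => `|dual 1%:M l (rvec Z t)|) = Ex Pr (fun t => `|Z l t|).
  by congr (Ex Pr _); apply/funext => t; rewrite E.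
have m1 := Ex_normr_normal_le1 hZ l.
rewrite lerD ?ler_piMr// ler_wpM2l//; apply: ler_sum => k _.
rewrite ler_wpM2l ?powR_ge0// addr0 lerD//.
  by rewrite ler_piMr ?powR_ge0.
rewrite (le_trans _ (Ex_normr_powR_le hZ k l (r0 k)))//.
rewrite le_eqVlt; apply/orP; left; apply/eqP; congr (Ex Pr _).
by apply/funext => t; rewrite E mul1mx mxE.
Qed.

End part_three.

Lemma corollary2p2_one (R : realType) (dT : measure_display)
    (T : measurableType dT) (Pr : probability T R) :
  (forall (d : nat) (Z : 'I_d -> {RV Pr >-> R}) (Sigma S : 'M[R]_d)
      (A B : R) (r : 'I_d -> R) (n : nat) (h : R -> R) (g : 'cV[R]_d -> R),
    std_normal_vector Z ->
    0 <= A -> 0 <= B -> (forall i, 0 <= r i) ->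
    nonneg_definite Sigma -> is_sqrtmx Sigma S ->
    (1 <= n)%N -> in_Cb n h -> in_CP n (Ppow A B r) g ->
    let f := stein_solution Z S (h \o g) in
    let Zc := fun (i : 'I_d) (t : T) => (S *m rvec Z t) i 0 in
    [/\ partials_exist n.-1 f,
        (forall x, derivable (derive1n n.-1 h) x 1) \/ pos_definite Sigma ->
          partials_exist n f &
        forall (i : n.-tuple 'I_d) (w : 'cV[R]_d),
          `|partials i f w| <=
            hnorm n h / n%:R *
              (A + B * \sum_k (2 `^ r k *
                 (`|w k 0| `^ r k + Ex Pr (fun t => `|Zc k t| `^ r k))))]).
Proof.
move=> d Z Sigma S A B r [//|n] h g hZ A0 B0 r0 nnd sq _ hC gC f Zc; split.
- exact: (stein_partials_exist hZ A0 B0 r0 hC gC).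
- move=> [hd|pd]; first exact: (stein_partials_existS hZ A0 B0 r0 hC gC).
  have Su := sqrtmx_unit pd sq; have Ssym := sq.1.1.
  move=> s i w sn; have := stein_partials_existSS hZ A0 B0 r0 hC gC Ssym Su.
  by apply; rewrite ltnW.
- by move=> i w; exact: stein_partials_bound.
Qed.

Lemma corollary2p2_two (R : realType) (dT : measure_display)
    (T : measurableType dT) (Pr : probability T R) :
  (forall (d : nat) (Z : 'I_d -> {RV Pr >-> R}) (Sigma S : 'M[R]_d)
      (A B : R) (r : 'I_d -> R) (n : nat) (h : R -> R) (g : 'cV[R]_d -> R),
    std_normal_vector Z ->
    0 <= A -> 0 <= B -> (forall i, 0 <= r i) ->
    pos_definite Sigma -> is_sqrtmx Sigma S ->
    (2 <= n)%N -> in_Cb n.-1 h -> in_CP n.-1 (Ppow A B r) g ->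
    let f := stein_solution Z S (h \o g) in
    let Zc := fun (i : 'I_d) (t : T) => (S *m rvec Z t) i 0 in
    let Zinv := fun (l : 'I_d) (t : T) => (invmx S *m rvec Z t) l 0 in
    [/\ partials_exist n f,
        forall (i : n.-tuple 'I_d) (w : 'cV[R]_d),
          `|partials i f w| <=
            hnorm n.-1 h * min_over i (fun l =>
              A * Ex Pr (fun t => `|Zinv l t|) +
              B * \sum_k (2 `^ r k *
                (`|w k 0| `^ r k * Ex Pr (fun t => `|Zinv l t|) +
                 Ex Pr (fun t => `|Zinv l t| * `|Zc k t| `^ r k)))) &
        Sigma = 1%:M ->
        forall (i : n.-tuple 'I_d) (w : 'cV[R]_d),
          `|partials i f w| <=
            hnorm n.-1 h *
              (A + B * \sum_k (2 `^ r k *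
                (`|w k 0| `^ r k + normal_absmoment (r k + 1))))]).
Proof.
move=> d Z Sigma S A B r [//|[//|n]] h g hZ A0 B0 r0 pd sq _ hC gC f Zc Zinv.
have Su := sqrtmx_unit pd sq; have Ssym := sq.1.1.
have bnd := stein_partials_bound_mem hZ A0 B0 r0 hC gC Ssym Su.
split.
- exact: (stein_partials_existSS hZ A0 B0 r0 hC gC Ssym Su).
- move=> i w.
  set F := (F in min_over _ F).
  have [|l li ->] := @min_over_mem R _ i F; first by case: i => [[]].
  rewrite (le_trans (bnd i w l li))// le_eqVlt; apply/orP; left; apply/eqP.
  rewrite /F /growth_bound; congr (_ * (_ + _ * _)).
  by apply: eq_bigr => k _; rewrite addr0.
- move=> S1 i w; subst Sigma.
  have SE := sqrtmx1 sq.
  have il : tnth i ord0 \in (i : seq _) by exact: mem_tnth.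
  rewrite (le_trans (bnd i w _ il))// ler_wpM2l ?hnorm_ge0// SE.
  exact: growth_bound_identity.
Qed.

(** * Antiderivatives of continuous functions *)

Section antiderivative.
Context {R : realType}.
Notation leb := (@lebesgue_measure R).
Local Notation e0 := (delta_mx 0 0 : 'cV[R]_1).

Lemma ex_antiderivative (f : R -> R) : continuous f ->
  exists F : R -> R, forall x : R, is_derive x 1 F (f x).
Proof.
move=> cf.
have itf a b : leb.-integrable `[a, b] (EFin \o f).
  apply: continuous_compact_integrable; first exact: segment_compact.
  exact: continuous_subspaceT.
pose P a x := \int[leb]_(t in `[a, x]) f t.
have dP (a x : R) : a < x -> is_derive x 1 (P a) (f x).
  move=> ax; have x1 : x < x + 1 by rewrite ltrDl.
  have [h1 h2] := continuous_FTC1_closed x1 (itf a (x + 1)) ax (cf x).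
  apply: DeriveDef; first exact: h1.
  by rewrite -derive1E; exact: h2.
have PB a b x y : a <= b -> b <= x -> b <= y -> P a x - P a y = P b x - P b y.
  move=> ab.
  have H z : b <= z -> P a z = P a b + P b z.
    move=> bz; rewrite /P -(@Rintegral_itv_obnd_cbnd _ b); last first.
      apply: integrableS (itf b z) => // t /=.
      by rewrite !in_itv/= => /andP[/ltW -> ->].
    rewrite -(@Rintegral_itvB _ f (BLeft a) (BRight z) b) ?bnd_simp//.
    by rewrite addrC subrK.
  by move=> bx yx; rewrite H// [P a y]H//; ring.
(* The base point lies to the left of 0 and of x; the difference does not depend on it. *)
pose F x := P (- `|x| - 1) x - P (- `|x| - 1) 0.
exists F => x.
(* A base point that serves all y within distance 1 of x. *)
pose c := - `|x| - 2.
have cx : c < x by rewrite /c; have := ler_norm (- x); rewrite normrN; lra.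
have h : is_derive x 1 (fun y => P c y - P c 0) (f x).
  have := is_deriveB (dP c x cx) (is_derive_cst (P c 0) x 1).
  by rewrite subr0.
apply: near_eq_is_derive h.
have : \forall y \near x, `|x - y| <= 1 by exists 1 => //= y /ltW.
apply: filterS => y xy; rewrite /F.
have : `|y| <= `|x| + 1.
  by rewrite -[y](subKr x) (le_trans (ler_normB _ _))// lerD2l.
move=> yx; have yn := ler_norm (- y); rewrite normrN in yn; have y0 := normr_ge0 y.
by apply: PB; rewrite /c; lra.
Qed.

Lemma is_derive_lift (F : R -> R) (y : 'cV[R]_1) l :
  is_derive (y 0 0) 1 F l -> is_derive y e0 (fun x : 'cV[R]_1 => F (x 0 0)) l.
Proof.
move=> /is_derive_lineP h; apply/is_derive_lineP.
rewrite (_ : (fun t : R => _) = (fun t : R => F (t *: (1 : R) + y 0 0)))//.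
by apply/funext => t; rewrite !mxE eqxx.
Qed.

Lemma norm1_cV1 (x : 'cV[R]_1) : norm1 x = `|x 0 0|.
Proof. by rewrite /norm1 big_ord1. Qed.

Lemma exp_lipschitz_lift (F f : R -> R) (C a : R) : 0 <= C -> 0 <= a ->
  (forall x : R, is_derive x 1 F (f x)) -> (forall x, `|f x| <= C * expR (a * `|x|)) ->
  exp_lipschitz (fun x : 'cV[R]_1 => F (x 0 0)).
Proof.
move=> C0 a0 dF fC; exists C, a; split=> // x y.
rewrite !norm1_cV1 !mxE; move: (x 0 0) (y 0 0) => {}x {}y.
wlog xy : x y / y <= x.
  move=> W; have [/W//|/ltW/W] := leP y x.
  by rewrite distrC [`|y - x|]distrC [`|y| + _]addrC.
rewrite [`|x - y|]ger0_norm ?subr_ge0// mulrAC.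
apply: lip_at_mean_value => //; first by rewrite mulr_ge0 ?expR_ge0.
move=> z /andP[yz zx]; apply: lip_at_le (is_derive_lip_at (dF z)).
rewrite (le_trans (fC z))// ler_wpM2l// ler_expR ler_wpM2l//.
rewrite ler_norml; have := ler_norm x; have := ler_norm (- y); rewrite normrN.
by have := normr_ge0 x; have := normr_ge0 y; lra.
Qed.

End antiderivative.

(** * The case of dimension one *)

Section barrier.
Context {R : realType}.
Variables (W V y chi : R -> R) (c p m C a : R).
Hypotheses (p0 : 0 <= p) (mE : m = p + 1).
Hypotheses (dy : forall x : R, is_derive x 1 y (W x)) (dW : forall x : R, is_derive x 1 W (V x)).
Hypothesis VE : forall x : R, V x = x * W x + p * y x - chi x + c.
Hypotheses (chi_nd : forall x z : R, x <= z -> chi x <= chi z) (chi_cont : continuous chi).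
Hypothesis W0 : forall x, 0 <= W x.
Hypotheses (C0 : 0 <= C) (a0 : 0 <= a).
Hypothesis growth : forall x : R, 0 <= x -> `|chi x| + `|y x| + `|W x| <= C * expR (a * x).

Let m0 : 0 < m. Proof. by rewrite mE ltr_wpDl. Qed.

Let q (x : R) : R := Num.sqrt (x ^+ 2 + 4 * m).
Let b (x : R) : R := (q x - x) / 2.

Let q2 (x : R) : q x ^+ 2 = x ^+ 2 + 4 * m.
Proof. by rewrite sqr_sqrtr// addr_ge0 ?sqr_ge0// mulr_ge0// ltW. Qed.

Let q_gt0 (x : R) : 0 < q x.
Proof. by rewrite sqrtr_gt0 ltr_wpDl ?sqr_ge0// mulr_gt0. Qed.

Let q_gtx (x : R) : x < q x.
Proof. by have := q2 x; have := q_gt0 x; have := m0; nra. Qed.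

Let bE (x : R) : b x ^+ 2 + x * b x = m.
Proof. by rewrite /b; have := q2 x; move: (q x) => z zE; nra. Qed.

Let b_gt0 (x : R) : 0 < b x.
Proof. by rewrite divr_gt0// subr_gt0. Qed.

Let db (x : R) : is_derive x 1 b ((x / q x - 1) / 2).
Proof.
pose P (x : R) : R := x ^+ 2 + 4 * m.
have dP : is_derive x 1 P (2 * x).
  by apply: is_derive_eq; rewrite /GRing.scale/=; ring.
have P0 : 0 < P x by rewrite ltr_wpDl ?sqr_ge0// mulr_gt0.
have dq : is_derive x 1 q (x / q x).
  have h := is_derive1_comp (is_derive1_sqrt P0) dP.
  apply: is_derive_eq h _; rewrite -/(q x).
  by field; rewrite gt_eqF.
have h := is_deriveM (is_deriveB dq (is_derive_id x 1)) (is_derive_cst (2^-1 : R) x 1).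
by apply: is_derive_eq h _; rewrite /GRing.scale/=; ring.
Qed.

Let db_le0 (x : R) : (x / q x - 1) / 2 <= 0.
Proof.
rewrite mulr_le0_ge0// subr_le0 ler_pdivrMr// mul1r.
exact: ltW.
Qed.

(* [b x] is the positive root of b^2 + x b = m.  If [D] were positive somewhere on
   the half line, D(x) e^(-x^2/4), which tends to 0 at infinity, would attain a
   positive maximum there; but D = E + chi with chi nondecreasing and
   E' >= (x + b) D, so it increases strictly to the right of such a point. *)
Let D (x : R) := - V x - b x * W x.
Let E (x : R) := - (x * W x + p * y x + c) - b x * W x.

Let DE (x : R) : D x = E x + chi x. Proof. by rewrite /D /E VE; ring. Qed.

Let dE (x : R) : is_derive x 1 E ((x + b x) * D x - (x / q x - 1) / 2 * W x).
Proof.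
have h1 := is_deriveM (is_derive_id x 1) (dW x).
have h2 := is_deriveM (is_derive_cst p x 1) (dy x).
have h3 := is_deriveM (db x) (dW x).
have h := is_deriveB (is_deriveN (is_deriveD (is_deriveD h1 h2) (is_derive_cst c x 1))) h3.
apply: is_derive_eq h _; rewrite /GRing.scale/= /D.
have := bE x; rewrite mE; move: (b x) ((x / q x - 1) / 2) (W x) (V x) => b1 b' w v bm.
have -> : p = b1 ^+ 2 + x * b1 - 1 by rewrite bm addrK.
ring.
Qed.

Let is_derive_continuous (F : R -> R) (x l : R) : is_derive x 1 F l -> {for x, continuous F}.
Proof.
by move=> [dF _]; apply: differentiable_continuous; exact/derivable1_diffP.
Qed.

Let cD : continuous D.
Proof.
move=> x; rewrite (_ : D = fun x => E x + chi x); last by apply/funext.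
apply: continuousD; last exact: chi_cont.
exact: is_derive_continuous (dE x).
Qed.

Let G (x : R) := D x * expR (- (x ^+ 2 / 4)).

Let cG : continuous G.
Proof.
move=> x; apply: continuousM; first exact: cD.
apply: (@continuous_comp _ _ _ (fun x : R => - (x ^+ 2 / 4)) expR); last exact: continuous_expR.
apply: continuousN; apply: (@continuousM _ _ (fun x : R => x ^+ 2) (cst 4^-1)); last exact: cst_continuous.
exact: exprn_continuous.
Qed.

Let K : R := (m + p + 2 + `|c|) * (C + 1).

Let G_le (x : R) : 4 * (a + 2) <= x -> 0 < x -> G x <= K / x.
Proof.
move=> ax x0; have x0' := ltW x0.
have bm : b x <= m + 1 by have := bE x; have := b_gt0 x; have := m0; nra.
have Ex1 : 1 <= expR (a * x) by rewrite -expR0 ler_expR mulr_ge0.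
have := growth x0'; have := W0 x; rewrite (ger0_norm (W0 x)) => w0 g.
have DK : D x <= K * (expR (a * x) * (1 + x)).
  have n1 := normr_ge0 (chi x); have n2 := normr_ge0 (y x); have n3 := normr_ge0 c.
  have l1 := ler_norm (chi x); have l2 := ler_norm (- y x); rewrite normrN in l2.
  have l3 := ler_norm (- c); rewrite normrN in l3.
  set X := expR (a * x) in Ex1 g *.
  have CX : C * X <= (C + 1) * X by rewrite ler_wpM2r ?lerDl// (le_trans _ Ex1).
  have CX1 : 1 <= (C + 1) * X by nra.
  rewrite /D VE /K.
  rewrite (_ : _ * (X * (1 + x)) = (m + p + 2 + `|c|) * ((C + 1) * X) * (1 + x)); last by ring.
  have s1 : `|chi x| <= (C + 1) * X by lra.
  have s2 : `|y x| <= (C + 1) * X by lra.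
  have s3 : W x <= (C + 1) * X by lra.
  move: ((C + 1) * X) CX1 s1 s2 s3 => L L1 s1 s2 s3.
  have t1 : - (x * W x) <= 0 by rewrite oppr_le0 mulr_ge0.
  have t2 : - (p * y x) <= p * L.
    by rewrite -mulrN ler_wpM2l//; lra.
  have t3 : - (b x * W x) <= 0 by rewrite oppr_le0 mulr_ge0// ltW.
  have t4 : - c <= `|c| * L by rewrite (le_trans l3)// ler_peMr.
  have t5 : (p + 1 + `|c|) * L <= (m + p + 2 + `|c|) * L * (1 + x).
    have L0 : 0 <= L by lra.
    have v0 : 0 <= m + p + 2 + `|c| by rewrite !addr_ge0// ltW.
    have u0 : 0 <= (m + p + 2 + `|c|) * L by exact: mulr_ge0.
    apply: (@le_trans _ _ ((m + p + 2 + `|c|) * L)); last by rewrite ler_peMr//; lra.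
    by rewrite ler_wpM2r// !lerD// ?ler1n// ler_wpDl// ltW.
  by move: t5; rewrite !mulrDl; lra.
(* From x >= 4 (a + 2) follows x^2 / 4 >= (a + 2) x, so the product is at most e^(-x) <= 1 / x. *)
have h : expR (a * x) * (1 + x) * expR (- (x ^+ 2 / 4)) <= x^-1.
  have e1 : 1 + x <= expR x by exact: expR_ge1Dx.
  apply: (@le_trans _ _ (expR (- x))).
    apply: (@le_trans _ _ (expR (a * x) * expR x * expR (- (x ^+ 2 / 4)))).
      by rewrite ler_wpM2r ?expR_ge0// ler_wpM2l ?expR_ge0.
    by rewrite -!expRD ler_expR; nra.
  rewrite expRN lef_pV2 ?posrE ?expR_gt0//.
  by rewrite (le_trans _ e1)// lerDr.
have K0 : 0 <= K by rewrite mulr_ge0 ?addr_ge0// ltW.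
rewrite /G (le_trans (ler_wpM2r (expR_ge0 _) DK))// -mulrA.
by rewrite ler_wpM2l.
Qed.

Let D_le0 (w : R) : 0 <= w -> D w <= 0.
Proof.
move=> w0; rewrite leNgt; apply/negP => Dw.
have Gw : 0 < G w by rewrite mulr_gt0 ?expR_gt0.
have K0 : 0 <= K by rewrite mulr_ge0 ?addr_ge0// ltW.
have KG0 : 0 <= K / G w by rewrite divr_ge0// ltW.
have a2 : 0 <= 4 * (a + 2) by rewrite mulr_ge0 ?addr_ge0.
have [M [wM aM kM M0]] : exists M : R, [/\ w <= M, 4 * (a + 2) <= M, K / G w <= M & 0 < M].
  exists (w + (4 * (a + 2) + (K / G w + 1))).
  have n1 : 0 <= K / G w + 1 by rewrite addr_ge0.
  split; first by rewrite lerDl addr_ge0.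
  - by rewrite ler_wpDl// lerDl.
  - by rewrite ler_wpDl// ler_wpDl// lerDl.
  - by rewrite ltr_wpDl// ltr_wpDl// ltr_wpDl.
(* Beyond [M] the bound K / x is at most [G w], so the maximum over [w, M] is one over [w, +oo[. *)
have [w1 + w1max] := EVT_max wM (continuous_subspaceT cG).
rewrite in_itv/= => /andP[ww1 w1M].
have Gmax x : w <= x -> G x <= G w1.
  move=> wx; have [xM|Mx] := leP x M; first by apply: w1max; rewrite in_itv/= wx.
  apply: (@le_trans _ _ (G w)); last by apply: w1max; rewrite in_itv/= lexx.
  have x0 : 0 < x by exact: lt_trans Mx.
  rewrite (le_trans (G_le _ x0))//; first by rewrite (le_trans aM)// ltW.
  by rewrite ler_pdivrMr// mulrC -ler_pdivrMr// (le_trans kM)// ltW.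
have Dw1 : 0 < D w1.
  have : 0 < G w1 by rewrite (lt_le_trans Gw)// Gmax.
  by rewrite pmulr_lgt0// expR_gt0.
have w10 : 0 <= w1 by exact: le_trans ww1.
(* [D] contains chi and need not be differentiable. Maximality is transferred to the differentiable
   [Q]: since chi is nondecreasing, [Q] is minimal at w1 on [w1, +oo[. Its derivative there is -(w1
   / 2 + b) D w1 + b' W w1 < 0, a contradiction. *)
pose Q (x : R) : R := D w1 * expR ((x ^+ 2 - w1 ^+ 2) / 4) - E x.
have Qmin x : w1 <= x -> Q w1 <= Q x.
  move=> w1x; rewrite /Q subrr mul0r expR0 mulr1.
  have := Gmax x (le_trans ww1 w1x); rewrite /G => g.
  have g' : D x <= D w1 * expR ((x ^+ 2 - w1 ^+ 2) / 4).
    have e : expR (- (x ^+ 2 / 4)) * expR (x ^+ 2 / 4) = 1.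
      by rewrite -expRD addNr expR0.
    have := ler_wpM2r (expR_ge0 (x ^+ 2 / 4)) g.
    rewrite -mulrA e mulr1 => /le_trans; apply.
    rewrite -mulrA -expRD ler_wpM2l ?(ltW Dw1)// ler_expR; lra.
  by have := chi_nd w1x; have := DE x; have := DE w1; lra.
have dQ : is_derive w1 1 Q (D w1 * (w1 / 2) - ((w1 + b w1) * D w1 - (w1 / q w1 - 1) / 2 * W w1)).
  pose P (x : R) : R := (x ^+ 2 - w1 ^+ 2) / 4.
  have dP : is_derive w1 1 P (w1 / 2).
    by apply: is_derive_eq; rewrite /GRing.scale/=; field.
  have h1 := is_derive1_comp (is_derive_expR (P w1)) dP.
  have h := is_deriveB (is_deriveM (is_derive_cst (D w1) w1 1) h1) (dE w1).
  apply: is_derive_eq h _; rewrite /GRing.scale/= /P subrr mul0r expR0; ring.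
have Q0 : 0 <= D w1 * (w1 / 2) - ((w1 + b w1) * D w1 - (w1 / q w1 - 1) / 2 * W w1).
  have [hd <-] := dQ.
  have h : h^-1 *: (Q (h *: (1 : R) + w1) - Q w1) @[h --> 0^'+] --> 'D_1 Q w1.
    by apply: cvg_dnbhs_at_right; exact: hd.
  apply: (cvgr_to_ge h); near=> t.
  have t0 : 0 < t by near: t; exact: nbhs_right_gt.
  apply: mulr_ge0; first by rewrite invr_ge0 ltW.
  rewrite subr_ge0; apply: Qmin.
  by rewrite /GRing.scale/= mulr1 lerDr ltW.
have := b_gt0 w1; have := W0 w1; have := db_le0 w1.
move: Q0 Dw1 w10; move: (D w1) (b w1) (W w1) ((w1 / q w1 - 1) / 2) => d1 b1 W1 b' Q0 d10 w10 b'0 W10 b10.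
nra.
Unshelve. all: by end_near. Qed.

(** From V >= - b W and x >= 0 follows x V + m W >= (m - x b) W = b^2 W. *)
Lemma barrier (x : R) : 0 <= x -> 0 <= x * V x + m * W x.
Proof.
move=> x0; have := D_le0 x0; rewrite /D => h.
have := bE x; have := b_gt0 x; have := W0 x.
move: h; move: (V x) (W x) (b x) => v w b1 h w0 b0 bm.
have : - (b1 * w) <= v by lra.
move=> /(ler_wpM2l x0); rewrite -bm; nra.
Qed.

End barrier.

(** * Growth of the semigroup in the space variable *)

Section growth.
Context {R : realType} dT (T : measurableType dT) (Pr : probability T R).
Variables (d : nat) (Z : 'I_d -> {RV Pr >-> R}) (S : 'M[R]_d).
Hypothesis hZ : std_normal_vector Z.
Implicit Types (kap psi : 'cV[R]_d -> R) (w : 'cV[R]_d) (s c : R).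
Local Notation one := (cst (1 : R) : 'cV[R]_d -> R).

Lemma ou_growth kap psi : continuous kap -> exp_bounded kap -> exp_lipschitz psi ->
  exists C a : R, [/\ 0 <= C, 0 <= a &
    forall s w, 0 < s -> `|ou Z S kap psi s w| <= C * expR (a * norm1 w)].
Proof.
move=> ck bk lp; have [C [a [C0 a0 H]]] := mehler_lipschitz_growth S hZ ck bk lp.
exists (`|mehler Z S kap 0 psi 0| + C), (a + 1); split; rewrite ?addr_ge0// => s w s0.
rewrite -[ou _ _ _ _ _ _](subrK (mehler Z S kap 0 psi 0)) addrC.
have n0 := norm1_ge0 w.
rewrite (le_trans (ler_normD _ _))// mulrDl lerD//.
  by rewrite ler_peMr// -expR0 ler_expR mulr_ge0 ?addr_ge0.
rewrite (le_trans (H (norm1 w) _ _ _ _ _ _ _ _)) ?normr_spread ?norm1_decay ?normr0 ?norm10//.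
rewrite !subr0 [in leRHS]mulrDl expRD mulrCA ler_wpM2l// mulrC ler_wpM2l ?expR_ge0// mul1r.
rewrite (le_trans _ (expR_ge1Dx _))// addrC lerD ?normr_spread ?norm1_decay//.
Qed.

Lemma wdecay_ou_growth psi p c : exp_lipschitz psi ->
  (0 < p)%N \/ c = Ex Pr (fun t => psi (S *m rvec Z t)) ->
  exists C a : R, [/\ 0 <= C, 0 <= a &
    forall s w, 0 < s ->
      `|wdecay p s * (ou Z S one psi s w - c)| <= C * expR (a * norm1 w) * decay s].
Proof.
have cone : continuous one by move=> x; exact: cst_continuous.
have bone : exp_bounded one by exact: exp_bounded_cst.
move=> lp [p0|cE].
  have [C [a [C0 a0 H]]] := ou_growth cone bone lp.
  exists (C + `|c|), a; split; rewrite ?addr_ge0// => s w s0.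
  have /andP[d0 d1] := decay01 (ltW s0).
  rewrite normrM (ger0_norm (wdecay_ge0 _ _)) mulrC ler_pM ?wdecay_ge0//.
    rewrite (le_trans (ler_normB _ _))// mulrDl lerD ?H//.
    by rewrite ler_peMr// -expR0 ler_expR mulr_ge0// norm1_ge0.
  by rewrite -[leRHS]expr1 ler_wiXn2l.
have [C [a [C0 a0 H]]] := mehler_lipschitz_growth S hZ cone bone lp.
exists C, (a + 1); split; rewrite ?addr_ge0// => s w s0.
have n0 := norm1_ge0 w.
have /andP[d0 d1] := decay01 (ltW s0).
rewrite cE (_ : Ex _ _ = mehler Z S one 1 psi 0); last first.
  by rewrite /mehler; congr (Ex Pr _); apply/funext => t; rewrite mul1r add0r scale1r.
rewrite normrM (ger0_norm (wdecay_ge0 _ _)).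
apply: (@le_trans _ _ (1 * ((decay s * norm1 w + decay s) * (C * expR (a * norm1 w))))).
  apply: ler_pM => //; [exact: wdecay_ge0|by rewrite exprn_ile1|].
  rewrite (le_trans (H (norm1 w) _ _ _ _ _ _ _ _)) ?normr_spread ?norm1_decay ?normr1 ?norm10//.
  rewrite ler_wpM2r ?mulr_ge0 ?expR_ge0// subr0 lerD//; last exact: spread_sub1 (ltW s0).
  by rewrite norm1Z ger0_norm.
rewrite mul1r (_ : _ * (C * _) = C * expR (a * norm1 w) * (1 + norm1 w) * decay s); last by ring.
rewrite mulrDl expRD mul1r ler_wpM2r// -mulrA ler_wpM2l// ler_wpM2l ?expR_ge0//.
exact: expR_ge1Dx.
Qed.

Lemma is_derive_wdecay p s : is_derive s 1 (wdecay p) (- (p%:R * wdecay p s)).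
Proof.
pose r (s : R) : R := - (p%:R * s).
have dr : is_derive s 1 r (- p%:R) by apply: is_derive_eq; rewrite /GRing.scale/=; ring.
have h := is_derive1_comp (is_derive_expR (r s)) dr.
rewrite (_ : wdecay p = expR \o r); last by apply/funext => x; rewrite /wdecay decay_exp.
by apply: is_derive_eq h _; rewrite /= /GRing.scale/=; ring.
Qed.

End growth.

(** * The Stein equation in dimension one for Lipschitz functions *)

Section dimension_one.
Context {R : realType} dT (T : measurableType dT) (Pr : probability T R).
Variable Z1 : {RV Pr >-> R}.
Hypothesis hZ1 : is_std_normal Z1.
Notation leb := (@lebesgue_measure R).
Notation D := (`]0%R, +oo[%classic : set R).
Local Notation e0 := (delta_mx 0 0 : 'cV[R]_1).
Local Notation Z := (fun _ : 'I_1 => Z1).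
Local Notation I1 := (1%:M : 'M[R]_1).
Local Notation one := (cst (1 : R) : 'cV[R]_1 -> R).
Implicit Types (s x : R) (w : 'cV[R]_1).

Lemma std_normal_vector1 : std_normal_vector Z.
Proof.
split=> [//|J A mA].
have [h0|h0] := boolP ((0 : 'I_1) \in J).
  have -> : J = [set 0]%SET.
    by apply/setP => i; rewrite finset.in_set1 ord1 h0 eqxx.
  rewrite finset.big_set1; congr (Pr _); apply/seteqP; split=> t /=.
    by apply; rewrite /= finset.in_set1.
  by move=> h i /=; rewrite finset.in_set1 => /eqP ->.
have -> : J = finset.set0.
  by apply/setP => i; rewrite finset.in_set0 ord1 (negPf h0).
rewrite finset.big_set0 -[RHS](probability_setT Pr); congr (Pr _).
by apply/seteqP; split=> t //= _ i /=; rewrite finset.in_set0.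
Qed.

Let hZ := std_normal_vector1.
Let cone : continuous one. Proof. by move=> x; exact: cst_continuous. Qed.
Let bone : exp_bounded one. Proof. exact: exp_bounded_cst. Qed.

Lemma cV1_const_mx w : const_mx (w 0 0) = w.
Proof. by apply/matrixP => i j; rewrite mxE !ord1. Qed.

Lemma is_derive_const_mx (F : 'cV[R]_1 -> R) x l :
  is_derive (const_mx x) e0 F l -> is_derive x 1 (fun x => F (const_mx x)) l.
Proof.
move=> /is_derive_lineP h; apply/is_derive_lineP.
rewrite (_ : (fun t : R => _) = (fun t : R => F (t *: e0 + const_mx x)))//.
apply/funext => t; congr F; apply/matrixP => i j.
by rewrite !mxE !ord1 eqxx /GRing.scale/= mulr1.
Qed.

Lemma decay_lipschitz s s' : 0 <= s -> 0 <= s' -> `|decay s - decay s'| <= `|s - s'|.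
Proof.
wlog ss : s s' / s <= s'.
  move=> W; have [/W//|/ltW/W h] := leP s s'.
  by move=> s0 s0'; rewrite distrC [leRHS]distrC h.
move=> s0 s0'.
have E : decay s' = decay s * expR (- (s' - s)).
  by rewrite /decay -expRD; congr expR; ring.
have /andP[a0 a1] := decay01 s0.
have e1 := expR_ge1Dx (- (s' - s)).
have e2 : expR (- (s' - s)) <= 1 by rewrite -expR0 ler_expR; lra.
rewrite distrC [leRHS]distrC [leRHS]ger0_norm ?subr_ge0//.
rewrite ler0_norm; last by rewrite E; nra.
by rewrite E; nra.
Qed.

(** Multiply by spread s' + spread s >= spread s and use spread^2 = 1 - decay^2. *)
Lemma spread_lipschitz s s' : 0 < s -> 0 <= s' ->
  `|spread s' - spread s| <= 2 / spread s * `|s' - s|.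
Proof.
move=> s0 s0'; have b0 := spread_gt0 s0; have b0' := spread_ge0 s'.
rewrite mulrAC ler_pdivlMr//.
have /andP[a0 a1] := decay01 (ltW s0); have /andP[a0' a1'] := decay01 s0'.
have dl := decay_lipschitz s0' (ltW s0).
apply: (@le_trans _ _ (`|spread s' - spread s| * (spread s' + spread s))).
  by rewrite ler_wpM2l// lerDr.
rewrite -[X in _ * X]ger0_norm ?addr_ge0 ?spread_ge0// -normrM -subr_sqr.
rewrite !spread_sqr ?(ltW s0)//.
rewrite (_ : _ - _ = - ((decay s' - decay s) * (decay s' + decay s))); last by ring.
rewrite normrN normrM mulrC ler_pM//.
by rewrite ger0_norm ?addr_ge0//; lra.
Qed.

(* Differentiability of P_s psi in s when psi is only Lipschitz: integrating by
   parts, P_s psi is expressed through an antiderivative of psi. *)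
Section heat.
Variables (P psi : R -> R).
Hypothesis dP : forall x, is_derive x 1 P (psi x).
Let lpsi (w : 'cV[R]_1) : R := psi (w 0 0).
Let lP (w : 'cV[R]_1) : R := P (w 0 0).
Hypotheses (lip_psi : exp_lipschitz lpsi) (lip_P : exp_lipschitz lP).

Let M w s := mehler Z I1 (dual I1 0) (spread s) lP (decay s *: w).

(** Both sides are the derivative in x of the Mehler integral of [P], taken once under the
    expectation and once by integration by parts. *)
Lemma ou_antiderivative w s : 0 < s -> ou Z I1 one lpsi s w = (spread s)^-1 * M w s.
Proof.
move=> s0; have b0 : spread s != 0 by rewrite gt_eqF// spread_gt0.
have h1 := is_derive_mehler_cst hZ (trmx1 _ _) (unitmx1 _ _) (decay s *: w) 0 b0 lip_P.
have h2 := @is_derive_mehler _ _ _ _ _ Z I1 hZ one (spread s) lP lpsi 0 (decay s *: w) (normr_spread s) cone bone lip_P (fun y => is_derive_lift (dP (y 0 0))).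
by rewrite -(derive_val (is_derive := h1)) (derive_val (is_derive := h2)).
Qed.

Let K2 (z : 'cV[R]_1) : R := z 0 0 ^+ 2.

Lemma dual1E (z : 'cV[R]_1) : dual I1 0 z = z 0 0.
Proof. by rewrite /dual invmx1 mul1mx. Qed.

Let cK2 : continuous K2.
Proof. by apply: continuous_realM; exact: coord_continuous. Qed.

Let bK2 : exp_bounded K2.
Proof.
rewrite (_ : K2 = fun z => dual I1 0 z * dual I1 0 z); last first.
  by apply/funext => z; rewrite dual1E.
by apply: exp_boundedM; exact: exp_bounded_dual.
Qed.

Lemma is_derive_M w s : 0 < s ->
  is_derive s 1 (M w) (- decay s * w 0 0 * ou Z I1 (dual I1 0) lpsi s w +
    decay s ^+ 2 / spread s * ou Z I1 K2 lpsi s w).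
Proof.
move=> s0; have b0 := spread_gt0 s0.
have cd := @continuous_dual R 1 I1 0; have bd := @exp_bounded_dual R 1 I1 0.
have [C [b [C0 b00 H]]] := @mehler_lipschitz_pt R 1 I1 (dual I1 0) lP (norm1 w) bd lip_P.
pose c := s / 2; have c0 : 0 < c by rewrite divr_gt0.
have cs : c < s by rewrite /c; lra.
(* Differentiation under the integral is available at 0 with steps of modulus at most 1; this
   substitution keeps the time positive for such steps. *)
pose sg (t : R) : R := s + c * t.
have sg_gt0 t : `|t| <= 1 -> 0 < sg t.
  by rewrite ler_norml /sg => /andP[t1 _]; nra.
pose F t (o : T) := dual I1 0 (rvec Z o) * lP (decay (sg t) *: w + spread (sg t) *: (I1 *m rvec Z o)).
pose G (o : T) := c * (dual I1 0 (rvec Z o) * (lpsi (decay s *: w + spread s *: (I1 *m rvec Z o)) *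
   (- decay s * w 0 0 + decay s ^+ 2 / spread s * rvec Z o 0 0))).
pose K := c * norm1 w + 2 / spread s * c.
have [||||iG dG] := @is_derive_integral _ _ R Pr setT F G (fun o => K * (C * expR (b * normZ Z o))) measurableT.
- by move=> t t1; apply: integrable_mehler.
- have h1 := integrable_expR_normZ hZ.1 b.
  have h2 := @integrableZl _ _ _ Pr setT measurableT C _ h1.
  exact: (@integrableZl _ _ _ Pr setT measurableT K _ h2).
- move=> t o t1 _; have sg0 : sg 0 = s by rewrite /sg mulr0 addr0.
  rewrite /F sg0 -norm1_rvec [leRHS]mulrA.
  rewrite (le_trans (H _ _ _ _ _ _ _ _ _)) ?normr_spread ?norm1_decay//.
    exact: sg_gt0.
  rewrite ler_wpM2r ?mulr_ge0 ?expR_ge0// -scalerBl norm1Z.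
  have E : `|sg t - s| = c * `|t| by rewrite /sg addrC addKr normrM gtr0_norm.
  have h1 := decay_lipschitz (ltW (sg_gt0 _ t1)) (ltW s0).
  have h2 := spread_lipschitz s0 (ltW (sg_gt0 _ t1)).
  rewrite E in h1 h2.
  rewrite /K mulrDr lerD//.
    by rewrite mulrCA mulrA ler_wpM2r ?norm1_ge0.
  by rewrite (le_trans h2)// le_eqVlt; apply/orP; left; apply/eqP; ring.
- move=> o _; set z := rvec Z o.
  pose X (t : R) : R := decay (sg t) * w 0 0 + spread (sg t) * z 0 0.
  have sg0 : sg 0 = s by rewrite /sg mulr0 addr0.
  have dsg : is_derive (0 : R) 1 sg c.
    by apply: is_derive_eq; rewrite /GRing.scale/=; ring.
  have d1 : is_derive (sg 0) 1 decay (- decay s) by rewrite sg0; exact: is_derive_decay.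
  have d2 : is_derive (sg 0) 1 (@spread R) (decay s ^+ 2 / spread s) by rewrite sg0; exact: is_derive_spread.
  have dX : is_derive (0 : R) 1 X (c * (- decay s * w 0 0 + decay s ^+ 2 / spread s * z 0 0)).
    have h1 := is_deriveM (is_derive1_comp d1 dsg) (is_derive_cst (w 0 0) (0 : R) 1).
    have h2 := is_deriveM (is_derive1_comp d2 dsg) (is_derive_cst (z 0 0) (0 : R) 1).
    have h := is_deriveD h1 h2.
    by apply: is_derive_eq h _; rewrite /GRing.scale/=; ring.
  have h := is_deriveM (is_derive_cst (dual I1 0 z) (0 : R) 1) (is_derive1_comp (dP (X 0)) dX).
  rewrite (_ : F ^~ o = cst (dual I1 0 z) * (P \o X)).
    apply: is_derive_eq h _.
    have XE : (decay s *: w + spread s *: (I1 *m z)) 0 0 = X 0.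
      by rewrite mul1mx /X sg0 mxE [X in X + _]mxE [X in _ + X]mxE.
    rewrite /G -/z /lpsi XE /GRing.scale/=; ring.
  by apply/funext => t; rewrite /F /lP -/z mul1mx /X /= !mxE.
have EG : \int[Pr]_o G o = c * (- decay s * w 0 0 * ou Z I1 (dual I1 0) lpsi s w +
    decay s ^+ 2 / spread s * ou Z I1 K2 lpsi s w).
  have i1 := integrable_mehler I1 hZ (spread s) (decay s *: w) cd bd lip_psi.
  have i2 := integrable_mehler I1 hZ (spread s) (decay s *: w) cK2 bK2 lip_psi.
  have j1 := @integrableZl _ _ _ Pr setT measurableT (- decay s * w 0 0) _ i1.
  have j2 := @integrableZl _ _ _ Pr setT measurableT (decay s ^+ 2 / spread s) _ i2.
  rewrite /ou /mehler !ExE -!RintegralZl// -RintegralD// -RintegralZl//.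
    by apply: eq_Rintegral => o _; rewrite /G dual1E /K2; ring.
  exact: (integrableD measurableT j1 j2).
have dG' : is_derive (0 : R) 1 (fun t => M w (sg t)) (\int[Pr]_o G o).
  by rewrite /M /mehler; under eq_fun do rewrite ExE.
pose r (x : R) : R := (x - s) / c.
have dr : is_derive s 1 r c^-1.
  by apply: is_derive_eq; rewrite /GRing.scale/=; ring.
have dG2 : is_derive (r s) 1 (fun t => M w (sg t)) (\int[Pr]_o G o) by rewrite /r subrr mul0r.
have h := is_derive1_comp dG2 dr.
rewrite (_ : _ \o r = M w) in h.
  by apply: is_derive_eq h _; rewrite EG mulrAC mulfV ?mul1r// gt_eqF.
apply/funext => x; rewrite /= /sg /r; congr (M w _).
by rewrite mulrCA mulfV ?mulr1 ?gt_eqF// addrC subrK.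
Qed.

(** The equation d/ds P_s psi = - w (P_s psi)' + (P_s psi)'', the derivatives in w being expressed
    through the Hermite weights. *)
Lemma is_derive_ou w s : 0 < s ->
  is_derive s 1 (fun s => ou Z I1 one lpsi s w)
    (- (w 0 0 * (decay s / spread s * ou Z I1 (dual I1 0) lpsi s w)) +
     (decay s / spread s) * (decay s / spread s * ou Z I1 (dual2 I1 0 0) lpsi s w)).
Proof.
move=> s0; have b0 : spread s != 0 by rewrite gt_eqF// spread_gt0.
have dV := is_deriveV b0 (is_derive_spread s0).
have h := is_deriveM dV (is_derive_M w s0).
have {}h : is_derive s 1 (fun x => (spread x)^-1 * M w x) _ := h.
have E : \forall x \near s, (spread x)^-1 * M w x = ou Z I1 one lpsi x w.
  have := lt_nbhsr s0; apply: filterS => x x0.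
  by rewrite ou_antiderivative.
apply: near_eq_is_derive E _.
apply: is_derive_eq h _.
have E2 : ou Z I1 (dual2 I1 0 0) lpsi s w = ou Z I1 K2 lpsi s w - ou Z I1 one lpsi s w.
  have i1 := integrable_mehler I1 hZ (spread s) (decay s *: w) cone bone lip_psi.
  have i2 := integrable_mehler I1 hZ (spread s) (decay s *: w) cK2 bK2 lip_psi.
  rewrite /ou /mehler !ExE -RintegralB//; apply: eq_Rintegral => o _.
  have -> : dual2 I1 0 0 (rvec Z o) = K2 (rvec Z o) - 1.
    by rewrite /dual2 !dual1E invmx1 mul1mx [1%:M _ _]mxE eqxx /K2 expr2.
  by rewrite mulrBl.
rewrite E2 ou_antiderivative// /GRing.scale/=.
move: (ou _ _ _ _ _ _) (ou _ _ _ _ _ _) (M w s) (w 0 0) => k l mm ww.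
move: b0; move: (decay s) (spread s) => aa bb b0.
by field.
Qed.

End heat.


Section stein_equation.
Variables (psi : R -> R) (p : nat) (c : R).
Let lpsi (w : 'cV[R]_1) : R := psi (w 0 0).
Hypothesis lip_psi : exp_lipschitz lpsi.
Hypothesis cE : c = if p is 0 then Ex Pr (fun t => lpsi (I1 *m rvec Z t)) else 0.

Lemma continuous_of_lift : continuous psi.
Proof.
have [C [a [C0 a0 H]]] := lip_psi.
move=> x; apply: (@lip_at_continuous _ _ _ (C * expR (a * (2 * `|x| + 1)))) => e e_gt0.
exists 1 => //= y; rewrite /ball_/= => yx.
have := H (const_mx y) (const_mx x); rewrite /lpsi !norm1_cV1 !mxE => h.
rewrite (le_trans h)// mulrAC ler_wpM2r// (@le_trans _ _ (C * expR (a * (2 * `|x| + 1))))//.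
  rewrite ler_wpM2l// ler_expR ler_wpM2l//.
  have : `|y| <= `|x| + `|x - y| by rewrite -{1}[y](subKr x) ler_normB.
  by lra.
by rewrite lerDl ltW.
Qed.

Lemma ex_lift_antiderivative : exists P : R -> R,
  (forall x, is_derive x 1 P (psi x)) /\ exp_lipschitz (fun w : 'cV[R]_1 => P (w 0 0)).
Proof.
have [P dP] := ex_antiderivative continuous_of_lift.
have [C [a [C0 a0 H]]] := exp_lipschitz_bounded lip_psi.
exists P; split=> //; apply: (exp_lipschitz_lift C0 a0 dP) => x.
by have := H (const_mx x); rewrite /lpsi norm1_cV1 !mxE.
Qed.

Let kc : (0 < p)%N \/ c = Ex Pr (fun t => lpsi (I1 *m rvec Z t)).
Proof. by rewrite cE; case: (p) => [|q]; [right|left]. Qed.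

Let cd := @continuous_dual R 1 I1 0.
Let bd := @exp_bounded_dual R 1 I1 0.

(** Integrate the derivative in s of e^(-ps) (P_s psi - c): this function tends to 0 at infinity and
    to psi(w) - c at 0. *)
Lemma stein_equation w :
  \int[leb]_(s in D) (wspread p s * (decay s / spread s * ou Z I1 (dual2 I1 0 0) lpsi s w)) =
  w 0 0 * weighted_ou Z I1 (wspread p) (dual I1 0) lpsi 0 w +
  p%:R * weighted_ou Z I1 (wdecay p) one lpsi c w - psi (w 0 0) + c.
Proof.
have [P [dP lP]] := ex_lift_antiderivative.
have mD : @measurable _ (measurableTypeR R) D by [].
pose f s := - p%:R * (wdecay p s * (ou Z I1 one lpsi s w - c)) +
  (- w 0 0 * (wspread p s * (ou Z I1 (dual I1 0) lpsi s w - 0)) +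
   wspread p s * (decay s / spread s * ou Z I1 (dual2 I1 0 0) lpsi s w)).
pose F s := wdecay p s * (ou Z I1 one lpsi s w - c).
have i1 := integrable_wdecay_ou hZ w lip_psi kc.
have i2 := integrable_wspread_ou I1 hZ p w cd bd lip_psi.
have [i3 _] := is_derive_wspread_ou_dual hZ (trmx1 _ _) (unitmx1 _ _) p w 0 0 lip_psi.
have j1 := @integrableZl _ _ _ leb D mD (- p%:R) _ i1.
have j2 := @integrableZl _ _ _ leb D mD (- w 0 0) _ i2.
have j3 := integrableD mD j2 i3.
have key : \int[leb]_(s in D) f s = 0 - (psi (w 0 0) - c).
  have [C1 [a1 [C10 a10 H1]]] := wdecay_ou_growth hZ lip_psi kc.
  have [C2 H2] := ou_bounded I1 hZ cd bd lip_psi w.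
  have [C3 [C30 H3]] := ou_lipschitz I1 hZ cd bd lip_psi w.
  pose K1 := C1 * expR (a1 * norm1 w).
  (* K (decay^2 / spread + decay) dominates |f|. Its antiderivative K (spread - decay) runs from -K
     to K. *)
  pose K := p%:R * K1 + `|w 0 0| * `|C2| * 2 + C3.
  have K10 : 0 <= K1 by rewrite mulr_ge0 ?expR_ge0.
  have K0 : 0 <= K by rewrite !addr_ge0 ?mulr_ge0.
  have gE s : 0 < s -> 0 <= decay s ^+ 2 / spread s.
    by move=> s0; rewrite divr_ge0 ?sqr_ge0 ?spread_ge0.
  apply: (proj2 (@integral_FTC_half_line R f F (fun s => K * (decay s ^+ 2 / spread s + decay s))
    (fun s => K * (spread s - decay s)) _ _ (- K) K _ _ _ _ _ _ _ _ _)).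
  - move=> s s0; have [a0 _] := andP (decay01 (ltW s0)).
    have dd := decay_div_spread_le s0; have g0 := gE s s0.
    have q0 : 0 <= decay s / spread s by rewrite divr_ge0 ?spread_ge0.
    have wsp : wspread p s <= decay s / spread s.
      rewrite /wspread ler_wpM2r ?invr_ge0 ?spread_ge0// exprS ler_piMr// exprn_ile1//.
      by have /andP[] := decay01 (ltW s0).
    have t1 : `|- p%:R * (wdecay p s * (ou Z I1 one lpsi s w - c))| <=
        p%:R * K1 * (decay s ^+ 2 / spread s + decay s).
      rewrite normrM normrN (ger0_norm (ler0n _ _)) -mulrA ler_wpM2l//.
      rewrite (le_trans (H1 s w s0))// ler_wpM2l// lerDr//.
    have t2 : `|- w 0 0 * (wspread p s * (ou Z I1 (dual I1 0) lpsi s w - 0))| <=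
        `|w 0 0| * `|C2| * 2 * (decay s ^+ 2 / spread s + decay s).
      rewrite subr0 normrM normrN (normrM (wspread p s)) (ger0_norm (wspread_ge0 p s)).
      rewrite (_ : _ * 2 * _ = `|w 0 0| * (2 * (decay s ^+ 2 / spread s + decay s) * `|C2|)); last by ring.
      rewrite ler_wpM2l// ler_pM ?wspread_ge0//; first exact: le_trans dd.
      by rewrite (le_trans (H2 s s0))// ler_norm.
    have t3 : `|wspread p s * (decay s / spread s * ou Z I1 (dual2 I1 0 0) lpsi s w)| <=
        C3 * (decay s ^+ 2 / spread s + decay s).
      have b0 : spread s != 0 by rewrite gt_eqF// spread_gt0.
      have d1 : is_derive w e0 (ou Z I1 (dual I1 0) lpsi s)
          (decay s * ((spread s)^-1 * ou Z I1 (dual2 I1 0 0) lpsi s w)).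
        apply: is_derive_scale.
        exact: (is_derive_mehler_dual hZ (trmx1 _ _) (unitmx1 _ _)).
      have d2 : `|decay s / spread s * ou Z I1 (dual2 I1 0 0) lpsi s w| <= decay s * C3.
        rewrite -mulrA -(derive_val (is_derive := d1)).
        apply: (derive_norm_le (b := cst (decay s * C3))); first exact: mulr_ge0.
          exact: cvg_cst.
        by move=> t t1'; exact: H3.
      rewrite normrM (ger0_norm (wspread_ge0 p s)).
      apply: (@le_trans _ _ (decay s / spread s * (decay s * C3))).
        by rewrite ler_pM// wspread_ge0.
      rewrite (_ : _ * (decay s * C3) = C3 * (decay s ^+ 2 / spread s)); last by ring.
      by rewrite ler_wpM2l// lerDl.
    rewrite /f (le_trans (ler_normD _ _))// /K !mulrDl -addrA lerD//.
    by rewrite (le_trans (ler_normD _ _))// lerD.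
  - move=> s s0.
    have k1 := @continuous_ou _ _ _ Pr 1 Z I1 hZ one lpsi cone bone lip_psi w s s0.
    have k2 := @continuous_ou _ _ _ Pr 1 Z I1 hZ _ lpsi cd bd lip_psi w s s0.
    have k3 := @continuous_ou _ _ _ Pr 1 Z I1 hZ _ lpsi (@continuous_dual2 R 1 I1 0 0) (@exp_bounded_dual2 R 1 I1 0 0) lip_psi w s s0.
    have cM (f1 f2 : R -> R) : {for s, continuous f1} -> {for s, continuous f2} -> {for s, continuous (fun s => f1 s * f2 s)}.
      by move=> h1 h2; exact: continuousM.
    have cD (f1 f2 : R -> R) : {for s, continuous f1} -> {for s, continuous f2} -> {for s, continuous (fun s => f1 s + f2 s)}.
      by move=> h1 h2; exact: continuousD.
    have cc (k : R) : {for s, continuous (fun _ : R => k)} by exact: cst_continuous.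
    have w1 : {for s, continuous (wdecay p)} by exact: continuous_decay_exp.
    have w2 : {for s, continuous (wspread p)} by exact: continuous_decay_spread.
    have w3 : {for s, continuous (fun s => decay s / spread s)}.
      exact: (@continuous_decay_spread R 1 s s0).
    apply: (cD); first by apply: (cM) => //; apply: (cM) => //; exact: (cD).
    apply: (cD); first by apply: (cM) => //; apply: (cM) => //; exact: (cD).
    by apply: (cM) => //; exact: (cM).
  - move=> s s0; apply: continuousM; first exact: cst_continuous.
    apply: continuousD; first exact: continuous_decay_spread.
    exact: continuous_decay.
  - move=> s s0.
    have h := is_deriveM (is_derive_wdecay p s) (is_deriveB (is_derive_ou dP lip_psi lP w s0) (is_derive_cst c s 1)).
    apply: is_derive_eq h _; rewrite /f /GRing.scale/= /wspread /wdecay exprSr.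
    rewrite -/lpsi -[X in _ + X * _]/(ou Z I1 one lpsi s w - c).
    ring.
  - move=> s s0.
    have h := is_deriveM (is_derive_cst K s 1) (is_deriveB (is_derive_spread s0) (is_derive_decay s)).
    apply: is_derive_eq h _; rewrite /GRing.scale/=; ring.
  - have cw : wdecay p s @[s --> 0^'+] --> (1 : R).
      have := @cvg_at_right0 R (wdecay p) (@continuous_decay_exp R p).
      by rewrite /wdecay decay0 expr1n.
    rewrite -[X in _ --> X]mul1r; apply: cvgM => //.
    apply: cvgB; last exact: cvg_cst.
    have [C [C0 H]] := mehler_lipschitz I1 hZ (norm1 w) cone bone lip_psi.
    have E0 : psi (w 0 0) = mehler Z I1 one 0 lpsi w.
      rewrite /mehler ExE; under eq_Rintegral do rewrite mul1r scale0r addr0.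
      by rewrite Rintegral_probability_cst.
    rewrite E0; apply/cvgrPdist_le => e e_gt0.
    have cg : (`|decay s - 1| * norm1 w + `|spread s|) * C @[s --> 0^'+] --> (0 : R).
      rewrite [X in _ --> X](_ : 0 = (`|decay 0 - 1| * norm1 w + `|spread 0|) * C); last first.
        by rewrite decay0 spread0 subrr normr0 mul0r addr0 mul0r.
      apply: cvgM; last exact: cvg_cst.
      apply: cvgD; last by apply: cvg_norm; apply: cvg_at_right0; exact: continuous_spread.
      apply: cvgM; last exact: cvg_cst.
      apply: cvg_norm; apply: cvgB; last exact: cvg_cst.
      by apply: cvg_at_right0; exact: continuous_decay.
    move/cvgr0Pnorm_le : cg => /(_ e e_gt0); apply: filterS2 (nbhs_right_gt 0) => s s0.
    apply: le_trans; rewrite (le_trans _ (ler_norm _))// distrC.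
    rewrite (le_trans (H _ _ _ _ _ _ _ _)) ?normr_spread ?norm1_decay ?normr0//.
    by rewrite subr0 -[X in _ - X]scale1r -scalerBl norm1Z.
  - apply/cvgr0Pnorm_le => e e_gt0.
    have cg : K1 * decay s @[s --> +oo] --> (0 : R).
      by rewrite -[X in _ --> X](mulr0 K1); apply: cvgM; [exact: cvg_cst|exact: cvg_decay_pinfty].
    move/cvgr0Pnorm_le : cg => /(_ e e_gt0); apply: filterS2 (nbhs_pinfty_gt (num_real 0)) => s s0.
    by apply: le_trans; rewrite (le_trans _ (ler_norm _))//; exact: H1.
  - have -> : - K = K * (spread 0 - decay 0) by rewrite spread0 decay0 sub0r mulrN1.
    apply: cvgM; first exact: cvg_cst.
    by apply: cvgB; apply: cvg_at_right0; [exact: continuous_spread|exact: continuous_decay].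
  - rewrite -[X in _ --> X](_ : K * (1 - 0) = K); last by rewrite subr0 mulr1.
    apply: cvgM; first exact: cvg_cst.
    by apply: cvgB; [exact: cvg_spread_pinfty|exact: cvg_decay_pinfty].
have := key.
rewrite /f RintegralD// [X in _ + X]RintegralD// RintegralZl// [X in _ + (X + _)]RintegralZl//.
rewrite -/(weighted_ou Z I1 _ _ _ _ _) -/(weighted_ou Z I1 _ _ _ _ _).
by rewrite /weighted_ou; lra.
Qed.

End stein_equation.

End dimension_one.

(** * Monotonicity and the maximum principle on the whole line *)

Section monotone.
Context {R : realType}.
Implicit Types (x y : R).

Lemma nondecreasing_derive_ge0 (F : R -> R) x l :
  (forall y z, y <= z -> F y <= F z) -> is_derive x 1 F l -> 0 <= l.
Proof.
move=> ndF [hd <-].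
have h : h^-1 *: (F (h *: (1 : R) + x) - F x) @[h --> 0^'+] --> 'D_1 F x.
  by apply: cvg_dnbhs_at_right; exact: hd.
apply: (cvgr_to_ge h); near=> t.
have t0 : 0 < t by near: t; exact: nbhs_right_gt.
apply: mulr_ge0; first by rewrite invr_ge0 ltW.
by rewrite subr_ge0; apply: ndF; rewrite /GRing.scale/= mulr1 lerDr ltW.
Unshelve. all: by end_near. Qed.

(** G' dominates the upper derivate of F, so G + F and G - F have nonnegative lower derivates. *)
Lemma nondecreasing_dominated (F G dG M : R -> R) (sg : R) : `|sg| = 1 ->
  (forall x : R, is_derive x 1 G (dG x)) -> (forall x : R, lip_at F x (M x)) ->
  (forall x : R, M x <= dG x) -> forall x y : R, x <= y -> G x + sg * F x <= G y + sg * F y.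
Proof.
move=> sg1 HG HF Md x y xy.
apply: (dini_nondecreasing (F := fun x => G x + sg * F x)) => // z e _ e0.
have e2 : 0 < e / 2 by rewrite divr_gt0.
have dG0 : is_derive z 1 (fun y => G y - dG z * y) 0.
  have h := is_deriveB (HG z) (is_deriveM (is_derive_cst (dG z) z 1) (is_derive_id z 1)).
  by apply: is_derive_eq h _; rewrite /GRing.scale/=; ring.
have := is_derive_lip_at dG0 e2; apply: filterS2 (HF z _ e2) => u.
rewrite normr0 add0r => h1 h2.
have {}h1 : `|sg * (F u - F z)| <= (M z + e / 2) * `|u - z| by rewrite normrM sg1 mul1r.
have Mz := Md z.
move: h1 h2; rewrite !ler_norml => /andP[a1 a2] /andP[b1 b2].
split=> zu.
  rewrite (ger0_norm (x := u - z)) ?subr_ge0// in a1 a2 b1 b2.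
  have h : (M z) * (u - z) <= dG z * (u - z) by rewrite ler_wpM2r// subr_ge0.
  by move: a1 a2 b1 b2 h; lra.
rewrite (ler0_norm (x := u - z)) ?subr_le0// in a1 a2 b1 b2.
have h : (M z) * (z - u) <= dG z * (z - u) by rewrite ler_wpM2r// subr_ge0.
rewrite opprB in a1 a2 b1 b2 *.
by move: a1 a2 b1 b2 h; lra.
Qed.

Lemma barrier_line (W V y chi : R -> R) (c p m C a : R) : 0 <= p -> m = p + 1 ->
  (forall x : R, is_derive x 1 y (W x)) -> (forall x : R, is_derive x 1 W (V x)) ->
  (forall x : R, V x = x * W x + p * y x - chi x + c) ->
  (forall x z : R, x <= z -> chi x <= chi z) -> continuous chi ->
  (forall x, 0 <= W x) -> 0 <= C -> 0 <= a ->
  (forall x : R, `|chi x| + `|y x| + `|W x| <= C * expR (a * `|x|)) ->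
  forall x, 0 <= x * V x + m * W x.
Proof.
move=> p0 mE dy dW VE chi_nd cc W0 C0 a0 G x.
have [x0|x0] := leP 0 x.
  apply: (@barrier R W V y chi c p m C a) => //.
  by move=> z z0; have := G z; rewrite (ger0_norm z0).
have x0' : 0 <= - x by rewrite oppr_ge0 ltW.
have dN (z : R) : is_derive z 1 (-%R : R -> R) (-1) by exact: is_deriveN.
(* The odd reflections of V, y and chi and the even reflection of W satisfy the same equation with
   -c, and the reflected chi is again nondecreasing. *)
suff : 0 <= - x * (- V (- - x)) + m * W (- - x) by rewrite !opprK mulrNN.
apply: (@barrier R (fun z => W (- z)) (fun z => - V (- z)) (fun z => - y (- z))
  (fun z => - chi (- z)) (- c) p m C a) => //.
- move=> z; have := is_deriveN (is_derive1_comp (dy (- z)) (dN z)).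
  by move=> h; apply: is_derive_eq h _; ring.
- move=> z; have := is_derive1_comp (dW (- z)) (dN z).
  by move=> h; apply: is_derive_eq h _; ring.
- by move=> z; rewrite VE; ring.
- by move=> z u zu; rewrite lerN2; apply: chi_nd; rewrite lerN2.
- move=> z; apply: continuousN; apply: (@continuous_comp _ _ _ -%R chi); last exact: cc.
  exact: opp_continuous.
- by move=> z z0; have := G (- z); rewrite !normrN (ger0_norm z0).
Qed.

End monotone.

(** * The Stein operators in dimension one *)

Section stein_operators.
Context {R : realType} dT (T : measurableType dT) (Pr : probability T R).
Variable Z1 : {RV Pr >-> R}.
Hypothesis hZ1 : is_std_normal Z1.
Variable p : nat.
Notation leb := (@lebesgue_measure R).
Notation D := (`]0%R, +oo[%classic : set R).
Local Notation e0 := (delta_mx 0 0 : 'cV[R]_1).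
Local Notation Z := (fun _ : 'I_1 => Z1).
Local Notation I1 := (1%:M : 'M[R]_1).
Local Notation one := (cst (1 : R) : 'cV[R]_1 -> R).
Implicit Types (s x : R) (w : 'cV[R]_1) (psi : R -> R).

Let hZ := std_normal_vector1 hZ1.
Let cone : continuous one. Proof. by move=> x; exact: cst_continuous. Qed.
Let bone : exp_bounded one. Proof. exact: exp_bounded_cst. Qed.
Let cd := @continuous_dual R 1 I1 0.
Let bd := @exp_bounded_dual R 1 I1 0.
Let mD : @measurable _ (measurableTypeR R) D. Proof. by []. Qed.

Definition lift psi (w : 'cV[R]_1) : R := psi (w 0 0).

Definition mean_term psi : R := if p is 0 then Ex Pr (fun t => lift psi (I1 *m rvec Z t)) else 0.

(* If psi is the p-th derivative of h o g then, up to sign, these are the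
   derivatives of orders p, p + 1 and p + 2 of the Stein solution. *)
Definition stein_y psi x : R := weighted_ou Z I1 (wdecay p) one (lift psi) (mean_term psi) (const_mx x).
Definition stein_W psi x : R := weighted_ou Z I1 (wspread p) (dual I1 0) (lift psi) 0 (const_mx x).
Definition stein_V psi x : R :=
  \int[leb]_(s in D) (wspread p s * (decay s / spread s * ou Z I1 (dual2 I1 0 0) (lift psi) s (const_mx x))).

Let kc psi : (0 < p)%N \/ mean_term psi = Ex Pr (fun t => lift psi (I1 *m rvec Z t)).
Proof. by rewrite /mean_term; case: (p) => [|q]; [right|left]. Qed.

Lemma is_derive_stein_y psi x : exp_lipschitz (lift psi) -> is_derive x 1 (stein_y psi) (stein_W psi x).
Proof.
move=> lp; apply: is_derive_const_mx.
exact: (is_derive_wdecay_ou_cst hZ (trmx1 _ _) (unitmx1 _ _) _ 0 lp (kc psi)).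
Qed.

Lemma is_derive_stein_W psi x : exp_lipschitz (lift psi) -> is_derive x 1 (stein_W psi) (stein_V psi x).
Proof.
move=> lp; apply: is_derive_const_mx.
exact: (is_derive_wspread_ou_dual hZ (trmx1 _ _) (unitmx1 _ _) p (const_mx x) 0 0 lp).2.
Qed.

Lemma stein_VE psi x : exp_lipschitz (lift psi) ->
  stein_V psi x = x * stein_W psi x + p%:R * stein_y psi x - psi x + mean_term psi.
Proof.
by move=> lp; have := stein_equation hZ1 lp (erefl (mean_term psi)) (const_mx x); rewrite !mxE.
Qed.

Lemma exp_lipschitz_lift_linear (a b : R) psi1 psi2 :
  exp_lipschitz (lift psi1) -> exp_lipschitz (lift psi2) ->
  exp_lipschitz (lift (fun x => a * psi1 x + b * psi2 x)).
Proof.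
move=> [C [c [C0 c0 HC]]] [C' [c' [C'0 c'0 HC']]].
exists (`|a| * C + `|b| * C'), (c + c'); split=> [||x y]; rewrite ?addr_ge0 ?mulr_ge0//.
rewrite /lift.
have -> : a * psi1 (x 0 0) + b * psi2 (x 0 0) - (a * psi1 (y 0 0) + b * psi2 (y 0 0)) =
  a * (lift psi1 x - lift psi1 y) + b * (lift psi2 x - lift psi2 y) by rewrite /lift; ring.
have n0 : 0 <= norm1 x + norm1 y by rewrite addr_ge0 ?norm1_ge0.
rewrite (le_trans (ler_normD _ _))// !mulrDl lerD// normrM -!mulrA ler_wpM2l//.
  rewrite (le_trans (HC x y))// -!mulrA ler_wpM2l// ler_wpM2l ?norm1_ge0// ler_expR.
  by rewrite lerDl mulr_ge0.
rewrite (le_trans (HC' x y))// -!mulrA ler_wpM2l// ler_wpM2l ?norm1_ge0// ler_expR.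
by rewrite lerDr mulr_ge0.
Qed.

Lemma stein_W_linear (a b : R) psi1 psi2 x :
  exp_lipschitz (lift psi1) -> exp_lipschitz (lift psi2) ->
  stein_W (fun x => a * psi1 x + b * psi2 x) x = a * stein_W psi1 x + b * stein_W psi2 x.
Proof.
move=> l1 l2; rewrite /stein_W /weighted_ou.
have i1 := integrable_wspread_ou I1 hZ p (const_mx x) cd bd l1.
have i2 := integrable_wspread_ou I1 hZ p (const_mx x) cd bd l2.
have j1 := @integrableZl _ _ _ leb D mD a _ i1.
have j2 := @integrableZl _ _ _ leb D mD b _ i2.
rewrite -!RintegralZl// -RintegralD//; apply: eq_Rintegral => s _.
have k1 := integrable_mehler I1 hZ (spread s) (decay s *: const_mx x) cd bd l1.
have k2 := integrable_mehler I1 hZ (spread s) (decay s *: const_mx x) cd bd l2.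
rewrite /ou /mehler !ExE.
rewrite (_ : \int[Pr]_t _ = a * \int[Pr]_t (dual I1 0 (rvec Z t) * lift psi1 (decay s *: const_mx x + spread s *: (I1 *m rvec Z t))) +
  b * \int[Pr]_t (dual I1 0 (rvec Z t) * lift psi2 (decay s *: const_mx x + spread s *: (I1 *m rvec Z t)))); first by ring.
have m1 := @integrableZl _ _ _ Pr setT measurableT a _ k1.
have m2 := @integrableZl _ _ _ Pr setT measurableT b _ k2.
rewrite -!RintegralZl// -RintegralD//; apply: eq_Rintegral => t _.
by rewrite /lift; ring.
Qed.

Lemma stein_V_linear (a b : R) psi1 psi2 x :
  exp_lipschitz (lift psi1) -> exp_lipschitz (lift psi2) ->
  stein_V (fun x => a * psi1 x + b * psi2 x) x = a * stein_V psi1 x + b * stein_V psi2 x.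
Proof.
move=> l1 l2.
have h := is_derive_stein_W x (exp_lipschitz_lift_linear a b l1 l2).
have h1 := is_derive_stein_W x l1; have h2 := is_derive_stein_W x l2.
have h3 := is_deriveD (is_deriveM (is_derive_cst a x 1) h1) (is_deriveM (is_derive_cst b x 1) h2).
rewrite -(derive_val (is_derive := h)).
rewrite (_ : stein_W _ = cst a * stein_W psi1 + cst b * stein_W psi2); last first.
  by apply/funext => y; exact: stein_W_linear.
by rewrite (derive_val (is_derive := h3)) /GRing.scale/=; ring.
Qed.

Section nondecreasing.
Variable chi : R -> R.
Hypotheses (lc : exp_lipschitz (lift chi)) (chi_nd : forall x z, x <= z -> chi x <= chi z).

(** The semigroup preserves monotonicity, and the weighted expectation is [spread s] times the
    derivative of a nondecreasing function. *)
Lemma stein_W_ge0 x : 0 <= stein_W chi x.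
Proof.
apply: Rintegral_ge0 => s; rewrite /= in_itv/= andbT => s0.
rewrite mulr_ge0 ?wspread_ge0// subr0.
have b0 := spread_gt0 s0; have bn0 : spread s != 0 by rewrite gt_eqF.
pose G (u : R) := mehler Z I1 one (spread s) (lift chi) (const_mx u).
have d1 : is_derive (decay s * x) 1 G ((spread s)^-1 * ou Z I1 (dual I1 0) (lift chi) s (const_mx x)).
  apply: is_derive_const_mx.
  have -> : const_mx (decay s * x) = decay s *: const_mx x :> 'cV[R]_1.
    by apply/matrixP => i j; rewrite !mxE.
  exact: (is_derive_mehler_cst hZ (trmx1 _ _) (unitmx1 _ _)).
have : 0 <= (spread s)^-1 * ou Z I1 (dual I1 0) (lift chi) s (const_mx x).
  apply: nondecreasing_derive_ge0 d1 => y z yz.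
  rewrite /G /mehler !ExE; apply: le_Rintegral => //; [exact: integrable_mehler..|].
  by move=> t _; rewrite !mul1r; apply: chi_nd; rewrite !mxE lerD2r.
by rewrite pmulr_rge0// invr_gt0.
Qed.

Lemma stein_growth : exists C a : R, [/\ 0 <= C, 0 <= a &
  forall x, `|chi x| + `|stein_y chi x| + `|stein_W chi x| <= C * expR (a * `|x|)].
Proof.
have [C1 [a1 [C10 a10 H1]]] := exp_lipschitz_bounded lc.
have [C2 [a2 [C20 a20 H2]]] := wdecay_ou_growth hZ lc (kc chi).
have [C3 [a3 [C30 a30 H3]]] := ou_growth I1 hZ cd bd lc.
pose k := \int[leb]_(s in D) wspread p s.
have k0 : 0 <= k by apply: Rintegral_ge0 => s _; exact: wspread_ge0.
exists (C1 + C2 + C3 * k), (a1 + a2 + a3); split; rewrite ?addr_ge0 ?mulr_ge0// => x.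
have x0 := normr_ge0 x.
have mono (a : R) : 0 <= a -> a <= a1 + a2 + a3 -> expR (a * `|x|) <= expR ((a1 + a2 + a3) * `|x|).
  by move=> _ aa; rewrite ler_expR ler_wpM2r.
have nx : norm1 (const_mx x : 'cV[R]_1) = `|x| by rewrite norm1_cV1 mxE.
set X := expR _; rewrite [leRHS]mulrDl [X in _ <= X + _]mulrDl {}/X lerD//; first rewrite lerD//.
- have := H1 (const_mx x); rewrite nx /lift mxE => h.
  by rewrite (le_trans h)// ler_wpM2l// mono//; lra.
- have [i1 I1'] := @integral_decay R 1 isT.
  rewrite /stein_y /weighted_ou.
  have i := integrable_wdecay_ou hZ (const_mx x) lc (kc chi).
  rewrite (le_trans (le_normr_Rintegral mD i))//.
  apply: (@le_trans _ _ (\int[leb]_(s in D) (C2 * expR (a2 * `|x|) * decay s ^+ 1))).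
    apply: le_Rintegral => //; first exact: integrable_norm.
      exact: (@integrableZl _ _ _ leb D mD _ _ i1).
    by move=> s; rewrite /= in_itv/= andbT => s0; rewrite -nx; exact: H2.
  rewrite RintegralZl// I1' invr1 mulr1 ler_wpM2l// mono//; lra.
- rewrite /stein_W /weighted_ou.
  have i := integrable_wspread_ou I1 hZ p (const_mx x) cd bd lc.
  have iw : leb.-integrable D (EFin \o wspread p) by exact: integrable_decay_spread.
  rewrite (le_trans (le_normr_Rintegral mD i))//.
  apply: (@le_trans _ _ (\int[leb]_(s in D) (C3 * expR (a3 * `|x|) * wspread p s))).
    apply: le_Rintegral => //; first exact: integrable_norm.
      exact: (@integrableZl _ _ _ leb D mD _ _ iw).
    move=> s; rewrite /= in_itv/= andbT => s0.
    rewrite normrM (ger0_norm (wspread_ge0 _ _)) mulrC ler_wpM2r ?wspread_ge0// subr0 -nx.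
    exact: H3.
  rewrite RintegralZl// -/k mulrAC ler_wpM2l ?mulr_ge0// mono//; lra.
Qed.

Lemma stein_barrier x : 0 <= x * stein_V chi x + p.+1%:R * stein_W chi x.
Proof.
have [C [a [C0 a0 G]]] := stein_growth.
have dy z := is_derive_stein_y z lc; have dW z := is_derive_stein_W z lc.
have VE z := stein_VE z lc.
have cc := continuous_of_lift lc.
have p0 : 0 <= p%:R :> R by [].
apply: (@barrier_line R (stein_W chi) (stein_V chi) (stein_y chi) chi (mean_term chi) p%:R p.+1%:R C a).
- exact: p0.
- by rewrite natr1.
- exact: VE.
- exact: chi_nd.
- exact: cc.
- exact: stein_W_ge0.
- exact: C0.
- exact: a0.
- exact: G.
Qed.

End nondecreasing.

End stein_operators.

(** * A regularised power function *)

Section smooth_power.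
Context {R : realType}.
Variables (r dl : R).
Hypotheses (r0 : 0 <= r) (dl0 : 0 < dl).
Implicit Types x : R.

(* A locally Lipschitz majorant of |x|^r, which itself fails to be Lipschitz at 0
   when r < 1; dl tends to 0 in the end. *)
Definition smooth_pow x : R := (x ^+ 2 + dl ^+ 2) `^ (r / 2).

Let base_gt0 x : 0 < x ^+ 2 + dl ^+ 2.
Proof. by rewrite ltr_wpDl ?sqr_ge0// exprn_gt0. Qed.

Let r2 : 0 <= r / 2. Proof. by rewrite divr_ge0. Qed.

Let sqrK x : (x ^+ 2) `^ (r / 2) = `|x| `^ r.
Proof.
rewrite -real_normK ?num_real// -powR_mulrn// -powRrM; congr (_ `^ _).
by rewrite mulrCA mulfV ?mulr1// pnatr_eq0.
Qed.

Lemma powR_le_smooth_pow x : `|x| `^ r <= smooth_pow x.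
Proof.
rewrite -sqrK; apply: ge0_ler_powR => //; rewrite ?nnegrE ?sqr_ge0//.
  exact: ltW.
by rewrite lerDl sqr_ge0.
Qed.

Lemma smooth_pow_le x : smooth_pow x <= (`|x| + dl) `^ r.
Proof.
have x0 := normr_ge0 x.
have h : 0 <= `|x| + dl by rewrite addr_ge0// ltW.
rewrite -[in leRHS](ger0_norm h) -sqrK; apply: ge0_ler_powR => //; rewrite ?nnegrE ?sqr_ge0//.
  exact: ltW.
rewrite -[x ^+ 2]real_normK ?num_real// sqrrD.
by have := mulr_ge0 x0 (ltW dl0); lra.
Qed.

Lemma smooth_pow_ge0 x : 0 <= smooth_pow x. Proof. exact: powR_ge0. Qed.

Lemma is_derive_smooth_pow x : is_derive x 1 smooth_pow (r * x / (x ^+ 2 + dl ^+ 2) * smooth_pow x).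
Proof.
pose q (x : R) : R := x ^+ 2 + dl ^+ 2.
have dq : is_derive x 1 q (2 * x).
  by apply: is_derive_eq; rewrite /GRing.scale/=; ring.
have h := is_derive1_comp (is_derive1_powR (r / 2) (base_gt0 x : 0 < q x)) dq.
apply: is_derive_eq h _; rewrite /smooth_pow -/(q x) powRD; last first.
  by apply/implyP => _; apply: lt0r_neq0; exact: base_gt0.
have q0 : 0 < q x by exact: base_gt0.
rewrite powRN powRr1 ?(ltW q0)//; move: q0; set u := q x `^ (r / 2); move: u (q x) => u v v0.
by field; rewrite gt_eqF.
Qed.

(** 2 |x| dl <= x^2 + dl^2 bounds the factor r x / (x^2 + dl^2) by r / (2 dl). *)
Lemma exp_lipschitz_smooth_pow : exp_lipschitz (lift smooth_pow).
Proof.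
apply: (exp_lipschitz_lift (C := r / (2 * dl) * expR (r * dl)) (a := r) _ _ is_derive_smooth_pow) => //.
  by rewrite mulr_ge0 ?expR_ge0// divr_ge0// mulr_ge0// ltW.
move=> x; have p0 := smooth_pow_ge0 x.
rewrite normrM (ger0_norm p0) -[leRHS]mulrA -expRD ler_pM//.
  rewrite !normrM normfV (ger0_norm (ltW (base_gt0 x))) (ger0_norm r0) -mulrA ler_wpM2l//.
  rewrite ler_pdivrMr// -[in leRHS]real_normK ?num_real//.
  rewrite mulrC ler_pdivlMr ?mulr_gt0//.
  by have := sqr_ge0 (`|x| - dl); rewrite sqrrB; lra.
rewrite (le_trans (smooth_pow_le x))// (le_trans (powR_le_expR r0 _))//.
  by rewrite addr_ge0// ltW.
by rewrite ler_expR; lra.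
Qed.

End smooth_power.

(** * Comparison with an explicit majorant *)

Section comparison.
Context {R : realType} dT (T : measurableType dT) (Pr : probability T R).
Variable Z1 : {RV Pr >-> R}.
Hypothesis hZ1 : is_std_normal Z1.
Variable p : nat.
Notation leb := (@lebesgue_measure R).
Notation D := (`]0%R, +oo[%classic : set R).
Local Notation e0 := (delta_mx 0 0 : 'cV[R]_1).
Local Notation Z := (fun _ : 'I_1 => Z1).
Local Notation I1 := (1%:M : 'M[R]_1).
Local Notation one := (cst (1 : R) : 'cV[R]_1 -> R).
Local Notation W := (stein_W Z1 p).
Local Notation V := (stein_V Z1 p).
Implicit Types (s x : R) (w : 'cV[R]_1) (psi : R -> R).

Let hZ := std_normal_vector1 hZ1.
Let cone : continuous one. Proof. by move=> x; exact: cst_continuous. Qed.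
Let bone : exp_bounded one. Proof. exact: exp_bounded_cst. Qed.
Let cd := @continuous_dual R 1 I1 0.
Let bd := @exp_bounded_dual R 1 I1 0.
Let mD : @measurable _ (measurableTypeR R) D. Proof. by []. Qed.

Lemma stein_comparison (th G dG : R -> R) : exp_lipschitz (lift th) -> exp_lipschitz (lift G) ->
  (forall x : R, is_derive x 1 G (dG x)) -> (forall x : R, lip_at th x (dG x)) ->
  forall x, `|x * V th x + p.+1%:R * W th x| <= x * V G x + p.+1%:R * W G x.
Proof.
move=> lt lG dG' HF x.
have key (sg : R) : `|sg| = 1 -> 0 <= x * (1 * V G x + sg * V th x) + p.+1%:R * (1 * W G x + sg * W th x).
  move=> sg1; rewrite -stein_V_linear// -stein_W_linear//.
  apply: stein_barrier => //; first exact: exp_lipschitz_lift_linear.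
  by move=> y z yz; rewrite !mul1r; exact: (nondecreasing_dominated sg1 dG' HF).
have h1 := key 1 (normr1 _).
have h2 : 0 <= _ := key (-1) (normrN1 _).
move: h1 h2; move: (V G x) (V th x) (W G x) (W th x) (p.+1%:R : R) => v1 v2 w1 w2 k h1 h2.
by rewrite ler_norml; apply/andP; split; lra.
Qed.

Section antiderivative.
Variables (G psi : R -> R).
Hypotheses (dG : forall x : R, is_derive x 1 G (psi x)) (lG : exp_lipschitz (lift G)) (lpsi : exp_lipschitz (lift psi)).

Let kc : (0 < p)%N \/ mean_term Z1 p G = Ex Pr (fun t => lift G (I1 *m rvec Z t)).
Proof. by rewrite /mean_term; case: (p) => [|q]; [right|left]. Qed.

(** [W G] is the derivative of [stein_y], computed here a second time by letting the derivative fall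
    on [G]. *)
Lemma stein_W_antiderivative x :
  W G x = weighted_ou Z I1 (wdecay p.+1) one (lift psi) 0 (const_mx x).
Proof.
have h := is_derive_stein_y hZ1 p x lG.
have h2 : is_derive x 1 (stein_y Z1 p G) (weighted_ou Z I1 (wdecay p.+1) one (lift psi) 0 (const_mx x)).
  apply: is_derive_const_mx.
  exact: (@is_derive_wdecay_ou _ _ _ _ _ _ I1 hZ (lift G) (lift psi) p (mean_term Z1 p G) (const_mx x) 0 lG kc (fun y => is_derive_lift (dG (y 0 0)))).
by rewrite -(derive_val (is_derive := h)) (derive_val (is_derive := h2)).
Qed.

Lemma stein_V_antiderivative x :
  V G x = weighted_ou Z I1 (wspread p.+1) (dual I1 0) (lift psi) 0 (const_mx x).
Proof.
have h := is_derive_stein_W hZ1 p x lG.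
have h2 : is_derive x 1 (W G) (weighted_ou Z I1 (wspread p.+1) (dual I1 0) (lift psi) 0 (const_mx x)).
  rewrite (_ : W G = fun x => weighted_ou Z I1 (wdecay p.+1) one (lift psi) 0 (const_mx x)); last first.
    by apply/funext => y; exact: stein_W_antiderivative.
  apply: is_derive_const_mx.
  by apply: (is_derive_wdecay_ou_cst hZ (trmx1 _ _) (unitmx1 _ _) _ 0 lpsi); left.
by rewrite -(derive_val (is_derive := h)) (derive_val (is_derive := h2)).
Qed.

End antiderivative.

(** Integration by parts for the constant function 1. *)
Lemma Ex_std_normal : \int[Pr]_t Z1 t = 0.
Proof.
have lc : exp_lipschitz (cst (1 : R) : 'cV[R]_1 -> R) by exact: exp_lipschitz_cst.
have h := is_derive_mehler_cst hZ (trmx1 _ _) (unitmx1 _ _) (0 : 'cV[R]_1) 0 (oner_neq0 R) lc.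
have h2 : is_derive (0 : 'cV[R]_1) e0 (mehler Z I1 one 1 (cst 1)) 0.
  rewrite (_ : mehler _ _ _ _ _ = cst (mehler Z I1 one 1 (cst 1) 0)); last exact/funext.
  exact: is_derive_cst.
have := derive_val (is_derive := h); rewrite (derive_val (is_derive := h2)).
rewrite invr1 mul1r /mehler ExE => {1}->; apply: eq_Rintegral => t _.
by rewrite dual1E mxE mulr1.
Qed.

Section power_growth.
Variables (H A B r dl : R).
Hypotheses (H0 : 0 <= H) (B0 : 0 <= B) (r0 : 0 <= r) (dl0 : 0 < dl).
Local Notation psi := (fun x : R => H * A * cst (1 : R) x + H * B * smooth_pow r dl x).
Variable G : R -> R.
Hypotheses (dG : forall x : R, is_derive x 1 G (psi x)) (lG : exp_lipschitz (lift G)).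

Let lc : exp_lipschitz (lift (cst (1 : R))). Proof. exact: exp_lipschitz_cst. Qed.
Let lp : exp_lipschitz (lift (smooth_pow r dl)). Proof. exact: exp_lipschitz_smooth_pow. Qed.
Let lpsi : exp_lipschitz (lift psi). Proof. exact: exp_lipschitz_lift_linear. Qed.
Local Notation Y x := ((`|x| + dl) `^ r).

Let ou_psi kap s x : continuous kap -> exp_bounded kap ->
  ou Z I1 kap (lift psi) s (const_mx x) =
  \int[Pr]_t (H * A * kap (rvec Z t) + H * B * (kap (rvec Z t) * smooth_pow r dl (decay s * x + spread s * Z1 t))).
Proof.
move=> ck bk; rewrite /ou /mehler ExE; apply: eq_Rintegral => t _.
by rewrite /lift mul1mx !mxE /=; ring.
Qed.

Let smooth_ou x s z : 0 < s ->
  smooth_pow r dl (decay s * x + spread s * z) <= 2 `^ r * (Y x + `|z| `^ r).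
Proof.
move=> s0; have /andP[a0 a1] := decay01 (ltW s0); have /andP[b0 b1] := spread01 s.
rewrite (le_trans (smooth_pow_le r0 dl0 _))//.
apply: (@le_trans _ _ ((`|x| + dl + `|z|) `^ r)); last first.
  by apply: powRD_le => //; rewrite addr_ge0// ltW.
apply: ge0_ler_powR => //; rewrite ?nnegrE ?addr_ge0 ?(ltW dl0)//.
rewrite addrAC lerD2r (le_trans (ler_normD _ _))// !normrM (ger0_norm a0) (ger0_norm b0).
by rewrite lerD// ler_piMl.
Qed.

Let int_pow : Pr.-integrable setT (EFin \o (fun t => `|Z1 t| `^ r)).
Proof. exact: (integrable_powR_normal hZ 0 r0). Qed.

Let int_cst (c : R) : Pr.-integrable setT (EFin \o (fun=> c)).
Proof. exact: finite_measure_integrable_cst. Qed.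

(** The factor p + 1 cancels against int_0^oo e^(-(p+1)s) ds. *)
Lemma stein_W_power_le x :
  p.+1%:R * W G x <= H * (A + B * 2 `^ r * (Y x + normal_absmoment r)).
Proof.
set K := H * _.
have [i1 e1] := @integral_decay R p.+1 isT.
rewrite (stein_W_antiderivative dG lG) /weighted_ou.
have key s : 0 < s -> ou Z I1 one (lift psi) s (const_mx x) <= K.
  move=> s0; rewrite ou_psi//.
  have j1 := @integrableZl _ _ _ Pr setT measurableT (H * A) _ (int_cst 1).
  have j2 := integrableD measurableT (int_cst (Y x)) int_pow.
  have j3 := @integrableZl _ _ _ Pr setT measurableT (2 `^ r) _ j2.
  have j4 := @integrableZl _ _ _ Pr setT measurableT (H * B) _ j3.
  have j5 := integrableD measurableT j1 j4.
  apply: (@le_trans _ _ (\int[Pr]_t (H * A * 1 + H * B * (2 `^ r * (Y x + `|Z1 t| `^ r))))).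
    apply: le_Rintegral => //.
      have := integrable_mehler I1 hZ (spread s) (decay s *: const_mx x) cone bone lpsi.
      congr (Pr.-integrable _ _); apply/funext => t; congr (_%:E).
      by rewrite /lift mul1mx !mxE /=; ring.
    move=> t _; rewrite lerD2l ler_wpM2l ?mulr_ge0// mul1r; exact: smooth_ou.
  rewrite RintegralD// RintegralZl// RintegralZl// RintegralZl// RintegralD//.
  rewrite !Rintegral_probability_cst -ExE (Ex_powR_normal hZ 0 r0) /K le_eqVlt; apply/orP; left; apply/eqP.
  by ring.
have i := integrable_wdecay_ou hZ (const_mx x) lpsi (or_introl isT : (0 < p.+1)%N \/ 0 = _).
have i2 := @integrableZl _ _ _ leb D mD K _ i1.
rewrite -ler_pdivlMl ?ltr0n//.
apply: (@le_trans _ _ (\int[leb]_(s in D) (K * decay s ^+ p.+1))).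
  apply: le_Rintegral => // s; rewrite /= in_itv/= andbT => s0.
  by rewrite subr0 mulrC ler_wpM2r ?wdecay_ge0// key.
by rewrite RintegralZl// e1 mulrC.
Qed.

(** No term in [A] appears: the constant part of psi is weighted with Z, and E Z = 0. The rest uses
    E |Z| <= 1 and |Z| |Z|^r = |Z|^(r+1). *)
Lemma stein_V_power_le x :
  `|V G x| <= H * B * 2 `^ r * (Y x + normal_absmoment (r + 1)).
Proof.
set K := _ * (_ + _).
have m0 : 0 <= normal_absmoment (r + 1) :> R.
  rewrite -(Ex_powR_normal hZ 0) ?addr_ge0// ExE.
  by apply: Rintegral_ge0 => t _; exact: powR_ge0.
have K0 : 0 <= K by rewrite !mulr_ge0 ?addr_ge0 ?powR_ge0.
rewrite (stein_V_antiderivative dG lG lpsi) /weighted_ou.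
have iZ : Pr.-integrable setT (EFin \o (fun t => Z1 t)).
  have := integrable_rvec hZ cd bd; congr (Pr.-integrable _ _).
  by apply/funext => t; congr (_%:E); rewrite dual1E mxE.
have key s : 0 < s -> `|ou Z I1 (dual I1 0) (lift psi) s (const_mx x)| <= K.
  move=> s0; rewrite ou_psi//.
  have k1 := @integrableZl _ _ _ Pr setT measurableT (H * A) _ iZ.
  have k2 : Pr.-integrable setT (EFin \o (fun t => Z1 t * smooth_pow r dl (decay s * x + spread s * Z1 t))).
    have := integrable_mehler I1 hZ (spread s) (decay s *: const_mx x) cd bd lp.
    congr (Pr.-integrable _ _); apply/funext => t; congr (_%:E).
    by rewrite dual1E /lift mul1mx !mxE.
  have k3 := @integrableZl _ _ _ Pr setT measurableT (H * B) _ k2.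
  rewrite (_ : \int[Pr]_t _ = \int[Pr]_t (H * A * Z1 t + H * B * (Z1 t * smooth_pow r dl (decay s * x + spread s * Z1 t)))); last first.
    by apply: eq_Rintegral => t _; rewrite dual1E mxE.
  rewrite RintegralD// RintegralZl// Ex_std_normal mulr0 add0r RintegralZl//.
  rewrite normrM ger0_norm ?mulr_ge0// /K -mulrA ler_wpM2l ?mulr_ge0//.
  rewrite (le_trans (le_normr_Rintegral _ k2))//.
  have iZa : Pr.-integrable setT (EFin \o (fun t => `|Z1 t|)) by exact: integrable_norm.
  have j1 := @integrableZl _ _ _ Pr setT measurableT (Y x) _ iZa.
  have r1 : 0 <= r + 1 by rewrite addr_ge0.
  have j2 := integrable_powR_normal hZ 0 r1.
  have j3 := integrableD measurableT j1 j2.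
  have j4 := @integrableZl _ _ _ Pr setT measurableT (2 `^ r) _ j3.
  apply: (@le_trans _ _ (\int[Pr]_t (2 `^ r * (Y x * `|Z1 t| + `|Z1 t| `^ (r + 1))))).
    apply: le_Rintegral => //; first exact: integrable_norm.
    move=> t _; rewrite normrM (ger0_norm (smooth_pow_ge0 _ _ _)).
    have -> : 2 `^ r * (Y x * `|Z1 t| + `|Z1 t| `^ (r + 1)) = `|Z1 t| * (2 `^ r * (Y x + `|Z1 t| `^ r)).
      rewrite powRD; last by rewrite gt_eqF ?implybT// ltr_wpDl.
      by rewrite powRr1//; ring.
    by rewrite ler_wpM2l// smooth_ou.
  rewrite RintegralZl// RintegralD// RintegralZl ?integrable_norm//.
  rewrite -!ExE (Ex_powR_normal hZ 0 r1) ler_wpM2l ?powR_ge0// lerD2r.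
  by rewrite ler_piMr ?powR_ge0// (Ex_normr_normal_le1 hZ 0).
have i := integrable_wspread_ou I1 hZ p.+1 (const_mx x) cd bd lpsi.
rewrite (le_trans (le_normr_Rintegral mD i))//.
have [i1 e1] := @integral_decay_spread R.
apply: (@le_trans _ _ (\int[leb]_(s in D) (K * (decay s ^+ 2 / spread s)))).
  apply: le_Rintegral => //; [exact: integrable_norm|exact: (@integrableZl _ _ _ leb D mD K _ i1)|].
  move=> s; rewrite /= in_itv/= andbT => s0.
  have /andP[a0 a1] := decay01 (ltW s0).
  rewrite normrM (ger0_norm (wspread_ge0 _ _)) mulrC subr0 ler_pM ?wspread_ge0// ?key//.
  by rewrite /wspread ler_wpM2r ?invr_ge0 ?spread_ge0// ler_wiXn2l.
by rewrite RintegralZl// e1 mulr1.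
Qed.

End power_growth.

End comparison.

(** * Column vectors of length one and real numbers *)

Section coordinate.
Context {R : realType}.
Local Notation e0 := (delta_mx 0 0 : 'cV[R]_1).
Implicit Types (F : 'cV[R]_1 -> R) (x : R).

Let quotient_const_mx F x :
  (fun t : R => t^-1 *: (((fun y : R => F (const_mx y)) \o shift x) (t *: (1 : R)) - F (const_mx x))) =
  (fun t : R => t^-1 *: ((F \o shift (const_mx x)) (t *: e0) - F (const_mx x))).
Proof.
apply/funext => t; congr (_ *: (F _ - _)); apply/matrixP => i j.
by rewrite !mxE !ord1 eqxx.
Qed.

Lemma derivable_const_mx F x :
  derivable F (const_mx x) e0 -> derivable (fun y : R => F (const_mx y)) x 1.
Proof. by rewrite /derivable quotient_const_mx. Qed.

Lemma derive_const_mx F x : 'D_1 (fun y : R => F (const_mx y)) x = 'D_e0 F (const_mx x).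
Proof. by rewrite /derive quotient_const_mx. Qed.

Lemma derive1n_const_mx F k :
  derive1n k (fun x : R => F (const_mx x)) = fun x => partials (nseq k 0) F (const_mx x).
Proof.
elim: k => [//|k IH]; apply/funext => x.
by rewrite derive1nS IH derive1E derive_const_mx.
Qed.

End coordinate.

Section subtract_smooth.
Context {R : realType} (u th k : R -> R) (x q : R).
Hypotheses (uE : forall y, u y = th y - k y) (dk : is_derive x 1 k q).

Lemma derivable_sub_smooth : derivable th x 1 -> derivable u x 1.
Proof.
move=> dth; rewrite (_ : u = th - k); last exact/funext.
by apply: derivableB => //; case: dk.
Qed.

(** u and th differ by a function differentiable at x, so both are differentiable there or neither
    is; in the latter case the derivative of u counts as 0. *)
Lemma derive_sub_smooth_le (b : R) : 0 <= b -> `|'D_1 th x| <= b -> `|'D_1 u x| <= `|q| + b.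
Proof.
move=> b0 hb; have [du|ndu] := pselect (derivable u x 1); last first.
  by rewrite /derive dvgP// normr0 addr_ge0.
have dth : is_derive x 1 th ('D_1 u x + q).
  rewrite (_ : th = u + k); first exact: is_deriveD (derivableP du) dk.
  by apply/funext => y; rewrite [RHS]/GRing.add/= uE subrK.
have -> : 'D_1 u x = 'D_1 th x - q by rewrite (derive_val (is_derive := dth)) addrK.
by rewrite (le_trans (ler_normB _ _))// addrC lerD2l.
Qed.

End subtract_smooth.

(** * Case (4) *)

Section part_four.
Context {R : realType} dT (T : measurableType dT) (Pr : probability T R).
Variable Z1 : {RV Pr >-> R}.
Hypothesis hZ1 : is_std_normal Z1.
Local Notation e0 := (delta_mx 0 0 : 'cV[R]_1).
Local Notation Z := (fun _ : 'I_1 => Z1).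
Local Notation I1 := (1%:M : 'M[R]_1).
Variables (A B r : R) (p : nat) (h : R -> R) (g : 'cV[R]_1 -> R).
Hypotheses (A0 : 0 <= A) (B0 : 0 <= B) (r0 : 0 <= r).
Hypotheses (hC : in_Cb p.+1 h) (gC : in_CP p.+1 (Ppow A B (fun=> r)) g).
Implicit Types x t : R.

Let hZ := std_normal_vector1 hZ1.
Let H := hnorm p.+1 h.
Let H0 : 0 <= H. Proof. exact: hnorm_ge0. Qed.
Let phi := h \o g.
Let th x := partials (nseq p 0) phi (const_mx x).
Let F := stein_solution Z I1 phi.
Local Notation W := (stein_W Z1 p th).
Local Notation V := (stein_V Z1 p th).

Let phi_exist : partials_exist p phi := comp_partials_exist hC gC.1.
Let phi_lip (s : seq 'I_1) (sn : (size s <= p)%N) : exp_lipschitz (partials s phi) :=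
  exp_lipschitz_partials_comp A0 B0 (fun=> r0) hC gC sn.

Let lift_th : lift th = partials (nseq p 0) phi.
Proof. by apply/funext => w; rewrite /lift /th cV1_const_mx. Qed.

Let lth : exp_lipschitz (lift th).
Proof. by rewrite lift_th; apply: phi_lip; rewrite size_nseq. Qed.

Let th_increment t x : `|th (t + x) - th x| <= `|t| * (H * (A + B * (`|x| + `|t|) `^ r)).
Proof.
have := partials_comp_top A0 B0 (fun=> r0) hC gC (size_nseq p 0) t 0 (const_mx x).
rewrite /Qpow big_ord1 mxE /th.
by have -> : t *: e0 + const_mx x = const_mx (t + x) by apply/matrixP => i j; rewrite !mxE !ord1 mulr1.
Qed.

Let cvg_growth x (c0 c1 : R) :
  c0 + c1 * (`|x| + `|t|) `^ r @[t --> (0:R)^'] --> c0 + c1 * `|x| `^ r.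
Proof.
apply: cvgD; first exact: cvg_cst.
by apply: cvgM; [exact: cvg_cst|exact: cvg_powR_normr].
Qed.

Let lip_at_th x : lip_at th x (H * (A + B * `|x| `^ r)).
Proof.
move=> e e0.
have h1 : \forall t \near (0:R)^', H * A + H * B * (`|x| + `|t|) `^ r < H * A + H * B * `|x| `^ r + e.
  have hc := @cvg_growth x (H * A) (H * B).
  by apply: (cvgr_lt _ hc); rewrite ltrDl.
have h2 : \forall t \near (0:R), t != 0 -> H * A + H * B * (`|x| + `|t|) `^ r < H * A + H * B * `|x| `^ r + e.
  exact: h1.
rewrite (near_shift 0); apply: filterS h2 => t ht.
rewrite /= subr0 addrK.
have [->|t0] := eqVneq t 0; first by rewrite add0r subrr !normr0 mulr0.
rewrite (le_trans (th_increment t x))// mulrC ler_wpM2r//.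
by rewrite !mulrDr !mulrA ltW// ht.
Qed.

(** For each dl > 0 compare with an antiderivative of H A + H B [smooth_pow r dl]; then let dl = |t|
    tend to 0. *)
Lemma stein_barrier_bound x : `|x * V x + p.+1%:R * W x| <=
  H * (A + B * 2 `^ r * (`|x| `^ r + normal_absmoment r)) +
  `|x| * (H * B * 2 `^ r * (`|x| `^ r + normal_absmoment (r + 1))).
Proof.
pose c0 := H * (A + B * 2 `^ r * normal_absmoment r) + `|x| * (H * B * 2 `^ r * normal_absmoment (r + 1)).
pose c1 := H * B * 2 `^ r + `|x| * (H * B * 2 `^ r).
have cE (y : R) : H * (A + B * 2 `^ r * (y + normal_absmoment r)) +
  `|x| * (H * B * 2 `^ r * (y + normal_absmoment (r + 1))) = c0 + c1 * y by rewrite /c0 /c1; ring.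
rewrite cE. have hc := @cvg_growth x c0 c1; apply: (cvgr_to_ge hc).
near=> t.
have t0 : t != 0 by near: t; exact: nbhs_dnbhs_neq.
have dl0 : 0 < `|t| by rewrite normr_gt0.
rewrite -cE; set dl := `|t| in dl0 *.
have lc : exp_lipschitz (lift (cst (1 : R))) by exact: exp_lipschitz_cst.
have lp := exp_lipschitz_smooth_pow r0 dl0.
have lpsi := exp_lipschitz_lift_linear (H * A) (H * B) lc lp.
have [G [dG lG]] := ex_lift_antiderivative lpsi.
have hG y : lip_at th y (H * A * cst (1 : R) y + H * B * smooth_pow r dl y).
  apply: lip_at_le (lip_at_th y); rewrite mulr1 mulrDr lerD2l mulrA ler_wpM2l ?mulr_ge0//.
  exact: powR_le_smooth_pow.
rewrite (le_trans (stein_comparison hZ1 p lth lG dG hG x))// addrC lerD//.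
  exact: (stein_W_power_le hZ1 p H0 B0 r0 dl0 dG lG).
rewrite (le_trans (ler_norm _))// normrM ler_wpM2l//.
exact: (stein_V_power_le hZ1 p H0 B0 r0 dl0 dG lG).
Unshelve. all: by end_near. Qed.

Let q x := x * V x + p.+1%:R * W x.
Let k x := x * W x + p%:R * stein_y Z1 p th x + mean_term Z1 p th.

Let is_derive_k x : is_derive x 1 k (q x).
Proof.
have h1 := is_deriveM (is_derive_id x 1) (is_derive_stein_W hZ1 p x lth).
have h2 := is_deriveM (is_derive_cst (p%:R : R) x 1) (is_derive_stein_y hZ1 p x lth).
have h3 := is_deriveD (is_deriveD h1 h2) (is_derive_cst (mean_term Z1 p th) x 1).
apply: is_derive_eq h3 _; rewrite /q -natr1 /GRing.scale/=; ring.
Qed.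

Let VE x : - V x = th x - k x.
Proof. by rewrite (stein_VE hZ1 p x lth) /k; ring. Qed.

Lemma derive1n_stein_solution x : derive1n p.+2 (fun w : R => F (const_mx w)) x = - V x.
Proof.
rewrite derive1n_const_mx.
have := @partials_stein_top _ _ _ _ _ _ _ hZ _ _ phi_exist phi_lip (trmx1 _ _) (unitmx1 _ _) [::] (nseq p 0) 0 0 (const_mx x).
by rewrite /= size_nseq add0n leqnn /stein_V lift_th; apply.
Qed.

Let derivable_th x : derivable th x 1 -> derivable (fun y => - V y) x 1.
Proof.
move=> dth;
exact: (derivable_sub_smooth VE (is_derive_k x)). Qed.

Lemma derivable_derive1n_stein x : derivable (derive1n p h) (g (const_mx x)) 1 ->
  derivable (derive1n p.+2 (fun w : R => F (const_mx w))) x 1.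
Proof.
move=> dh; rewrite (_ : derive1n _ _ = fun y => - V y); last first.
  by apply/funext => y; exact: derive1n_stein_solution.
apply: derivable_th; apply: derivable_const_mx.
apply: (partials_comp_derivable gC.1) => //; last by rewrite size_nseq.
by move=> i y ip; case: hC => + _ _; apply.
Qed.

Lemma derivable_derive1n_stein_lt j x : (j < p.+2)%N ->
  derivable (derive1n j (fun w : R => F (const_mx w))) x 1.
Proof.
move=> jp; rewrite derive1n_const_mx; apply: derivable_const_mx.
apply: (stein_partials_existSS hZ A0 B0 (fun=> r0) hC gC (trmx1 _ _) (unitmx1 _ _)).
by rewrite size_nseq.
Qed.

Lemma derive1n_stein_bound x : `|derive1n p.+3 (fun w : R => F (const_mx w)) x| <=
  H * (3 * A + 2 `^ r * B * (`|x| `^ (r + 1) + 2 * `|x| `^ r +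
    `|x| * normal_absmoment (r + 1) + normal_absmoment r)).
Proof.
have M0 (s : R) : 0 <= s -> 0 <= normal_absmoment s :> R.
  move=> s0; rewrite -(Ex_powR_normal hZ 0 s0) ExE.
  by apply: Rintegral_ge0 => t _; exact: powR_ge0.
have r1 : 0 <= r + 1 by rewrite addr_ge0.
have x0 : 0 <= `|x| `^ r by exact: powR_ge0.
have HA : 0 <= H * A by rewrite mulr_ge0.
have two : 1 <= 2 `^ r :> R by rewrite -[leLHS](powRr0 2) ler_powR// ler1n.
apply: (@le_trans _ _ (`|q x| + H * (A + B * `|x| `^ r))); last first.
  have xr : `|x| `^ (r + 1) = `|x| * `|x| `^ r.
    rewrite powRD; last by rewrite gt_eqF// ltr_wpDl.
    by rewrite powRr1// mulrC.
  rewrite xr; apply: le_trans (lerD (stein_barrier_bound x) (lexx _)) _.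
  (* The term B |x|^r contributed by theta' is absorbed through 2^r >= 1. The estimates yield 2 A;
     the third A is slack. *)
  have h1 : H * (B * `|x| `^ r) <= H * (B * `|x| `^ r) * 2 `^ r by rewrite ler_peMr// !mulr_ge0.
  move: h1 HA; move: (H) (`|x| `^ r) (`|x|) (2 `^ r) (normal_absmoment r) (normal_absmoment (r + 1)) => c y z u m1 m2.
  by lra.
rewrite derive1nS (_ : derive1n p.+2 _ = fun y => - V y); last first.
  by apply/funext => y; exact: derive1n_stein_solution.
rewrite derive1E.
have b0 : 0 <= H * (A + B * `|x| `^ r) by rewrite mulr_ge0// addr_ge0// mulr_ge0.
apply: (derive_sub_smooth_le VE (is_derive_k x) b0).
apply: (@derive_norm_le R R th x 1 (fun t => H * (A + B * (`|x| + `|t|) `^ r))) => //.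
  rewrite (_ : (fun t : R => _) = (fun t => H * A + H * B * (`|x| + `|t|) `^ r)); last first.
    by apply/funext => t; ring.
  by rewrite mulrDr mulrA; exact: (@cvg_growth x (H * A) (H * B)).
move=> t _; rewrite (_ : t *: (1 : R) = t); first exact: th_increment.
by rewrite /GRing.scale/= mulr1.
Qed.

End part_four.

Lemma corollary2p2_four (R : realType) (dT : measure_display)
    (T : measurableType dT) (Pr : probability T R)
    (Z : {RV Pr >-> R}) (A B r : R) (n : nat) (h g : R -> R) :
    is_std_normal Z ->
    0 <= A -> 0 <= B -> 0 <= r ->
    (3 <= n)%N -> in_Cb (n - 2) h ->
    let g1 := fun w : 'cV[R]_1 => g (w 0 0) in
    in_CP (n - 2) (Ppow A B (fun=> r)) g1 ->
    let f := fun w : R =>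
      stein_solution (fun=> Z) 1%:M (h \o g1) (const_mx w) in
    [/\ forall k w, (k < n.-1)%N -> derivable (derive1n k f) w 1,
        forall w, derivable (derive1n (n - 3) h) (g w) 1 ->
          derivable (derive1n n.-1 f) w 1 &
        forall w, `|derive1n n f w| <=
          hnorm (n - 2) h *
            (3 * A + 2 `^ r * B *
              (`|w| `^ (r + 1) + 2 * `|w| `^ r
               + `|w| * normal_absmoment (r + 1) + normal_absmoment r))].
Proof.
move=> hZ A0 B0 r0; case: n => [|[|[|p]]]// _; rewrite !subSS !subn0 => hC g1 gC f.
split=> [k w|w dh|w].
- exact: (derivable_derive1n_stein_lt hZ A0 B0 r0 hC gC).
- apply: (derivable_derive1n_stein hZ A0 B0 r0 hC gC).
  by rewrite /g1 mxE.
- exact: (derive1n_stein_bound hZ A0 B0 r0 hC gC).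
Qed.

(* Derivatives of order n need not exist at every point in the first and the
   last case, where test functions h with an n-th (resp. (n-2)-th) derivative
   defined only almost everywhere are allowed: for d = 1, Sigma = 0, h(x) = |x|
   and g = id one finds f(w) = - |w|.  Each case therefore states where the derivatives exist; the displayed bound is about the total
   derivative, i.e. about the points where the derivative exists.

   In the second case the minimum is over the coordinates l occurring among
   i_1, ..., i_n.  For other l the inequality fails: take
   Sigma = diag(1, sigma ^ 2), n = 2, i_1 = i_2 = 1, g(w) = w_1, h = sin and
   l = 2; the left-hand side does not depend on sigma, and the right-hand side
   tends to 0 as sigma tends to infinity. *)
Theorem corollary2p2 (R : realType) (dT : measure_display)
    (T : measurableType dT) (Pr : probability T R) :
  (* (1) *)
  (forall (d : nat) (Z : 'I_d -> {RV Pr >-> R}) (Sigma S : 'M[R]_d)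
      (A B : R) (r : 'I_d -> R) (n : nat) (h : R -> R) (g : 'cV[R]_d -> R),
    std_normal_vector Z ->
    0 <= A -> 0 <= B -> (forall i, 0 <= r i) ->
    nonneg_definite Sigma -> is_sqrtmx Sigma S ->
    (1 <= n)%N -> in_Cb n h -> in_CP n (Ppow A B r) g ->
    let f := stein_solution Z S (h \o g) in
    let Zc := fun (i : 'I_d) (t : T) => (S *m rvec Z t) i 0 in
    [/\ partials_exist n.-1 f,
        (forall x, derivable (derive1n n.-1 h) x 1) \/ pos_definite Sigma ->
          partials_exist n f &
        forall (i : n.-tuple 'I_d) (w : 'cV[R]_d),
          `|partials i f w| <=
            hnorm n h / n%:R *
              (A + B * \sum_k (2 `^ r k *
                 (`|w k 0| `^ r k + Ex Pr (fun t => `|Zc k t| `^ r k))))])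
  /\
  (* (2) and (3) *)
  (forall (d : nat) (Z : 'I_d -> {RV Pr >-> R}) (Sigma S : 'M[R]_d)
      (A B : R) (r : 'I_d -> R) (n : nat) (h : R -> R) (g : 'cV[R]_d -> R),
    std_normal_vector Z ->
    0 <= A -> 0 <= B -> (forall i, 0 <= r i) ->
    pos_definite Sigma -> is_sqrtmx Sigma S ->
    (2 <= n)%N -> in_Cb n.-1 h -> in_CP n.-1 (Ppow A B r) g ->
    let f := stein_solution Z S (h \o g) in
    let Zc := fun (i : 'I_d) (t : T) => (S *m rvec Z t) i 0 in
    let Zinv := fun (l : 'I_d) (t : T) => (invmx S *m rvec Z t) l 0 in
    [/\ partials_exist n f,
        forall (i : n.-tuple 'I_d) (w : 'cV[R]_d),
          `|partials i f w| <=
            hnorm n.-1 h * min_over i (fun l =>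
              A * Ex Pr (fun t => `|Zinv l t|) +
              B * \sum_k (2 `^ r k *
                (`|w k 0| `^ r k * Ex Pr (fun t => `|Zinv l t|) +
                 Ex Pr (fun t => `|Zinv l t| * `|Zc k t| `^ r k)))) &
        Sigma = 1%:M ->
        forall (i : n.-tuple 'I_d) (w : 'cV[R]_d),
          `|partials i f w| <=
            hnorm n.-1 h *
              (A + B * \sum_k (2 `^ r k *
                (`|w k 0| `^ r k + normal_absmoment (r k + 1))))])
  /\
  (* (4): d = 1, with R identified with 'cV[R]_1 *)
  (forall (Z : {RV Pr >-> R}) (A B r : R) (n : nat) (h g : R -> R),
    is_std_normal Z ->
    0 <= A -> 0 <= B -> 0 <= r ->
    (3 <= n)%N -> in_Cb (n - 2) h ->
    let g1 := fun w : 'cV[R]_1 => g (w 0 0) in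
    in_CP (n - 2) (Ppow A B (fun=> r)) g1 ->
    let f := fun w : R =>
      stein_solution (fun=> Z) 1%:M (h \o g1) (const_mx w) in
    [/\ forall k w, (k < n.-1)%N -> derivable (derive1n k f) w 1,
        forall w, derivable (derive1n (n - 3) h) (g w) 1 ->
          derivable (derive1n n.-1 f) w 1 &
        forall w, `|derive1n n f w| <=
          hnorm (n - 2) h *
            (3 * A + 2 `^ r * B *
              (`|w| `^ (r + 1) + 2 * `|w| `^ r
               + `|w| * normal_absmoment (r + 1) + normal_absmoment r))]).
Proof.
split; [|split].
- exact: corollary2p2_one.
- exact: corollary2p2_two.
- exact: corollary2p2_four.
Qed.
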